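(* Let $a,b,c\ge 0$ be integers with $b\le a+c$. Then there is an isomorphism in $\dot{\mathcal U}^+_3$ $$\mathcal E_1^{(a)}\mathcal E_2^{(b)}\mathcal E_1^{(c)}\;\cong\;\bigoplus_{\substack{p+r=b\\ 0\le p\le c\\ 0\le r\le a}}\ \bigoplus_{\alpha\in P(c-p,\,a-r)}\mathcal E_2^{(p)}\mathcal E_1^{(a+c)}\mathcal E_2^{(r)}\{2|\alpha|-(c-p)(a-r)\}.$$
   Context: Partitions: $P(k,l)$ is the set of partitions $\alpha=(\alpha_1\ge\alpha_2\ge\dots\ge 0)$ with at most $k$ parts and $\alpha_1\le l$ (so $P(0,l)=P(k,0)=\{\emptyset\}$), and $|\alpha|=\sum_i\alpha_i$. The category $\mathcal U^+_3$. Put $i\cdot i=2$ for $i\in\{1,2\}$ and $1\cdot 2=2\cdot 1=-1$. Let $\mathcal H$ be the strict monoidal $\mathbb Z$-linear category with $\mathbb Z$-graded Hom groups, generated by objects $\mathcal E_1,\mathcal E_2$ (tensor product written as juxtaposition of objects) and morphisms $x_i:\mathcal E_i\to\mathcal E_i$ of degree $2$ (a dot) and $\tau_{ij}:\mathcal E_i\mathcal E_j\to\mathcal E_j\mathcal E_i$ of degree $-i\cdot j$ (a crossing), for $i,j\in\{1,2\}$, subject to the following relations ($1$ denotes identity morphisms, products are compositions with the rightmost factor applied first): (1) $\tau_{ii}(x_i\otimes 1)-(1\otimes x_i)\tau_{ii}=1=(x_i\otimes 1)\tau_{ii}-\tau_{ii}(1\otimes x_i)$; (2) $\tau_{ii}\tau_{ii}=0$;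 (3) for $i\ne j$: $\tau_{ji}\tau_{ij}=x_i\otimes 1+1\otimes x_j$; (4) for $i\neq j$: $(x_j\otimes 1)\tau_{ij}=\tau_{ij}(1\otimes x_j)$ and $(1\otimes x_i)\tau_{ij}=\tau_{ij}(x_i\otimes 1)$; (5) for all $i,j,k$: $(\tau_{jk}\otimes 1)(1\otimes\tau_{ik})(\tau_{ij}\otimes 1)-(1\otimes\tau_{ij})(\tau_{ik}\otimes 1)(1\otimes\tau_{jk})$ equals $1$ if $i=k\ne j$ and equals $0$ otherwise. Objects of $\mathcal U^+_3$ are formal finite direct sums of $\mathcal E_{i_1}\cdots\mathcal E_{i_k}\{t\}$ with $t\in\mathbb Z$, $i_s\in\{1,2\}$, $k\geq 0$; the group $\mathrm{Hom}(X\{t\},Y\{t'\})$ is the homogeneous part of degree $t-t'$ of $\mathrm{Hom}_{\mathcal H}(X,Y)$. It is monoidal, with shifts adding under tensor product. $\dot{\mathcal U}^+_3$ is the Karoubi envelope (idempotent completion) of $\mathcal U^+_3$; its objects are pairs $(X,e)$ with $e$ an idempotent endomorphism of $X$. The shift $\{t\}$ extends to all objects. Divided powers. On $\mathcal E_i^a=\mathcal E_i\cdots\mathcal E_i$ let $x_1,\dots,x_a$ denote the dots on the strands numbered left to right, $\delta_a=x_1^{a-1}x_2^{a-2}\cdots x_{a-1}$, and $D_a$ the composite of crossings $\tau_{ii}$ along a reduced word of the longest element of the symmetric group $S_a$. Then $e_a=\delta_aD_a$ is an idempotent of degree $0$, and $\mathcal E_i^{(a)}:=(\mathcal E_i^a,e_a)\{-a(a-1)/2\}$,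 with $\mathcal E_i^{(0)}$ the monoidal unit. *)

(* Defs.v *)
From mathcomp Require Import all_boot all_order all_algebra.

Set Implicit Arguments.
Unset Strict Implicit.
Unset Printing Implicit Defensive.

Import Order.TTheory GRing.Theory Num.Theory.

Local Open Scope ring_scope.

Inductive vertex : Set := vx1 | vx2.

Definition idot (i j : vertex) : int :=
  match i, j with
  | vx1, vx1 | vx2, vx2 => 2
  | vx1, vx2 | vx2, vx1 => -1
  end.

(* H is the strict monoidal Z-linear category with graded Hom groups generated by
   objects E_1, E_2 and by dots and crossings.  The word [:: i_1; ...; i_k] is its
   object E_{i_1} ... E_{i_k}; the monoidal product of objects is concatenation,
   the unit is [::]. *)
Notation word := (seq vertex).

(* Formal morphisms u -> v.  [tcomp f g] is "f after g". *)
Inductive term : word -> word -> Type :=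
| tid u : term u u
| tcomp u v w (f : term v w) (g : term u v) : term u w
| ttens u v u' v' (f : term u v) (g : term u' v') : term (u ++ u') (v ++ v')
| tzero u v : term u v
| tadd u v (f g : term u v) : term u v
| topp u v (f : term u v) : term u v
| tdot i : term [:: i] [:: i]
| tcross i j : term [:: i; j] [:: j; i].

Declare Scope term_scope.
Delimit Scope term_scope with T.
Bind Scope term_scope with term.

Notation "f \oc g" := (tcomp f g) (at level 40, left associativity) : term_scope.
Notation "f \ot g" := (ttens f g) (at level 39, left associativity) : term_scope.
Notation "f \oa g" := (tadd f g) (at level 50, left associativity) : term_scope.
Notation "f \os g" := (tadd f (topp g)) (at level 50, left associativity)
  : term_scope.

Reserved Notation "f =h g" (at level 70, no associativity).

(* The congruence on formal morphisms generated by the axioms of a strict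
   monoidal Z-linear category and by the defining relations; a morphism of H is
   an equivalence class of terms.  The relation is heterogeneous only because
   (u ++ v) ++ w and u ++ (v ++ w), and u ++ [::] and u, are provably equal but
   not convertible: f =h g relates parallel morphisms only.  The degree plays no
   role in the interchange law (no Koszul signs). *)
Inductive teq : forall u v u' v', term u v -> term u' v' -> Prop :=
| teq_refl u v (f : term u v) : f =h f
| teq_sym u v u' v' (f : term u v) (g : term u' v') : f =h g -> g =h f
| teq_trans u v u' v' u'' v''
    (f : term u v) (g : term u' v') (h : term u'' v'') :
    f =h g -> g =h h -> f =h h
| teq_comp u v w u' v' w' (f : term v w) (g : term u v)
    (f' : term v' w') (g' : term u' v') :
    f =h f' -> g =h g' -> (f \oc g)%T =h (f' \oc g')%T
| teq_tens u1 v1 u2 v2 u1' v1' u2' v2' (f : term u1 v1) (g : term u2 v2)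
    (f' : term u1' v1') (g' : term u2' v2') :
    f =h f' -> g =h g' -> (f \ot g)%T =h (f' \ot g')%T
| teq_add u v u' v' (f g : term u v) (f' g' : term u' v') :
    f =h f' -> g =h g' -> (f \oa g)%T =h (f' \oa g')%T
| teq_opp u v u' v' (f : term u v) (f' : term u' v') :
    f =h f' -> topp f =h topp f'
| teq_addA u v (f g h : term u v) : (f \oa (g \oa h))%T =h (f \oa g \oa h)%T
| teq_addC u v (f g : term u v) : (f \oa g)%T =h (g \oa f)%T
| teq_add0 u v (f : term u v) : (tzero u v \oa f)%T =h f
| teq_addN u v (f : term u v) : (f \os f)%T =h tzero u v
| teq_compA u v w z (f : term w z) (g : term v w) (h : term u v) :
    (f \oc (g \oc h))%T =h (f \oc g \oc h)%T
| teq_comp1l u v (f : term u v) : (tid v \oc f)%T =h f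
| teq_comp1r u v (f : term u v) : (f \oc tid u)%T =h f
| teq_compDl u v w (f g : term v w) (h : term u v) :
    ((f \oa g) \oc h)%T =h (f \oc h \oa g \oc h)%T
| teq_compDr u v w (f : term v w) (g h : term u v) :
    (f \oc (g \oa h))%T =h (f \oc g \oa f \oc h)%T
| teq_tens1 u v : (tid u \ot tid v)%T =h tid (u ++ v)
| teq_tens_comp u v w u' v' w' (f : term v w) (g : term u v)
    (f' : term v' w') (g' : term u' v') :
    ((f \ot f') \oc (g \ot g'))%T =h ((f \oc g) \ot (f' \oc g'))%T
| teq_tensA u1 v1 u2 v2 u3 v3
    (f : term u1 v1) (g : term u2 v2) (h : term u3 v3) :
    (f \ot (g \ot h))%T =h (f \ot g \ot h)%T
| teq_tens1l u v (f : term u v) : (tid [::] \ot f)%T =h f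
| teq_tens1r u v (f : term u v) : (f \ot tid [::])%T =h f
| teq_tensDl u v u' v' (f g : term u v) (h : term u' v') :
    ((f \oa g) \ot h)%T =h (f \ot h \oa g \ot h)%T
| teq_tensDr u v u' v' (f : term u v) (g h : term u' v') :
    (f \ot (g \oa h))%T =h (f \ot g \oa f \ot h)%T
| teq_nil1 i :
    (tcross i i \oc (tdot i \ot tid [:: i]) \os
     (tid [:: i] \ot tdot i) \oc tcross i i)%T =h tid [:: i; i]
| teq_nil2 i :
    ((tdot i \ot tid [:: i]) \oc tcross i i \os
     tcross i i \oc (tid [:: i] \ot tdot i))%T =h tid [:: i; i]
| teq_cross2_eq i : (tcross i i \oc tcross i i)%T =h tzero [:: i; i] [:: i; i]
| teq_cross2_neq i j : i <> j ->
    (tcross j i \oc tcross i j)%T =h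
    (tdot i \ot tid [:: j] \oa tid [:: i] \ot tdot j)%T
| teq_slide1 i j : i <> j ->
    ((tdot j \ot tid [:: i]) \oc tcross i j)%T =h
    (tcross i j \oc (tid [:: i] \ot tdot j))%T
| teq_slide2 i j : i <> j ->
    ((tid [:: j] \ot tdot i) \oc tcross i j)%T =h
    (tcross i j \oc (tdot i \ot tid [:: j]))%T
| teq_braid0 i j k : ~ (i = k /\ i <> j) ->
    ((tcross j k \ot tid [:: i]) \oc (tid [:: j] \ot tcross i k)
       \oc (tcross i j \ot tid [:: k]) \os
     (tid [:: k] \ot tcross i j) \oc (tcross i k \ot tid [:: j])
       \oc (tid [:: i] \ot tcross j k))%T =h tzero [:: i; j; k] [:: k; j; i]
| teq_braid1 i j : i <> j ->
    ((tcross j i \ot tid [:: i]) \oc (tid [:: j] \ot tcross i i)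
       \oc (tcross i j \ot tid [:: i]) \os
     (tid [:: i] \ot tcross i j) \oc (tcross i i \ot tid [:: j])
       \oc (tid [:: i] \ot tcross j i))%T =h tid [:: i; j; i]
where "f =h g" := (teq f g).

(* [homog d f]: the morphism of H represented by f is homogeneous of degree d. *)
Inductive homog : int -> forall u v, term u v -> Prop :=
| homog_eq d u v u' v' (f : term u v) (g : term u' v') :
    f =h g -> homog d f -> homog d g
| homog_id u : homog 0 (tid u)
| homog_comp d e u v w (f : term v w) (g : term u v) :
    homog d f -> homog e g -> homog (d + e) (f \oc g)%T
| homog_tens d e u v u' v' (f : term u v) (g : term u' v') :
    homog d f -> homog e g -> homog (d + e) (f \ot g)%T
| homog_zero d u v : homog d (tzero u v)
| homog_add d u v (f g : term u v) :
    homog d f -> homog d g -> homog d (f \oa g)%T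
| homog_opp d u v (f : term u v) : homog d f -> homog d (topp f)
| homog_dot i : homog 2 (tdot i)
| homog_cross i j : homog (- idot i j) (tcross i j).

(* An object of U_3^+: the formal direct sum, over x : idx X, of the shifted
   words (wd x){sh x}. *)
Record obj := Obj { idx : finType; wd : idx -> word; sh : idx -> int }.

(* Matrices of morphisms of H; those of degree 0 in the sense of [hom_ok] are
   the morphisms X -> Y of U_3^+. *)
Definition hom (X Y : obj) : Type :=
  forall (x : idx X) (y : idx Y), term (wd x) (wd y).

Definition hom_ok (X Y : obj) (M : hom X Y) : Prop :=
  forall x y, homog (sh x - sh y) (M x y).

Definition heq (X Y : obj) (M N : hom X Y) : Prop :=
  forall x y, M x y =h N x y.

Definition hcomp (X Y Z : obj) (M : hom Y Z) (N : hom X Y) : hom X Z :=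
  fun x z => \big[@tadd (wd x) (wd z) / tzero (wd x) (wd z)]_(y : idx Y)
               (M y z \oc N x y)%T.

Definition otens (X Y : obj) : obj :=
  @Obj (idx X * idx Y)%type (fun p => wd p.1 ++ wd p.2)
       (fun p => sh p.1 + sh p.2).

Definition htens (X Y X' Y' : obj) (M : hom X Y) (M' : hom X' Y') :
  hom (otens X X') (otens Y Y') :=
  fun p q => (M p.1 q.1 \ot M' p.2 q.2)%T.

Definition ozero : obj :=
  @Obj void (fun x => match x with end) (fun x => match x with end).

Definition osum (X Y : obj) : obj :=
  @Obj (idx X + idx Y)%type
       (fun s => match s with inl x => wd x | inr y => wd y end)
       (fun s => match s with inl x => sh x | inr y => sh y end).

Definition hsum (X Y X' Y' : obj) (M : hom X Y) (M' : hom X' Y') :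
  hom (osum X X') (osum Y Y') :=
  fun s t => match s, t with
  | inl x, inl y => M x y
  | inr x, inr y => M' x y
  | inl x, inr y => tzero (wd x) (wd y)
  | inr x, inl y => tzero (wd x) (wd y)
  end.

Definition oshift (t : int) (X : obj) : obj :=
  @Obj (idx X) (@wd X) (fun x => sh x + t).

(* Pairs (X, e); the objects of the Karoubi envelope of U_3^+ are those
   satisfying [kobj_ok]. *)
Record kpair := KPair { kobj : obj; kidem : hom kobj kobj }.
Arguments kidem : clear implicits.

Definition kobj_ok (A : kpair) : Prop :=
  hom_ok (kidem A) /\ heq (hcomp (kidem A) (kidem A)) (kidem A).

Definition khom_ok (A B : kpair) (M : hom (kobj A) (kobj B)) : Prop :=
  [/\ hom_ok M, heq (hcomp (kidem B) M) M & heq (hcomp M (kidem A)) M].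

(* A and B are isomorphic objects of the Karoubi envelope; the identity of A is
   [kidem A].  (The existence of M and N already forces both idempotents.) *)
Definition kiso (A B : kpair) : Prop :=
  [/\ kobj_ok A, kobj_ok B &
    exists (M : hom (kobj A) (kobj B)) (N : hom (kobj B) (kobj A)),
      [/\ khom_ok M, khom_ok N,
          heq (hcomp N M) (kidem A) & heq (hcomp M N) (kidem B)]].

Definition ktens (A B : kpair) : kpair :=
  @KPair (otens (kobj A) (kobj B)) (htens (kidem A) (kidem B)).

Definition kzero : kpair :=
  @KPair ozero (fun x _ => match x with end).

Definition ksum (A B : kpair) : kpair :=
  @KPair (osum (kobj A) (kobj B)) (hsum (kidem A) (kidem B)).

Definition kshift (t : int) (A : kpair) : kpair :=
  @KPair (oshift t (kobj A)) (kidem A).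

(* The dot on strand k of E_i^a, for k < a, strands being numbered from 0 from
   the left (junk value: the identity). *)
Fixpoint dot_at (i : vertex) (a k : nat) : term (nseq a i) (nseq a i) :=
  match a return term (nseq a i) (nseq a i) with
  | 0 => tid [::]
  | a'.+1 => if k is k'.+1 then ttens (tid [:: i]) (dot_at i a' k')
             else ttens (tdot i) (tid (nseq a' i))
  end.

(* The crossing of strands k and k+1 of E_i^a, for k.+1 < a (junk value: the
   identity). *)
Fixpoint cross_at (i : vertex) (a k : nat) : term (nseq a i) (nseq a i) :=
  match a return term (nseq a i) (nseq a i) with
  | 0 => tid [::]
  | a'.+1 => if k is k'.+1 then ttens (tid [:: i]) (cross_at i a' k') else
      match a' return term (nseq a'.+1 i) (nseq a'.+1 i) with
      | 0 => tid [:: i]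
      | a''.+1 => ttens (tcross i i) (tid (nseq a'' i))
      end
  end.

Definition tprod (u : word) (s : seq (term u u)) : term u u :=
  foldr (@tcomp u u u) (tid u) s.

(* x_1^(a-1) x_2^(a-2) ... x_(a-1) *)
Definition delta (i : vertex) (a : nat) : term (nseq a i) (nseq a i) :=
  tprod (flatten [seq nseq (a - k.+1) (dot_at i a k) | k <- iota 0 a]).

(* s_0 (s_1 s_0) (s_2 s_1 s_0) ... (s_(a-2) ... s_0), where s_k exchanges k and
   k+1: a reduced word, of length a(a-1)/2, of the longest element of S_a. *)
Definition longest_word (a : nat) : seq nat :=
  flatten [seq rev (iota 0 m) | m <- iota 0 a].

Definition Dlong (i : vertex) (a : nat) : term (nseq a i) (nseq a i) :=
  tprod [seq cross_at i a k | k <- longest_word a].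

Definition divpow (i : vertex) (a : nat) : kpair :=
  kshift (- ((a * a.-1)./2)%:Z)
    (@KPair (@Obj unit (fun=> nseq a i) (fun=> 0))
            (fun _ _ => (delta i a \oc Dlong i a)%T)).

(* Partitions with at most k parts, all at most l, padded with zeros to a weakly
   decreasing k-tuple. *)
Definition parts (k l : nat) : {set k.-tuple 'I_l.+1} :=
  [set al : k.-tuple 'I_l.+1 | sorted geq [seq val x | x <- al]].

Definition psize (k l : nat) (al : k.-tuple 'I_l.+1) : nat :=
  (\sum_(x <- al) x)%N.

(* Main.v *)
Require Import Defs.
From mathcomp Require Import all_boot all_order all_algebra.
From mathcomp Require Import all_fingroup ring lra zify.
From Stdlib Require Import ClassicalEpsilon FunctionalExtensionality.
From Stdlib Require Import Setoid Morphisms.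

Set Implicit Arguments.
Unset Strict Implicit.
Unset Printing Implicit Defensive.

Import Order.TTheory GRing.Theory Num.Theory.
Local Open Scope ring_scope.

(** Morphisms of H act on functions of lists of distinct positive rationals, one
    point per strand: a dot multiplies by a coordinate, a crossing of strands of
    the same colour is a divided difference, and a mixed crossing is a swap, for
    one of the two orders of the colours multiplied by the sum of the
    coordinates.  The action is faithful: a morphism into [E_j v] is a sum of
    morphisms [x^m (1 (x) r) w_K], where [w_K] pulls a strand [j] from position
    [K] to the left; for the largest [K] involved, suitable test functions turn
    the first coordinate into the variable of a polynomial with coefficients the
    actions of the [r], and one concludes by induction on [v].  So identities
    between morphisms may be checked on functions.

    There [D_a] is the alternating sum divided by the Vandermonde determinant, so
    that the two sides become functions [f(A,Y,C)] and [g(P,X,R)] symmetric in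
    each group of points.  Put [chi_L = \prod_(y in L) ('X + y)] and
    [n = a + c - b].  The morphism to the summand [(p,r,alpha)] antisymmetrizes
    [f] over all the points [X] of colour 1 against the polynomials
    [chi_Y 'X^l] ([l] in a (c-p)-subset of [0,n) encoding [alpha]) and
    [chi_R 'X^j] ([j < p]) in the points [C]; the morphism back uses
    [chi_P 'X^j] ([j < r]) and [chi_Y 'X^k] ([k] in the complementary subset) in
    the points [A].  A composite [M N] is then governed by the determinant of the
    coefficients of [a + c] polynomials, which is zero for different summands,
    and otherwise is, up to sign, the resultant of [chi_P] and [chi_R]; this
    gives [M N = delta].  The relation [\sum N M = 1] follows, because the [M] are
    jointly injective: the [chi_Y 'X^l] ([l < n]) and the [chi_(Y - y)]
    ([y in Y]) span the polynomials of degree less than [a + c]. *)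

(** The congruence [teq] gives no access to linear independence of morphisms, and Z-linearity
    forbids averaging over symmetric groups. Hence the action is on arbitrary functions and not on
    polynomials only: a test function may be concentrated on the orderings of the points that have a
    given point in a given place. Integers matter only for the unit object, and there they embed in
    the rationals. In a composite [M N] the resultant of [chi_P] and [chi_R] vanishes unless the two
    groups are disjoint. Among the ways to split the points of colour 2 anew it therefore selects
    the original one, and its value there is what the denominator of the alternating sum over these
    points requires. This is why one morphism carries [chi_P] and the other [chi_R]. The constant
    that remains is a sign, corrected in [M]. The relation for the sum of the [N M] needs no count
    of dimensions: its defect is killed by every [M], because [M N = delta]. *)

Local Notation hom := Defs.hom.
Local Notation funext := functional_extensionality.

(** * Semantics of terms *)

Notation fn := (seq rat -> rat).

(** The factor sits on one of the two mixed crossings only, so that each round trip of two mixed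
    crossings multiplies by [a + b] exactly once, as the quadratic relation demands. *)
Definition scross (i j : vertex) (h : fn) : fn := fun s =>
  let a := nth 0 s 0 in let b := nth 0 s 1 in
  match i, j with
  | vx1, vx1 | vx2, vx2 => (h [:: a; b] - h [:: b; a]) / (a - b)
  | vx1, vx2 => h [:: b; a]
  | vx2, vx1 => (a + b) * h [:: b; a]
  end.

(* A morphism [u -> v] turns functions of [size u] points into functions of
   [size v] points. *)
Fixpoint sem u v (f : term u v) {struct f} : fn -> fn :=
  match f with
  | tid _ => fun h => h
  | tcomp _ _ _ f g => fun h => sem f (sem g h)
  | ttens _ v _ _ f g => fun h s =>
      sem f (fun s1 => sem g (fun s2 => h (s1 ++ s2)) (drop (size v) s))
        (take (size v) s)
  | tzero _ _ => fun _ _ => 0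
  | tadd _ _ f g => fun h s => sem f h s + sem g h s
  | topp _ _ f => fun h s => - sem f h s
  | tdot _ => fun h s => nth 0 s 0 * h s
  | tcross i j => scross i j
  end.

Lemma sem_lin u v (f : term u v) (k : rat) (h h' : fn) s :
  sem f (fun s => k * h s + h' s) s = k * sem f h s + sem f h' s.
Proof.
elim: f k h h' s => {u v} /=.
- by [].
- move=> u v w f IHf g IHg k h h' s; rewrite -IHf; congr (sem f _ _).
  by apply: funext => x; apply: IHg.
- move=> u v u' v' f IHf g IHg k h h' s; rewrite -IHf; congr (sem f _ _).
  by apply: funext => x; apply: IHg.
- by move=> *; ring.
- by move=> u v f IHf g IHg k h h' s; rewrite IHf IHg; ring.
- by move=> u v f IHf k h h' s; rewrite IHf; ring.
- by move=> *; ring.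
- by move=> [] [] k h h' s; rewrite /scross; ring.
Qed.

Lemma sem0 u v (f : term u v) s : sem f (fun=> 0) s = 0.
Proof.
transitivity (sem f (fun x => -1 * (fun=> 0) x + (fun=> 0) x) s).
  by congr (sem f _ _); apply: funext => x; ring.
by rewrite sem_lin; ring.
Qed.

Lemma semD u v (f : term u v) (h h' : fn) s :
  sem f (fun s => h s + h' s) s = sem f h s + sem f h' s.
Proof.
rewrite -[sem f h s]mul1r -sem_lin; congr (sem f _ _).
by apply: funext => x; ring.
Qed.

Lemma semZ u v (f : term u v) k (h : fn) s :
  sem f (fun s => k * h s) s = k * sem f h s.
Proof.
rewrite -[RHS]addr0 -(sem0 f s) -sem_lin; congr (sem f _ _).
by apply: funext => x; ring.
Qed.

Lemma semZr u v (f : term u v) k (h : fn) s :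
  sem f (fun s => h s * k) s = sem f h s * k.
Proof.
rewrite mulrC -semZ; congr (sem f _ _).
by apply: funext => x; ring.
Qed.

Lemma semN u v (f : term u v) (h : fn) s :
  sem f (fun s => - h s) s = - sem f h s.
Proof.
rewrite -mulN1r -semZ; congr (sem f _ _).
by apply: funext => x; ring.
Qed.

Lemma sem_sum u v (f : term u v) (I : Type) (r : seq I) (P : pred I)
    (h : I -> fn) s :
  sem f (fun s => \sum_(i <- r | P i) h i s) s = \sum_(i <- r | P i) sem f (h i) s.
Proof.
elim: r => [|i r IH].
  rewrite big_nil -[RHS](sem0 f s); congr (sem f _ _).
  by apply: funext => x; rewrite big_nil.
rewrite big_cons -IH; case: ifP => Pi.
  rewrite -semD; congr (sem f _ _).
  by apply: funext => x; rewrite big_cons Pi.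
congr (sem f _ _).
by apply: funext => x; rewrite big_cons Pi.
Qed.

(** All generators preserve the length of words, so a change of length can come only from a [tzero].
    This disposes of the ill-matched intermediate words in later inductions. *)
Lemma sem_size u v (f : term u v) h s : size u != size v -> sem f h s = 0.
Proof.
elim: f h s => {u v} /=.
- by move=> u h s; rewrite eqxx.
- move=> u v w f IHf g IHg h s neq.
  have [e|ne] := eqVneq (size v) (size w); last exact: IHf.
  have -> : sem g h = fun=> 0; last exact: sem0.
  by apply: funext => x; apply: IHg; rewrite e.
- move=> u v u' v' f IHf g IHg h s neq.
  have [e|ne] := eqVneq (size u) (size v); last exact: IHf.
  rewrite -[RHS](sem0 f (take (size v) s)); congr (sem f _ _).
  apply: funext => x; apply: IHg.
  by move: neq; rewrite !size_cat e eqn_add2l.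
- by [].
- by move=> u v f IHf g IHg h s neq; rewrite IHf // IHg // addr0.
- by move=> u v f IHf h s neq; rewrite IHf // oppr0.
- by [].
- by [].
Qed.

(** Crossings merely permute the points. Hence the action restricts to tuples of distinct positive
    numbers, and a function may be altered off the orderings of [s]. *)
Lemma sem_local u v (f : term u v) (h h' : fn) s : size s = size v ->
  (forall s', perm_eq s' s -> h s' = h' s') -> sem f h s = sem f h' s.
Proof.
elim: f h h' s => {u v} /=.
- by move=> u h h' s _; apply.
- move=> u v w f IHf g IHg h h' s sz E.
  have [e|ne] := eqVneq (size v) (size w); last by rewrite !sem_size.
  apply: IHf => // s' ps; apply: IHg; first by rewrite (perm_size ps) sz.
  by move=> s'' ps'; apply: E; apply: perm_trans ps.
- move=> u v u' v' f IHf g IHg h h' s; rewrite size_cat => sz E.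
  apply: IHf; first by rewrite size_take_min sz (minn_idPl (leq_addr _ _)).
  move=> s1 p1; apply: IHg; first by rewrite size_drop sz addKn.
  by move=> s2 p2; apply: E; rewrite -(cat_take_drop (size v) s) perm_cat.
- by [].
- by move=> u v f IHf g IHg h h' s sz E; rewrite (IHf _ h') // (IHg _ h').
- by move=> u v f IHf h h' s sz E; rewrite (IHf _ h').
- by move=> i h h' s sz E; rewrite E.
- move=> i j h h' [|a [|b [|]]] //= _ E.
  have E1 : h [:: a; b] = h' [:: a; b] by apply: E.
  have E2 : h [:: b; a] = h' [:: b; a].
    by apply: E; rewrite -[[:: b; a]]/([:: b] ++ [:: a]) perm_catC.
  by case: i j => [] []; rewrite /scross /= ?E1 ?E2.
Qed.

(** The source of the interchange law: operators on disjoint groups of points commute. *)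
Lemma sem_fubini u v u' v' (f : term u v) (g : term u' v')
    (h : seq rat -> seq rat -> rat) t1 t2 :
  sem f (fun s1 => sem g (fun s2 => h s1 s2) t2) t1 =
  sem g (fun s2 => sem f (fun s1 => h s1 s2) t1) t2.
Proof.
elim: f h t1 => {u v} /=.
- by [].
- move=> u v w f IHf g1 IHg h t1.
  rewrite -IHf; congr (sem f _ _).
  by apply: funext => x; rewrite -IHg.
- move=> u v w x f IHf g1 IHg h t1.
  rewrite -(IHf (fun s1 s2 => sem g1 _ _)); congr (sem f _ _).
  by apply: funext => y; rewrite IHg.
- by move=> u v h t1; rewrite sem0.
- by move=> u v f IHf g1 IHg h t1; rewrite semD IHf IHg.
- by move=> u v f IHf h t1; rewrite semN IHf.
- by move=> i h t1; rewrite semZ.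
- move=> [] [] h t1; rewrite /scross ?semZ // semZr; congr (_ / _);
  by rewrite semD semN.
Qed.

(* The points are positive because [t + a] has to be invertible. *)
Definition generic (s : seq rat) := uniq s && all (fun x => 0 < x) s.

Lemma generic_perm s s' : perm_eq s s' -> generic s = generic s'.
Proof. by move=> p; rewrite /generic (perm_uniq p) (perm_all _ p). Qed.

Lemma generic_cat s s' : generic (s ++ s') -> generic s /\ generic s'.
Proof.
rewrite /generic cat_uniq all_cat.
by case/andP => /and3P[-> _ ->] /andP[-> ->].
Qed.

Lemma generic_take n s : generic s -> generic (take n s).
Proof. by rewrite -{1}(cat_take_drop n s) => /generic_cat[]. Qed.

Lemma generic_drop n s : generic s -> generic (drop n s).
Proof. by rewrite -{1}(cat_take_drop n s) => /generic_cat[]. Qed.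

Lemma teq_type u v u' v' (f : term u v) (g : term u' v') :
  teq f g -> u = u' /\ v = v'.
Proof.
elim=> //=.
- by move=> *; intuition.
- by move=> u1 v1 u2 v2 u3 v3 f1 f2 f3 _ [-> ->] _ [-> ->].
- by move=> ? ? ? ? ? ? ? ? ? ? _ [_ ->] _ [-> _].
- by move=> ? ? ? ? ? ? ? ? ? ? ? ? _ [-> ->] _ [-> ->].
- by move=> *; rewrite !catA.
- by move=> *; rewrite !cats0.
Qed.

Lemma subr_neq0 (x y : rat) : x != y -> x - y != 0 /\ y - x != 0.
Proof. by rewrite !subr_eq0 [y == x]eq_sym. Qed.

(** The relations between crossings of equal colours rely on distinct points, where no divided
    difference divides by zero; the other axioms are formal. *)
Lemma sem_sound u v u' v' (f : term u v) (g : term u' v') :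
  teq f g -> forall h s, size s = size v -> generic s -> sem f h s = sem g h s.
Proof.
elim=> {u v u' v' f g} /=.
- by [].
- by move=> u v u' v' f g fg IH h s sz gs; rewrite IH // (teq_type fg).2.
- move=> u v u' v' u2 v2 f g k fg IH gk IH2 h s sz gs.
  by rewrite IH // IH2 // -(teq_type fg).2.
- move=> u v w u' v' w' f g f' g' ff IHf gg IHg h s sz gs.
  have [? ?] := teq_type ff; have [? ?] := teq_type gg; subst.
  rewrite IHf //.
  have [e|ne] := eqVneq (size v') (size w'); last by rewrite !sem_size.
  apply: sem_local => // s' ps; apply: IHg; first by rewrite (perm_size ps) sz.
  by rewrite (generic_perm ps).
- move=> u1 v1 u2 v2 u1' v1' u2' v2' f g f' g' ff IHf gg IHg h s sz gs.
  have [? ?] := teq_type ff; have [? ?] := teq_type gg; subst.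
  move: sz; rewrite size_cat => sz.
  rewrite IHf //; last exact: generic_take.
    apply: sem_local; first by rewrite size_take_min sz (minn_idPl (leq_addr _ _)).
    move=> s' ps; apply: IHg; last exact: generic_drop.
    by rewrite size_drop sz addKn.
  by rewrite size_take_min sz (minn_idPl (leq_addr _ _)).
- move=> u v u' v' f g f' g' ff IHf gg IHg h s sz gs.
  by rewrite IHf // IHg.
- by move=> u v u' v' f g ff IHf h s sz gs; rewrite IHf.
1-4: by move=> *; ring.
1-4: by [].
- by move=> u v w f g h k s sz gs; rewrite -semD.
- by move=> u v h s sz gs; rewrite cat_take_drop.
- move=> u v w u' v' w' f g f' g' h s; rewrite size_cat => sz gs.
  set t1 := take _ s; set t2 := drop _ s.
  have s1 : size t1 = size w by rewrite size_take_min sz (minn_idPl (leq_addr _ _)).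
  have s2 : size t2 = size w' by rewrite size_drop sz addKn.
  have [e|ne] := eqVneq (size v) (size w); last by rewrite !(sem_size f).
  have [e'|ne] := eqVneq (size v') (size w'); last first.
    have z k t : sem f' k t = 0 by exact: sem_size.
    transitivity (sem f (fun=> 0) t1).
      by congr (sem f _ _); apply: funext => x.
    congr (sem f _ _); apply: funext => x.
    transitivity (sem g (fun=> 0) x); first by rewrite sem0.
    by congr (sem g _ _); apply: funext => y.
  transitivity (sem f (fun s0 => sem f' (fun s3 =>
     sem g (fun s4 => sem g' (fun s5 => h (s4 ++ s5)) s3) s0) t2) t1).
    apply: sem_local => // s3 p3; apply: sem_local => // s4 p4.
    by rewrite take_size_cat ?drop_size_cat ?(perm_size p3) ?e.
  congr (sem f _ _); apply: funext => x.
  by rewrite sem_fubini.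
- move=> u1 v1 u2 v2 u3 v3 f g k h s; rewrite !size_cat => sz gs.
  have -> : take (size v1) (take (size v1 + size v2) s) = take (size v1) s.
    by rewrite take_takel // leq_addr.
  have -> : drop (size v2) (drop (size v1) s) = drop (size v1 + size v2) s.
    by rewrite drop_drop addnC.
  have -> : drop (size v1) (take (size v1 + size v2) s) =
            take (size v2) (drop (size v1) s).
    by rewrite take_drop addnC.
  congr (sem f _ _); apply: funext => x.
  congr (sem g _ _); apply: funext => y.
  by congr (sem k _ _); apply: funext => z; rewrite catA.
- by move=> u v f h s sz gs; rewrite drop0 take0.
- move=> u v f h s; rewrite cats0 => sz gs; rewrite drop_oversize ?sz // -sz take_size.
  by congr (sem f _ _); apply: funext => x; rewrite cats0.
- by [].
- move=> u v u' v' f g k h s sz gs; rewrite -semD.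
  by congr (sem f _ _); apply: funext => x.
all: rewrite /scross.
1-3: move=> i h [|a [|b [|]]] //= _; rewrite /generic /= inE => /andP[/andP[ab _] _];
  have [? ?] := subr_neq0 ab; by case: i => /=; field; do ?[apply/andP; split].
1-3: by move=> [] [] // _ h [|a [|b [|]]] //= _ _; ring.
- move=> i j k ijk h [|a [|b [|c [|]]]] //= _.
  rewrite /generic /= !inE negb_or => /andP[/and3P[/andP[ab ac] bc _] _].
  have [? ?] := subr_neq0 ab; have [? ?] := subr_neq0 ac; have [? ?] := subr_neq0 bc.
  case: i j k ijk => [] [] [] ijk /=; try (by case: ijk; split); field;
    by do ?[apply/andP; split].
- move=> i j ij h [|a [|b [|c [|]]]] //= _.
  rewrite /generic /= !inE negb_or => /andP[/and3P[/andP[ab ac] bc _] _].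
  have [? ?] := subr_neq0 ab; have [? ?] := subr_neq0 ac; have [? ?] := subr_neq0 bc.
  by case: i j ij => [] [] // ij /=; field;
    do ?[apply/andP; split].
Qed.

(** * Calculus of terms *)

#[local] Hint Resolve teq_refl : core.

#[global] Instance teq_equiv u v : Equivalence (@teq u v u v).
Proof.
split=> [f|f g|f g h]; [exact: teq_refl | exact: teq_sym | exact: teq_trans].
Qed.

#[global] Instance tcomp_proper u v w :
  Proper (@teq v w v w ==> @teq u v u v ==> @teq u w u w) (@tcomp u v w).
Proof. by move=> f f' ff g g' gg; apply: teq_comp. Qed.

#[global] Instance tadd_proper u v :
  Proper (@teq u v u v ==> @teq u v u v ==> @teq u v u v) (@tadd u v).
Proof. by move=> f f' ff g g' gg; apply: teq_add. Qed.

#[global] Instance topp_proper u v :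
  Proper (@teq u v u v ==> @teq u v u v) (@topp u v).
Proof. by move=> f f' ff; apply: teq_opp. Qed.

Lemma teq_addr0 u v (f : term u v) : (f \oa tzero u v)%T =h f.
Proof. by rewrite teq_addC teq_add0. Qed.

Lemma teq_addK u v (f g : term u v) : (f \oa g \os g)%T =h f.
Proof. by rewrite -teq_addA teq_addN teq_addr0. Qed.

Lemma teq_addI u v (f g h : term u v) : (f \oa h)%T =h (g \oa h)%T -> f =h g.
Proof. by move=> E; rewrite -(teq_addK f h) E teq_addK. Qed.

Lemma teq_subr u v (f g h : term u v) : (f \os g)%T =h h -> f =h (g \oa h)%T.
Proof.
by move=> <-; rewrite teq_addC -teq_addA (teq_addC (topp g)) teq_addN teq_addr0.
Qed.

Lemma teq_0comp u v w (f : term u v) : (tzero v w \oc f)%T =h tzero u w.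
Proof.
apply: (@teq_addI _ _ _ _ (tzero v w \oc f)%T).
by rewrite -teq_compDl !teq_add0.
Qed.

Lemma teq_comp0 u v w (f : term v w) : (f \oc tzero u v)%T =h tzero u w.
Proof.
apply: (@teq_addI _ _ _ _ (f \oc tzero u v)%T).
by rewrite -teq_compDr !teq_add0.
Qed.

Lemma teq_oppE u v (f g : term u v) : (f \oa g)%T =h tzero u v -> g =h topp f.
Proof.
move=> E; apply: (@teq_addI _ _ _ _ f).
by rewrite (teq_addC _ f) E teq_addC teq_addN.
Qed.

Lemma teq_oppcomp u v w (f : term v w) (g : term u v) :
  (topp f \oc g)%T =h topp (f \oc g)%T.
Proof. by apply: teq_oppE; rewrite -teq_compDl teq_addN teq_0comp. Qed.

Lemma teq_compopp u v w (f : term v w) (g : term u v) :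
  (f \oc topp g)%T =h topp (f \oc g)%T.
Proof. by apply: teq_oppE; rewrite -teq_compDr teq_addN teq_comp0. Qed.

Lemma teq_tens0 u v u' v' (f : term u v) :
  (f \ot tzero u' v')%T =h tzero (u ++ u') (v ++ v').
Proof.
apply: (@teq_addI _ _ _ _ (f \ot tzero u' v')%T).
rewrite teq_add0 -teq_tensDr.
exact: (teq_tens (teq_refl f) (teq_add0 _)).
Qed.

Lemma teq_0tens u v u' v' (f : term u v) :
  (tzero u' v' \ot f)%T =h tzero (u' ++ u) (v' ++ v).
Proof.
apply: (@teq_addI _ _ _ _ (tzero u' v' \ot f)%T).
rewrite teq_add0 -teq_tensDl.
exact: (teq_tens (teq_add0 _) (teq_refl f)).
Qed.

Lemma teq_tensopp u v u' v' (f : term u v) (g : term u' v') :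
  (f \ot topp g)%T =h topp (f \ot g)%T.
Proof.
apply: teq_oppE; rewrite -teq_tensDr.
exact: teq_trans (teq_tens (teq_refl f) (teq_addN g)) (teq_tens0 _ _ f).
Qed.

Lemma teq_opptens u v u' v' (f : term u v) (g : term u' v') :
  (topp g \ot f)%T =h topp (g \ot f)%T.
Proof.
apply: teq_oppE; rewrite -teq_tensDl.
exact: teq_trans (teq_tens (teq_addN g) (teq_refl f)) (teq_0tens _ _ f).
Qed.

(** This and the next two terms are typed with [::] and not with [++], so that composites meet
    convertible words and can be rewritten. *)
Definition lw i u v (f : term u v) : term (i :: u) (i :: v) :=
  (tid [:: i] \ot f)%T.
Definition dt i v : term (i :: v) (i :: v) := (tdot i \ot tid v)%T.
Definition cr i j v : term (i :: j :: v) (j :: i :: v) :=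
  (tcross i j \ot tid v)%T.

#[global] Instance lw_proper i u v :
  Proper (@teq u v u v ==> @teq (i :: u) (i :: v) (i :: u) (i :: v)) (@lw i u v).
Proof. by move=> f g fg; exact: (teq_tens (teq_refl (tid [:: i])) fg). Qed.

Lemma lw1 i u : lw i (tid u) =h tid (i :: u).
Proof. exact: (teq_tens1 [:: i] u). Qed.

Lemma lwM i u v w (f : term v w) (g : term u v) :
  lw i (f \oc g)%T =h (lw i f \oc lw i g)%T.
Proof.
apply: teq_sym.
apply: teq_trans (teq_tens_comp (tid [:: i]) (tid [:: i]) f g) _.
exact: (teq_tens (teq_comp1l (tid [:: i])) (teq_refl (f \oc g)%T)).
Qed.

Lemma lwD i u v (f g : term u v) : lw i (f \oa g)%T =h (lw i f \oa lw i g)%T.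
Proof. exact: (teq_tensDr (tid [:: i]) f g). Qed.

Lemma lwN i u v (f : term u v) : lw i (topp f) =h topp (lw i f).
Proof. exact: (teq_tensopp (tid [:: i]) f). Qed.

Lemma lw0 i u v : lw i (tzero u v) =h tzero (i :: u) (i :: v).
Proof. exact: (teq_tens0 u v (tid [:: i])). Qed.

Lemma dt_lw i u v (f : term u v) : (dt i v \oc lw i f)%T =h (lw i f \oc dt i u)%T.
Proof.
apply: teq_trans (teq_tens_comp (tdot i) (tid [:: i]) (tid v) f) _.
apply: teq_trans (teq_sym (teq_tens_comp (tid [:: i]) (tdot i) f (tid u))).
have E : (tdot i \oc tid [:: i])%T =h (tid [:: i] \oc tdot i)%T.
  by rewrite teq_comp1l teq_comp1r.
apply: (teq_tens E); by rewrite teq_comp1l teq_comp1r.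
Qed.

Lemma lw_lw i j u v (f : term u v) : lw i (lw j f) =h (tid [:: i; j] \ot f)%T.
Proof.
apply: teq_trans (teq_tensA (tid [:: i]) (tid [:: j]) f) _.
exact: (teq_tens (teq_tens1 [:: i] [:: j]) (teq_refl f)).
Qed.

Lemma cr_lw i j u v (f : term u v) :
  (cr i j v \oc lw i (lw j f))%T =h (lw j (lw i f) \oc cr i j u)%T.
Proof.
apply: teq_trans (teq_comp (teq_refl _) (lw_lw i j f)) _.
apply: teq_trans (teq_sym (teq_comp (lw_lw j i f) (teq_refl _))).
apply: teq_trans (teq_tens_comp (tcross i j) (tid [:: i; j]) (tid v) f) _.
apply: teq_trans (teq_sym (teq_tens_comp (tid [:: j; i]) (tcross i j) f (tid u))).
have E : (tcross i j \oc tid [:: i; j])%T =h (tid [:: j; i] \oc tcross i j)%T.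
  by rewrite teq_comp1l teq_comp1r.
apply: (teq_tens E); by rewrite teq_comp1l teq_comp1r.
Qed.

Lemma dot_whisk i j v : ((tdot i \ot tid [:: j]) \ot tid v)%T =h dt i (j :: v).
Proof.
apply: teq_trans (teq_sym (teq_tensA (tdot i) (tid [:: j]) (tid v))) _.
exact: (teq_tens (teq_refl (tdot i)) (teq_tens1 [:: j] v)).
Qed.

Lemma lw_dot_whisk i j v : ((tid [:: j] \ot tdot i) \ot tid v)%T =h lw j (dt i v).
Proof. exact: (teq_sym (teq_tensA (tid [:: j]) (tdot i) (tid v))). Qed.

Lemma whiskM u v w (f : term v w) (g : term u v) x :
  ((f \oc g) \ot tid x)%T =h ((f \ot tid x) \oc (g \ot tid x))%T.
Proof.
apply: teq_trans (teq_sym (teq_tens_comp f g (tid x) (tid x))).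
exact: (teq_tens (teq_refl (f \oc g)%T) (teq_sym (teq_comp1l (tid x)))).
Qed.

Lemma teq_whisk u v (f g : term u v) x : f =h g -> (f \ot tid x)%T =h (g \ot tid x)%T.
Proof. by move=> E; apply: (teq_tens E). Qed.

Lemma whisk_sub2 x u v (f g h : term u v) :
  (f \os g)%T =h h -> (f \ot tid x)%T =h (g \ot tid x \oa h \ot tid x)%T.
Proof.
move=> /teq_subr /(teq_whisk x) E; apply: teq_trans E _; exact: teq_tensDl.
Qed.

Lemma cr_dt_eq i v :
  (cr i i v \oc dt i (i :: v))%T =h (lw i (dt i v) \oc cr i i v \oa tid (i :: i :: v))%T.
Proof.
have E := whisk_sub2 v (teq_nil1 i).
have E1 := teq_trans (whiskM (tcross i i) (tdot i \ot tid [:: i])%T v)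
  (teq_comp (teq_refl _) (dot_whisk i i v)).
have E2 := teq_trans (whiskM (tid [:: i] \ot tdot i)%T (tcross i i) v)
  (teq_comp (lw_dot_whisk i i v) (teq_refl _)).
exact: (teq_trans (teq_sym E1) (teq_trans E (teq_add E2 (teq_tens1 [:: i; i] v)))).
Qed.

Lemma cr_lwdt_eq i v :
  (cr i i v \oc lw i (dt i v))%T =h (dt i (i :: v) \oc cr i i v \os tid (i :: i :: v))%T.
Proof.
suff E : (dt i (i :: v) \oc cr i i v)%T =h (cr i i v \oc lw i (dt i v) \oa tid (i :: i :: v))%T.
  by rewrite E teq_addK.
have E := whisk_sub2 v (teq_nil2 i).
have E1 := teq_trans (whiskM (tdot i \ot tid [:: i])%T (tcross i i) v)
  (teq_comp (dot_whisk i i v) (teq_refl _)).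
have E2 := teq_trans (whiskM (tcross i i) (tid [:: i] \ot tdot i)%T v)
  (teq_comp (teq_refl _) (lw_dot_whisk i i v)).
exact: (teq_trans (teq_sym E1) (teq_trans E (teq_add E2 (teq_tens1 [:: i; i] v)))).
Qed.

Lemma cr_dt_neq i j v : i <> j ->
  (cr i j v \oc dt i (j :: v))%T =h (lw j (dt i v) \oc cr i j v)%T.
Proof.
move=> ij; have E := teq_whisk v (teq_slide2 ij).
have E1 := teq_trans (whiskM (tid [:: j] \ot tdot i)%T (tcross i j) v)
  (teq_comp (lw_dot_whisk i j v) (teq_refl _)).
have E2 := teq_trans (whiskM (tcross i j) (tdot i \ot tid [:: j])%T v)
  (teq_comp (teq_refl _) (dot_whisk i j v)).
exact: (teq_trans (teq_sym E2) (teq_trans (teq_sym E) E1)).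
Qed.

Lemma cr_lwdt_neq i j v : i <> j ->
  (cr i j v \oc lw i (dt j v))%T =h (dt j (i :: v) \oc cr i j v)%T.
Proof.
move=> ij; have E := teq_whisk v (teq_slide1 ij).
have E1 := teq_trans (whiskM (tdot j \ot tid [:: i])%T (tcross i j) v)
  (teq_comp (dot_whisk j i v) (teq_refl _)).
have E2 := teq_trans (whiskM (tcross i j) (tid [:: i] \ot tdot j)%T v)
  (teq_comp (teq_refl _) (lw_dot_whisk j i v)).
exact: (teq_trans (teq_sym E2) (teq_trans (teq_sym E) E1)).
Qed.

Lemma cr_cr_eq i v : (cr i i v \oc cr i i v)%T =h tzero (i :: i :: v) (i :: i :: v).
Proof.
have E := teq_whisk v (teq_cross2_eq i).
have E1 := whiskM (tcross i i) (tcross i i) v.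
exact: (teq_trans (teq_sym E1) (teq_trans E (teq_0tens [:: i; i] [:: i; i] (tid v)))).
Qed.

Lemma cr_cr_neq i j v : i <> j ->
  (cr j i v \oc cr i j v)%T =h (dt i (j :: v) \oa lw i (dt j v))%T.
Proof.
move=> ij; have E := teq_whisk v (teq_cross2_neq ij).
have E1 := whiskM (tcross j i) (tcross i j) v.
have E2 := teq_trans (teq_tensDl (tdot i \ot tid [:: j]) (tid [:: i] \ot tdot j) (tid v))%T
  (teq_add (dot_whisk i j v) (lw_dot_whisk j i v)).
exact: (teq_trans (teq_sym E1) (teq_trans E E2)).
Qed.

Lemma cr_whisk i j k v : ((tcross i j \ot tid [:: k]) \ot tid v)%T =h cr i j (k :: v).
Proof.
apply: teq_trans (teq_sym (teq_tensA (tcross i j) (tid [:: k]) (tid v))) _.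
exact: (teq_tens (teq_refl (tcross i j)) (teq_tens1 [:: k] v)).
Qed.

Lemma lw_cr_whisk i j k v : ((tid [:: k] \ot tcross i j) \ot tid v)%T =h lw k (cr i j v).
Proof. exact: (teq_sym (teq_tensA (tid [:: k]) (tcross i j) (tid v))). Qed.

(** The right-hand side [h] of the braid relation is kept general, to serve the two cases below. *)
Lemma braid_aux i j k v (h : term [:: i; j; k] [:: k; j; i]) :
  ((tcross j k \ot tid [:: i]) \oc (tid [:: j] \ot tcross i k)
       \oc (tcross i j \ot tid [:: k]) \os
     (tid [:: k] \ot tcross i j) \oc (tcross i k \ot tid [:: j])
       \oc (tid [:: i] \ot tcross j k))%T =h h ->
  (cr j k (i :: v) \oc lw j (cr i k v) \oc cr i j (k :: v))%T =h
  (lw k (cr i j v) \oc cr i k (j :: v) \oc lw i (cr j k v) \oa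
    (h \ot tid v : term (i :: j :: k :: v) (k :: j :: i :: v)))%T.
Proof.
move=> /(whisk_sub2 v) E.
have M3 u1 v1 w1 z1 (f1 : term w1 z1) (f2 : term v1 w1) (f3 : term u1 v1) :=
  teq_trans (whiskM (f1 \oc f2)%T f3 v) (teq_comp (whiskM f1 f2 v) (teq_refl _)).
have E1 := teq_trans (M3 _ _ _ _ (tcross j k \ot tid [:: i])%T
    (tid [:: j] \ot tcross i k)%T (tcross i j \ot tid [:: k])%T)
  (teq_comp (teq_comp (cr_whisk j k i v) (lw_cr_whisk i k j v)) (cr_whisk i j k v)).
have E2 := teq_trans (M3 _ _ _ _ (tid [:: k] \ot tcross i j)%T
    (tcross i k \ot tid [:: j])%T (tid [:: i] \ot tcross j k)%T)
  (teq_comp (teq_comp (lw_cr_whisk i j k v) (cr_whisk i k j v)) (lw_cr_whisk j k i v)).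
exact: (teq_trans (teq_sym E1) (teq_trans E (teq_add E2 (teq_refl _)))).
Qed.

Lemma cr_braid0 i j k v : ~ (i = k /\ i <> j) ->
  (cr j k (i :: v) \oc lw j (cr i k v) \oc cr i j (k :: v))%T =h
  (lw k (cr i j v) \oc cr i k (j :: v) \oc lw i (cr j k v))%T.
Proof.
move=> ijk; rewrite (braid_aux v (teq_braid0 ijk)).
have E := teq_0tens [:: i; j; k] [:: k; j; i] (tid v).
exact: (teq_trans (teq_add (teq_refl _) E) (teq_addr0 _)).
Qed.

Lemma cr_braid1 i j v : i <> j ->
  (cr j i (i :: v) \oc lw j (cr i i v) \oc cr i j (i :: v))%T =h
  (lw i (cr i j v) \oc cr i i (j :: v) \oc lw i (cr j i v)
     \oa tid (i :: j :: i :: v))%T.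
Proof.
move=> ij; rewrite (braid_aux v (teq_braid1 ij)).
exact: (teq_add (teq_refl _) (teq_tens1 [:: i; j; i] v)).
Qed.

(** * Spanning families *)

Lemma vertex_dec (i j : vertex) : {i = j} + {i <> j}.
Proof. by decide equality. Qed.

Fixpoint dotE (k : nat) (u : word) {struct u} : term u u :=
  match u with
  | [::] => tid [::]
  | i :: u' => if k is k'.+1 then lw i (dotE k' u') else dt i u'
  end.

Fixpoint swapk (T : Type) (k : nat) (u : seq T) {struct u} : seq T :=
  match u with
  | [::] => [::]
  | i :: u' => if k is k'.+1 then i :: swapk k' u'
               else if u' is j :: u'' then j :: i :: u'' else u
  end.

(** The target [u] is arbitrary and the source is computed from it: these crossings are precomposed
    to morphisms out of a given [u]. *)
Fixpoint crE (k : nat) (u : word) {struct u} : term (swapk k u) u :=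
  match u return term (swapk k u) u with
  | [::] => tid [::]
  | i :: u' =>
      match k return term (swapk k (i :: u')) (i :: u') with
      | k'.+1 => lw i (crE k' u')
      | 0 => match u' return term (swapk 0 (i :: u')) (i :: u') with
             | [::] => tid [:: i]
             | j :: u'' => cr j i u''
             end
      end
  end.

(* The strand coloured [j] crosses all of [u1] to its left. *)
Fixpoint W (u1 : word) (j : vertex) (u2 : word) {struct u1} :
    term (u1 ++ j :: u2) (j :: u1 ++ u2) :=
  match u1 return term (u1 ++ j :: u2) (j :: u1 ++ u2) with
  | [::] => tid (j :: u2)
  | i :: u1' => (cr i j (u1' ++ u2) \oc lw i (W u1' j u2))%T
  end.

(** The span of the overview's normal forms. Closure under [=h] makes it a property of morphisms of
    H and not of terms. *)
Inductive sp (j : vertex) : forall v u : word, term u (j :: v) -> Prop :=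
| sp_W v u1 u2 (r : term (u1 ++ u2) v) : sp (lw j r \oc W u1 j u2)%T
| sp_dt v u (f : term u (j :: v)) : sp f -> sp (dt j v \oc f)%T
| sp_zero v u : sp (tzero u (j :: v))
| sp_add v u (f g : term u (j :: v)) : sp f -> sp g -> sp (f \oa g)%T
| sp_opp v u (f : term u (j :: v)) : sp f -> sp (topp f)
| sp_eq v u (f g : term u (j :: v)) : sp f -> f =h g -> sp g.

#[global] Instance sp_proper j v u :
  Proper (@teq u (j :: v) u (j :: v) ==> iff) (@sp j v u).
Proof. by move=> f g fg; split=> S; apply: sp_eq S _; rewrite fg. Qed.

Lemma sp_W1 u1 j u2 : sp (W u1 j u2).
Proof.
by apply: sp_eq (sp_W j (tid (u1 ++ u2))) _; rewrite lw1 teq_comp1l.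
Qed.

Lemma sp_lw j u v (f : term u v) : sp (lw j f).
Proof. by apply: sp_eq (sp_W j (u1 := [::]) f) _; rewrite /= teq_comp1r. Qed.

Lemma sp_left j u v w (f : term u (j :: v)) (r : term v w) :
  sp f -> sp (lw j r \oc f)%T.
Proof.
move=> spf; elim: spf w r => {u v f} [v u1 u2 r'|v u f _ IH|v u|v u f g _ IHf _ IHg|
  v u f _ IH|v u f g _ IH fg] w r.
- by apply: sp_eq (sp_W j (r \oc r')%T) _; rewrite lwM teq_compA.
- by apply: sp_eq (sp_dt (IH _ r)) _; rewrite !teq_compA dt_lw.
- by apply: sp_eq (sp_zero _ _ _) _; rewrite teq_comp0.
- by apply: sp_eq (sp_add (IHf _ r) (IHg _ r)) _; rewrite teq_compDr.
- by apply: sp_eq (sp_opp (IH _ r)) _; rewrite teq_compopp.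
- by apply: sp_eq (IH _ r) _; rewrite fg.
Qed.

Lemma sp_sub j u v (f g : term u (j :: v)) : sp f -> sp g -> sp (f \os g)%T.
Proof. by move=> spf spg; apply: sp_add => //; apply: sp_opp. Qed.

(** This is the passage from [W u1] to [W (i :: u1)]. A dot on the pulled strand slides through the
    new crossing; for equal colours the error is [lw i f], which needs no pulling at all. *)
Lemma sp_cross i j u v (f : term u (j :: v)) :
  sp f -> sp (cr i j v \oc lw i f)%T.
Proof.
elim=> {u v f} [v u1 u2 r|v u f spf IH|v u|v u f g _ IHf _ IHg|
  v u f _ IH|v u f g _ IH fg].
- apply: sp_eq (sp_W j (u1 := i :: u1) (lw i r)) _.
  by rewrite /= lwM !teq_compA cr_lw.
- rewrite lwM teq_compA; have [e|ne] := vertex_dec i j.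
    subst j; apply: sp_eq (sp_sub (sp_dt IH) (sp_lw i f)) _.
    by rewrite cr_lwdt_eq teq_compDl teq_oppcomp teq_comp1l teq_compA.
  by apply: sp_eq (sp_dt IH) _; rewrite cr_lwdt_neq // teq_compA.
- by apply: sp_eq (sp_zero _ _ _) _; rewrite lw0 teq_comp0.
- by apply: sp_eq (sp_add IHf IHg) _; rewrite lwD teq_compDr.
- by apply: sp_eq (sp_opp IH) _; rewrite lwN teq_compopp.
- by apply: sp_eq IH _; rewrite fg.
Qed.

(** Dots climb through the crossings of [W]. The error at a crossing of equal colours leaves the
    identity in its place, hence a term of the form [lw]. *)
Lemma sp_W_dotE u1 j u2 k : sp (W u1 j u2 \oc dotE k (u1 ++ j :: u2))%T.
Proof.
elim: u1 k => [|i u1 IH] [|k] /=.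
- by apply: sp_eq (sp_dt (sp_W1 [::] j u2)) _; rewrite /= teq_comp1l teq_comp1r.
- by apply: sp_eq (sp_lw j (dotE k u2)) _; rewrite teq_comp1l.
- rewrite /= -teq_compA -dt_lw teq_compA.
  have [e|ne] := vertex_dec i j.
    subst j; apply: sp_eq (sp_add (sp_left (dt i (u1 ++ u2)) (sp_W1 (i :: u1) i u2))
      (sp_lw i (W u1 i u2))) _.
    by rewrite cr_dt_eq teq_compDl teq_comp1l /= teq_compA.
  apply: sp_eq (sp_left (dt i (u1 ++ u2)) (sp_W1 (i :: u1) j u2)) _.
  by rewrite cr_dt_neq // /= teq_compA.
- by apply: sp_eq (sp_cross i (IH k)) _; rewrite lwM teq_compA.
Qed.

(** A crossing with the pulled strand either lengthens [W] or undoes its last crossing, where a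
    quadratic relation applies. A crossing of two strands left of it climbs through [W] by the braid
    relation, whose exceptional error term is again an [lw]. *)
Lemma sp_W_crE u1 j u2 k : sp (W u1 j u2 \oc crE k (u1 ++ j :: u2))%T.
Proof.
elim: u1 k => [|i u1 IH] [|k] /=.
- case: u2 => [|i u2].
    by apply: sp_eq (sp_W1 [::] j [::]) _; rewrite teq_comp1l.
  by apply: sp_eq (sp_W1 [:: i] j u2) _; rewrite /= lw1 teq_comp1l teq_comp1r.
- by apply: sp_eq (sp_lw j (crE k u2)) _; rewrite teq_comp1l.
- case: u1 {IH} => [|p u1] /=.
    have [e|ne] := vertex_dec i j.
      subst j; apply: sp_eq (sp_zero i _ _) _.
      by rewrite lw1 teq_comp1r cr_cr_eq.
    apply: sp_eq (sp_add (sp_dt (sp_W1 [::] j (i :: u2))) (sp_lw j (dt i u2))) _.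
    rewrite lw1 teq_comp1r cr_cr_neq ?teq_comp1r //; exact: nesym.
  have E : (cr i j (p :: u1 ++ u2)
              \oc lw i (cr p j (u1 ++ u2) \oc lw p (W u1 j u2))
              \oc cr p i (u1 ++ j :: u2))%T =h
           (cr i j (p :: u1 ++ u2) \oc lw i (cr p j (u1 ++ u2))
              \oc cr p i (j :: u1 ++ u2) \oc lw p (lw i (W u1 j u2)))%T.
    by rewrite lwM -!teq_compA -cr_lw.
  apply: sp_eq (teq_sym E).
  have S : sp (lw j (cr p i (u1 ++ u2)) \oc W [:: p, i & u1] j u2)%T.
    exact: (sp_left (cr p i (u1 ++ u2)) (sp_W1 [:: p, i & u1] j u2)).
  have [[e1 e2]|ne] : {p = j /\ p <> i} + {~ (p = j /\ p <> i)}.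
    by case: p j i {E S} => [] [] []; by [left|right; case].
    subst p; apply: sp_eq (sp_add S (sp_lw j (lw i (W u1 j u2)))) _.
    by rewrite cr_braid1 // teq_compDl teq_comp1l /= lwM !teq_compA.
  apply: sp_eq S _.
  by rewrite cr_braid0 // /= lwM !teq_compA.
- by apply: sp_eq (sp_cross i (IH k)) _; rewrite lwM teq_compA.
Qed.

Lemma sp_comp (T : word -> word) (m : forall u, term (T u) u) j :
  (forall u1 u2, sp (W u1 j u2 \oc m (u1 ++ j :: u2))%T) ->
  forall v u (f : term u (j :: v)), sp f -> sp (f \oc m u)%T.
Proof.
move=> mW v u f; elim=> {u v f} [v u1 u2 r|v u f _ IH|v u|v u f g _ IHf _ IHg|
  v u f _ IH|v u f g _ IH fg].
- by apply: sp_eq (sp_left r (mW u1 u2)) _; rewrite teq_compA.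
- by apply: sp_eq (sp_dt IH) _; rewrite teq_compA.
- by apply: sp_eq (sp_zero _ _ _) _; rewrite teq_0comp.
- by apply: sp_eq (sp_add IHf IHg) _; rewrite teq_compDl.
- by apply: sp_eq (sp_opp IH) _; rewrite teq_oppcomp.
- by apply: sp_eq IH _; rewrite fg.
Qed.

Definition hcast u v u' v' (eu : u = u') (ev : v = v') (f : term u v) : term u' v' :=
  match eu in _ = x, ev in _ = y return term x y with
  | erefl, erefl => f
  end.

Lemma hcastE u v u' v' (eu : u = u') (ev : v = v') (f : term u v) :
  hcast eu ev f =h f.
Proof. by case: u' / eu; case: v' / ev. Qed.

Definition whisk pre post u v (f : term u v) :
  term (pre ++ u ++ post) (pre ++ v ++ post) := (tid pre \ot (f \ot tid post))%T.

Lemma whisk_cons i pre post u v (f : term u v) :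
  whisk (i :: pre) post f =h lw i (whisk pre post f).
Proof.
exact: (teq_trans (teq_tens (teq_sym (teq_tens1 [:: i] pre)) (teq_refl (f \ot tid post)%T))
  (teq_sym (teq_tensA (tid [:: i]) (tid pre) (f \ot tid post)%T))).
Qed.

Lemma whisk_dot pre post i :
  whisk pre post (tdot i) =h dotE (size pre) (pre ++ i :: post).
Proof.
elim: pre => [|k pre IH] /=; first exact: (teq_tens1l (tdot i \ot tid post)%T).
exact: (teq_trans (whisk_cons k pre post (tdot i)) (teq_tens (teq_refl (tid [:: k])) IH)).
Qed.

Lemma swapk_cat (T : Type) (pre post : seq T) i j :
  swapk (size pre) (pre ++ j :: i :: post) = pre ++ i :: j :: post.
Proof. by elim: pre => //= k pre ->. Qed.

Lemma whisk_cross pre post i j :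
  whisk pre post (tcross i j) =h crE (size pre) (pre ++ j :: i :: post).
Proof.
elim: pre => [|k pre IH] /=; first exact: (teq_tens1l (tcross i j \ot tid post)%T).
exact: (teq_trans (whisk_cons k pre post (tcross i j)) (teq_tens (teq_refl (tid [:: k])) IH)).
Qed.

Lemma teq_tens_left u v u' v' (f : term u v) (g : term u' v') :
  (f \ot g)%T =h ((f \ot tid v') \oc (tid u \ot g))%T.
Proof.
apply: teq_sym; apply: teq_trans (teq_tens_comp f (tid u) (tid v') g) _.
exact: (teq_tens (teq_comp1r f) (teq_comp1l g)).
Qed.

Lemma whiskM' pre post u v w (f : term v w) (g : term u v) :
  whisk pre post (f \oc g) =h (whisk pre post f \oc whisk pre post g)%T.
Proof.
apply: teq_sym.
apply: (teq_trans (teq_tens_comp (tid pre) (tid pre) (f \ot tid post)%T (g \ot tid post)%T)).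
apply: (teq_tens (teq_comp1l (tid pre))).
apply: (teq_trans (teq_tens_comp f g (tid post) (tid post))).
exact: (teq_tens (teq_refl (f \oc g)%T) (teq_comp1l (tid post))).
Qed.

Section Ideal.
Variables (v0 : word) (S : forall u, term u v0 -> Prop).
Hypothesis S0 : forall u, S (tzero u v0).
Hypothesis SD : forall u (f g : term u v0), S f -> S g -> S (f \oa g)%T.
Hypothesis SN : forall u (f : term u v0), S f -> S (topp f).
Hypothesis SE : forall u (f g : term u v0), S f -> f =h g -> S g.
Hypothesis Sdot : forall u k (f : term u v0), S f -> S (f \oc dotE k u)%T.
Hypothesis Scr : forall u k (f : term u v0), S f -> S (f \oc crE k u)%T.

(** A tensor factor acts inside a longer word, so the induction on [f] carries a context [pre],
    [post]. Moreover [h] is only required to be equal to the whiskered term, because its words may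
    be equal without being convertible. *)
Lemma ideal_mul u v (f : term u v) pre post w' w (h : term w' w) (g : term w v0) :
  h =h whisk pre post f -> S g -> S (g \oc h)%T.
Proof.
elim: f pre post w' w h g => {u v}.
- move=> u pre post w' w h g hE Sg.
  have {}hE : h =h tid (pre ++ u ++ post).
    apply: (teq_trans hE).
    apply: (teq_trans (teq_tens (teq_refl (tid pre)) (teq_tens1 u post))).
    exact: teq_tens1.
  have [e1 e2] := teq_type hE; subst; apply: SE Sg _; rewrite hE.
  by rewrite teq_comp1r.
- move=> u v w1 f IHf f' IHf' pre post w' w h g hE Sg.
  have {}hE := teq_trans hE (whiskM' pre post f f').
  have [e1 e2] := teq_type hE; subst.
  apply: SE (IHf' _ _ _ _ _ _ (teq_refl _) (IHf _ _ _ _ _ _ (teq_refl _) Sg)) _.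
  by rewrite hE -teq_compA.
- move=> u v u' v' f IHf f' IHf' pre post w' w h g hE Sg.
  have [e1 e2] := teq_type hE; subst.
  have e1 : pre ++ v ++ (v' ++ post) = pre ++ (v ++ v') ++ post by rewrite !catA.
  have e2 : pre ++ u ++ (v' ++ post) = (pre ++ u) ++ v' ++ post by rewrite !catA.
  have e3 : (pre ++ u) ++ u' ++ post = pre ++ (u ++ u') ++ post by rewrite !catA.
  pose h1 := hcast e2 e1 (whisk pre (v' ++ post) f).
  pose h2 := hcast e3 erefl (whisk (pre ++ u) post f').
  have S1 := IHf _ _ _ _ h1 g (hcastE _ _ _) Sg.
  have S2 := IHf' _ _ _ _ h2 _ (hcastE _ _ _) S1.
  apply: SE S2 _; rewrite -teq_compA.
  suff -> : h =h (h1 \oc h2)%T by [].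
  apply: teq_trans hE _.
  have E := whiskM' pre post (f \ot tid v')%T (tid u \ot f')%T.
  apply: teq_trans (teq_trans _ E) _.
    apply: (teq_tens (teq_refl (tid pre))); apply: (teq_tens _ (teq_refl (tid post))).
    exact: teq_tens_left.
  apply: teq_comp; apply: teq_trans (teq_sym (hcastE _ _ _)).
    apply: (teq_tens (teq_refl (tid pre))).
    apply: teq_trans (teq_sym (teq_tensA _ _ _)) _.
    exact: (teq_tens (teq_refl f) (teq_tens1 _ _)).
  apply: teq_trans (teq_tens (teq_refl (tid pre)) (teq_sym (teq_tensA (tid u) f' (tid post)))) _.
  apply: teq_trans (teq_tensA _ _ _) _.
  exact: (teq_tens (teq_tens1 _ _) (teq_refl _)).
- move=> u v pre post w' w h g hE Sg.
  have {}hE : h =h tzero (pre ++ u ++ post) (pre ++ v ++ post).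
    apply: teq_trans hE _; apply: teq_trans (teq_tens (teq_refl _) (teq_0tens _ _ _)) _.
    exact: teq_tens0.
  have [e1 e2] := teq_type hE; subst; apply: SE (S0 _) _.
  by rewrite hE teq_comp0.
- move=> u v f IHf f' IHf' pre post w' w h g hE Sg.
  have {}hE : h =h (whisk pre post f \oa whisk pre post f')%T.
    apply: teq_trans hE _; apply: teq_trans (teq_tens (teq_refl _) (teq_tensDl _ _ _)) _.
    exact: teq_tensDr.
  have [e1 e2] := teq_type hE; subst.
  apply: SE (SD (IHf _ _ _ _ _ _ (teq_refl _) Sg) (IHf' _ _ _ _ _ _ (teq_refl _) Sg)) _.
  by rewrite hE teq_compDr.
- move=> u v f IHf pre post w' w h g hE Sg.
  have {}hE : h =h topp (whisk pre post f).
    apply: teq_trans hE _; apply: teq_trans (teq_tens (teq_refl _) (teq_opptens _ _)) _.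
    exact: teq_tensopp.
  have [e1 e2] := teq_type hE; subst.
  apply: SE (SN (IHf _ _ _ _ _ _ (teq_refl _) Sg)) _.
  by rewrite hE teq_compopp.
- move=> i pre post w' w h g hE Sg.
  have {}hE := teq_trans hE (whisk_dot pre post i).
  have [e1 e2] := teq_type hE; subst.
  by apply: SE (Sdot (size pre) Sg) _; rewrite hE.
- move=> i j pre post w' w h g hE Sg.
  have {}hE := teq_trans hE (whisk_cross pre post i j).
  have [e1 e2] := teq_type hE; subst.
  by apply: SE (Scr (size pre) Sg) _; rewrite hE.
Qed.

Lemma ideal_all : S (tid v0) -> forall u (f : term u v0), S f.
Proof.
move=> S1 u f.
have e1 : [::] ++ u ++ [::] = u by rewrite cats0.
have fE : f =h whisk [::] [::] f.
  apply: teq_sym; apply: teq_trans (teq_tens1l _) _; exact: teq_tens1r.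
by apply: SE (ideal_mul fE S1) _; rewrite teq_comp1l.
Qed.
End Ideal.

Lemma sp_all j v u (f : term u (j :: v)) : sp f.
Proof.
apply: (@ideal_all (j :: v) (@sp j v)).
- exact: sp_zero.
- exact: sp_add.
- exact: sp_opp.
- exact: sp_eq.
- by move=> u0 k f0; apply: sp_comp => u1 u2; apply: sp_W_dotE.
- by move=> u0 k f0; apply: sp_comp => u1 u2; apply: sp_W_crE.
- by apply: sp_eq (sp_lw j (tid v)) _; rewrite lw1.
Qed.

(** * Morphisms to the monoidal unit *)

Inductive sp0 : forall u : word, term u [::] -> Prop :=
| sp0_id : sp0 (tid [::])
| sp0_zero u : sp0 (tzero u [::])
| sp0_add u (f g : term u [::]) : sp0 f -> sp0 g -> sp0 (f \oa g)%T
| sp0_opp u (f : term u [::]) : sp0 f -> sp0 (topp f)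
| sp0_eq u (f g : term u [::]) : sp0 f -> f =h g -> sp0 g.

Lemma sp0_comp (T : word -> word) (m : forall u, term (T u) u) :
  sp0 (m [::]) -> forall u (f : term u [::]), sp0 f -> sp0 (f \oc m u)%T.
Proof.
move=> m0 u f; elim=> {u f} [|u|u f g _ IHf _ IHg|u f _ IH|u f g _ IH fg].
- by apply: sp0_eq m0 _; rewrite teq_comp1l.
- by apply: sp0_eq (sp0_zero _) _; rewrite teq_0comp.
- by apply: sp0_eq (sp0_add IHf IHg) _; rewrite teq_compDl.
- by apply: sp0_eq (sp0_opp IH) _; rewrite teq_oppcomp.
- by apply: sp0_eq IH _; rewrite fg.
Qed.

Lemma sp0_all u (f : term u [::]) : sp0 f.
Proof.
apply: (@ideal_all [::] sp0).
- exact: sp0_zero.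
- exact: sp0_add.
- exact: sp0_opp.
- exact: sp0_eq.
- by move=> u0 k f0; apply: sp0_comp; exact: sp0_id.
- by move=> u0 k f0; apply: sp0_comp; exact: sp0_id.
- exact: sp0_id.
Qed.

(** * Faithfulness *)

Lemma catI T (u u' w w' : seq T) : size u = size u' -> u ++ w = u' ++ w' ->
  u = u' /\ w = w'.
Proof. by elim: u u' => [|x u IH] [|y u'] //= [/IH{}IH] [-> /IH[-> ->]]. Qed.

(* Only strands of the source in positions below [K] are pulled to the left. *)
Inductive spK (K : nat) (j : vertex) : forall v u : word, term u (j :: v) -> Prop :=
| spK_W v u1 u2 (r : term (u1 ++ u2) v) : (size u1 < K)%N ->
    spK K (lw j r \oc W u1 j u2)%T
| spK_dt v u (f : term u (j :: v)) : spK K f -> spK K (dt j v \oc f)%T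
| spK_zero v u : spK K (tzero u (j :: v))
| spK_add v u (f g : term u (j :: v)) : spK K f -> spK K g -> spK K (f \oa g)%T
| spK_opp v u (f : term u (j :: v)) : spK K f -> spK K (topp f)
| spK_eq v u (f g : term u (j :: v)) : spK K f -> f =h g -> spK K g.

Lemma sp_spK j v u (f : term u (j :: v)) : spK (size u) f.
Proof.
elim: (sp_all f) => {u v f} [v u1 u2 r|v u f spf IH|v u|v u f g _ IHf _ IHg|
  v u f _ IH|v u f g _ IH fg].
- by apply: spK_W; rewrite size_cat /= addnS ltnS leq_addr.
- exact: spK_dt.
- exact: spK_zero.
- exact: spK_add.
- exact: spK_opp.
- exact: spK_eq fg.
Qed.

Lemma spK0 j v u (f : term u (j :: v)) : spK 0 f -> f =h tzero u (j :: v).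
Proof.
elim=> {u v f} [v u1 u2 r|v u f spf IH|v u|v u f g _ IHf _ IHg|
  v u f _ IH|v u f g _ IH fg] //.
- by rewrite IH teq_comp0.
- by rewrite IHf IHg teq_add0.
- by rewrite IH -(teq_add0 (topp _)) teq_addN.
- by rewrite -fg.
Qed.

Lemma spK_cast K j v u u' (e : u = u') (f : term u (j :: v)) :
  spK K f -> spK K (hcast e erefl f).
Proof. by case: u' / e. Qed.

Section Collect.
Variables (u1 : word) (j : vertex) (u2 v : word).

(** Horner's form of a polynomial in the dot on the first target strand: its coefficient of degree
    [m] is [lw j r] after the fixed [W u1 j u2], with [r] the entry of index [m]. *)
Fixpoint dpoly (rs : seq (term (u1 ++ u2) v)) : term (u1 ++ j :: u2) (j :: v) :=
  if rs is r :: rs' then (lw j r \oc W u1 j u2 \oa dt j v \oc dpoly rs')%T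
  else tzero _ _.

Fixpoint addl (rs rs' : seq (term (u1 ++ u2) v)) :=
  match rs, rs' with
  | [::], _ => rs'
  | _, [::] => rs
  | r :: rs, r' :: rs' => (r \oa r')%T :: addl rs rs'
  end.

Lemma dpolyD rs rs' : (dpoly rs \oa dpoly rs')%T =h dpoly (addl rs rs').
Proof.
elim: rs rs' => [|r rs IH] [|r' rs'] /=; rewrite ?teq_add0 ?teq_addr0 //.
rewrite -IH lwD teq_compDl teq_compDr -!teq_addA; apply: teq_add => //.
by rewrite !teq_addA (teq_addC (dt _ _ \oc _)%T).
Qed.

Lemma dpolyN rs : topp (dpoly rs) =h dpoly (map (@topp _ _) rs).
Proof.
elim: rs => [|r rs IH] /=.
  by rewrite -(teq_add0 (topp _)) teq_addN.
rewrite -IH lwN teq_oppcomp teq_compopp; apply: teq_sym; apply: teq_oppE.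
rewrite -teq_addA (teq_addC (dt _ _ \oc _)%T) -teq_addA (teq_addC (topp (dt _ _ \oc _)%T)).
by rewrite teq_addN teq_addr0 teq_addN.
Qed.

(** The source word and the position [K] determine [u1] and [u2], so all pulls from position exactly
    [K] share one [W]. The words are variables tied by equations for the sake of the induction on
    [spK]. *)
Lemma collect K u v0 (f : term u (j :: v0)) : size u1 = K -> u = u1 ++ j :: u2 -> v = v0 ->
  spK K.+1 f ->
  exists f' rs, spK K f' /\ f =h (f' \oa dpoly rs)%T.
Proof.
move=> sK + + spf; elim: spf => {u v0 f} [v0 w1 w2 r|v0 u f _ IH|v0 u|v0 u f g _ IHf _ IHg|
  v0 u f _ IH|v0 u f g _ IH fg] => [sz eu ev|eu ev|eu ev|eu ev|eu ev|eu ev].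
- subst v0; move: sz; rewrite ltnS leq_eqVlt => /orP[/eqP sz|sz].
    have [? [?]] := catI (etrans sz (esym sK)) eu; subst.
    exists (tzero _ _), [:: r]; split; first exact: spK_zero.
    by rewrite /= teq_comp0 teq_addr0 teq_add0.
  exists (hcast eu erefl (lw j r \oc W w1 j w2)%T), [::]; split.
    by apply: spK_cast; apply: spK_W.
  apply: teq_trans (teq_sym (hcastE eu erefl _)) _.
  by rewrite teq_addr0.
- have [f' [rs [spf' E]]] := IH eu ev.
  subst v0; exists (dt j v \oc f')%T, (tzero _ _ :: rs); split; first exact: spK_dt.
  apply: (teq_trans (teq_comp (teq_refl (dt j v)) E)).
  by rewrite teq_compDr /= lw0 teq_0comp teq_add0.
- subst; exists (tzero _ _), [::]; split; first exact: spK_zero.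
  by rewrite teq_add0.
- have [f' [rs [spf' E]]] := IHf eu ev.
  have [g' [rs' [spg' E']]] := IHg eu ev.
  subst v0; exists (f' \oa g')%T, (addl rs rs'); split; first exact: spK_add.
  apply: (teq_trans (teq_add E E')).
  rewrite -dpolyD -!teq_addA; apply: teq_add => //.
  by rewrite !teq_addA (teq_addC g').
- have [f' [rs [spf' E]]] := IH eu ev.
  subst v0; exists (topp f'), (map (@topp _ _) rs); split; first exact: spK_opp.
  apply: (teq_trans (teq_opp E)).
  apply: teq_sym; apply: teq_oppE; rewrite -dpolyN.
  rewrite -teq_addA (teq_addC (dpoly rs)) -teq_addA (teq_addC (topp (dpoly rs))).
  by rewrite teq_addN teq_addr0 teq_addN.
- have [f' [rs [spf' E]]] := IH eu ev.
  by exists f', rs; split => //; apply: teq_trans E; apply: teq_sym.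
Qed.
End Collect.

Lemma collect0 K j v u (f : term u (j :: v)) :
  (forall u1 u2, size u1 = K -> u <> u1 ++ j :: u2) -> spK K.+1 f -> spK K f.
Proof.
move=> + spf.
elim: spf => {u v f} [v0 w1 w2 r|v0 u f _ IH|v0 u|v0 u f g _ IHf _ IHg|
  v0 u f _ IH|v0 u f g _ IH fg] => [sz nu|nu|nu|nu|nu|nu].
- apply: spK_W; move: sz; rewrite ltnS leq_eqVlt => /orP[/eqP sz|//].
  by case: (nu _ _ sz erefl).
- by apply: spK_dt; apply: IH.
- exact: spK_zero.
- by apply: spK_add; [apply: IHf|apply: IHg].
- by apply: spK_opp; apply: IH.
- by apply: spK_eq fg; apply: IH.
Qed.

Lemma sem_comp u v w (f : term v w) (g : term u v) h s :
  sem (f \oc g) h s = sem f (sem g h) s.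
Proof. by []. Qed.

Lemma sem_add u v (f g : term u v) h s : sem (f \oa g) h s = sem f h s + sem g h s.
Proof. by []. Qed.

Lemma W_cons i u1 j u2 :
  W (i :: u1) j u2 = (cr i j (u1 ++ u2) \oc lw i (W u1 j u2))%T.
Proof. by []. Qed.

Lemma sem_lw i u v (f : term u v) h t s :
  sem (lw i f) h (t :: s) = sem f (fun s' => h (t :: s')) s.
Proof. by rewrite /= take0 drop0 /=. Qed.

Lemma sem_dt i v h t s : sem (dt i v) h (t :: s) = t * h (t :: s).
Proof. by rewrite /= take0 drop0 /=. Qed.

Definition cf0 (i j : vertex) (t a : rat) : rat :=
  match i, j with vx1, vx1 | vx2, vx2 => (t - a)^-1 | _, _ => 0 end.
Definition cf1 (i j : vertex) (t a : rat) : rat :=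
  match i, j with vx1, vx1 | vx2, vx2 => - (t - a)^-1
  | vx1, vx2 => 1 | vx2, vx1 => t + a end.

Lemma sem_cr i j v h t a s :
  sem (cr i j v) h (t :: a :: s) =
  cf0 i j t a * h (t :: a :: s) + cf1 i j t a * h (a :: t :: s).
Proof. by rewrite /= take0 drop0 /=; case: i j => [] []; rewrite /scross /=; ring. Qed.

Lemma cf1_neq0 i j t a : 0 < t -> 0 < a -> t != a -> cf1 i j t a != 0.
Proof.
move=> t0 a0 ta; have ? : t - a != 0 by rewrite subr_eq0.
by case: i j => [] [] /=; rewrite ?oppr_eq0 ?invr_eq0 ?oner_eq0 // gt_eqF // addr_gt0.
Qed.

Lemma generic_cons t s : generic (t :: s) -> [/\ t \notin s, 0 < t & generic s].
Proof. by rewrite /generic /= => /andP[/andP[-> ->] /andP[-> ->]]. Qed.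

Lemma sem_eq0 u v (f : term u v) h s : size s = size v ->
  (forall s', perm_eq s' s -> h s' = 0) -> sem f h s = 0.
Proof. by move=> sz h0; rewrite -(sem0 f s); apply: sem_local. Qed.

Fixpoint Wcoef (u1 : word) (j : vertex) (t : rat) (s : seq rat) : rat :=
  if u1 is i :: u1' then cf1 i j t (head 0 s) * Wcoef u1' j t (behead s) else 1.

Lemma Wcoef_neq0 u1 j t s : (size u1 <= size s)%N -> generic (t :: s) ->
  Wcoef u1 j t s != 0.
Proof.
elim: u1 s => [|i u1 IH] [|a s] //=; rewrite ?oner_eq0 // ltnS => sz gs.
have [nts t0 gas] := generic_cons gs; have [nas a0 gs'] := generic_cons gas.
move: nts; rewrite inE negb_or => /andP[ta ts].
rewrite mulf_neq0 ?cf1_neq0 ?IH //.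
by rewrite /generic /= ts t0 //; case/andP: gs' => -> ->.
Qed.

(** Each crossing either keeps or exchanges its two points. Only the choice that carries [t] past
    all of [u1] evaluates [h] at a list where [t] does not come too early. *)
Lemma sem_W_lead u1 j u2 h t s : generic (t :: s) -> size s = size (u1 ++ u2) ->
  (forall s', perm_eq s' (t :: s) -> (index t s' < size u1)%N -> h s' = 0) ->
  sem (W u1 j u2) h (t :: s) =
  Wcoef u1 j t s * h (take (size u1) s ++ t :: drop (size u1) s).
Proof.
elim: u1 h s => [|i u1 IH] h s gs sz h0; first by rewrite /= take0 drop0 mul1r.
case: s gs sz h0 => [|a s] // gs [sz] h0.
rewrite W_cons sem_comp sem_cr !sem_lw.
have [nts t0 gas] := generic_cons gs; have [nas a0 gs'] := generic_cons gas.
move: nts; rewrite inE negb_or => /andP[ta ts].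
rewrite [sem (W _ _ _) _ (a :: s)]sem_eq0 ?IH ?mulr0 ?add0r ?mulrA //.
- by rewrite /generic /= ts t0 //; case/andP: gs' => -> ->.
- move=> s' ps it; apply: h0; last by rewrite /= eq_sym (negbTE ta).
  by rewrite perm_sym (perm_catCA [:: t] [:: a] s) /= perm_cons perm_sym.
- by rewrite /= sz.
- by move=> s' ps; apply: h0; rewrite ?perm_cons //= eqxx.
Qed.

Lemma sem_W_vanish u1 j u2 h t s : generic (t :: s) -> size s = size (u1 ++ u2) ->
  (forall s', perm_eq s' (t :: s) -> (index t s' <= size u1)%N -> h s' = 0) ->
  sem (W u1 j u2) h (t :: s) = 0.
Proof.
move=> gs sz h0; rewrite sem_W_lead //; last by move=> s' ps /ltnW; apply: h0.
rewrite h0 ?mulr0 //.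
  by rewrite (perm_catCA _ [:: t]) cat_take_drop.
have szt : size (take (size u1) s) = size u1 by rewrite size_takel // sz size_cat leq_addr.
rewrite index_cat szt /= eqxx addn0; case: ifP => // tt.
by rewrite -{2}szt index_size.
Qed.

Lemma sem_spK0 K j v u (f : term u (j :: v)) h t s :
  spK K f -> generic (t :: s) -> size s = size v ->
  (forall s', perm_eq s' (t :: s) -> (index t s' < K)%N -> h s' = 0) ->
  sem f h (t :: s) = 0.
Proof.
move=> spf gs + h0.
elim: spf => {u v f} [v u1 u2 r sK|v u f _ IH|v u|v u f g _ IHf _ IHg|
  v u f _ IH|v u f g _ IH fg] sz.
- rewrite sem_comp sem_lw.
  have [e|ne] := eqVneq (size (u1 ++ u2)) (size v); last by rewrite sem_size.
  apply: sem_eq0 => // s' ps.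
  have ps' : perm_eq (t :: s') (t :: s) by rewrite perm_cons.
  apply: sem_W_vanish.
  + by rewrite (generic_perm ps').
  + by rewrite (perm_size ps) sz.
  + move=> s'' ps'' it; apply: h0; first exact: perm_trans ps'' ps'.
    exact: leq_ltn_trans it sK.
- by rewrite sem_comp sem_dt IH ?mulr0.
- by [].
- by rewrite /= IHf ?IHg ?addr0.
- by rewrite /= IH ?oppr0.
- by rewrite -(sem_sound fg) ?IH //= sz.
Qed.

Lemma sem_dpoly u1 j u2 v (rs : seq (term (u1 ++ u2) v)) h t s :
  sem (dpoly j rs) h (t :: s) =
  \sum_(i < size rs) t ^+ i * sem (nth (tzero _ _) rs i)
    (fun s' => sem (W u1 j u2) h (t :: s')) s.
Proof.
elim: rs => [|r rs IH]; first by rewrite big_ord0.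
rewrite [size _]/= big_ord_recl expr0 mul1r.
have -> : dpoly j (r :: rs) = (lw j r \oc W u1 j u2 \oa dt j v \oc dpoly j rs)%T by [].
rewrite sem_add !sem_comp sem_lw sem_dt IH mulr_sumr; congr (_ + _).
by apply: eq_bigr => i _; rewrite mulrA -exprS.
Qed.

Lemma dpoly0 u1 j u2 v (rs : seq (term (u1 ++ u2) v)) :
  (forall i, (i < size rs)%N -> nth (tzero _ _) rs i =h tzero (u1 ++ u2) v) ->
  dpoly j rs =h tzero (u1 ++ j :: u2) (j :: v).
Proof.
elim: rs => [|r rs IH] //= E.
rewrite IH; last by move=> i ir; apply: (E i.+1).
have E0 : r =h tzero (u1 ++ u2) v by apply: (E 0%N).
by rewrite E0 lw0 teq_0comp teq_comp0 teq_add0.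
Qed.

Fixpoint natid (n : nat) : term [::] [::] :=
  if n is n'.+1 then (tid [::] \oa natid n')%T else tzero _ _.

Lemma natidD m n : natid (m + n) =h (natid m \oa natid n)%T.
Proof. by elim: m => [|m IH] /=; rewrite ?teq_add0 // IH teq_addA. Qed.

Lemma sem_natid n h s : sem (natid n) h s = n%:R * h s.
Proof. by elim: n => [|n IH] /=; rewrite ?mul0r // IH -natr1; ring. Qed.

Lemma sp0_form u (f : term u [::]) :
  (u = [::] -> exists m n, f =h (natid m \os natid n)%T) /\
  (u <> [::] -> f =h tzero u [::]).
Proof.
elim: (sp0_all f) => {u f}.
- split=> // _; exists 1%N, 0%N.
  exact: (teq_sym (teq_addK (tid [::]) (tzero [::] [::]))).
- by move=> u; split=> // ->; exists 0%N, 0%N; rewrite teq_addN.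
- move=> u f g _ [IHf IHf'] _ [IHg IHg']; split=> eu.
    have [m [n E]] := IHf eu; have [m' [n' E']] := IHg eu.
    exists (m + m')%N, (n + n')%N; apply: (teq_trans (teq_add E E')).
    have -> : topp (natid (n + n')) =h (topp (natid n) \oa topp (natid n'))%T.
      apply: teq_sym; apply: teq_oppE; rewrite natidD.
      rewrite -teq_addA (teq_addA (natid n')) (teq_addC (natid n')) -(teq_addA _ (natid n')).
      by rewrite teq_addN teq_addr0 teq_addN.
    rewrite natidD -!teq_addA; apply: teq_add => //.
    by rewrite !teq_addA (teq_addC (natid m')).
  by rewrite IHf' // IHg' // teq_add0.
- move=> u f _ [IHf IHf']; split=> eu.
    have [m [n E]] := IHf eu; exists n, m.
    apply: (teq_trans (teq_opp E)).
    apply: teq_sym; apply: teq_oppE.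
    rewrite -teq_addA (teq_addA (topp (natid n))) (teq_addC (topp (natid n))) teq_addN.
    by rewrite teq_add0 teq_addN.
  by rewrite IHf' // -(teq_add0 (topp _)) teq_addN.
- move=> u f g _ [IHf IHf'] fg; split=> eu; last by rewrite -fg IHf'.
  have [m [n E]] := IHf eu; exists m, n; exact: teq_trans (teq_sym fg) E.
Qed.

Lemma poly_inf_root (p : {poly rat}) (M : rat) :
  (forall t, M < t -> root p t) -> p = 0.
Proof.
move=> rp; apply/eqP/negPn/negP => p0.
have /= := @max_poly_roots _ p [seq M + k.+1%:R | k <- iota 0 (size p)] p0.
rewrite size_map size_iota ltnn => H; suff: false by []; apply: H.
  by apply/allP => t /mapP[k _ ->]; apply: rp; rewrite ltrDl ltr0n.
rewrite map_inj_uniq ?iota_uniq // => k l /addrI/eqP.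
by rewrite eqr_nat => /eqP[].
Qed.

Theorem sem_complete0 n u v (f : term u v) : size v = n ->
  (forall h s, size s = n -> generic s -> sem f h s = 0) -> f =h tzero u v.
Proof.
elim: n u v f => [|n IHn] u v f.
  case: v f => // f _ f0; have [E E'] := sp0_form f.
  case: u f f0 E E' => [|i u] f f0 E E'; last exact: E'.
  have [m [k fE]] := E erefl.
  (* The constant function reads off the integer [m - k], which is zero as soon as it is zero in the
     rationals. *)
  have := f0 (fun=> 1) [::] erefl erefl.
  rewrite (sem_sound fE) //= !sem_natid !mulr1 => /eqP.
  by rewrite subr_eq0 eqr_nat fE => /eqP->; rewrite teq_addN.
case: v f => // j v f [sz] f0.
suff H K : spK K f -> f =h tzero u (j :: v) by apply: H (sp_spK f).
elim: K f f0 => [|K IHK] f f0; first exact: spK0.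
have [[u1 [u2 [sK eu]]]|nu] := classic (exists u1 u2, size u1 = K /\ u = u1 ++ j :: u2);
  last first.
  move=> spf; apply: IHK => //; apply: collect0 spf => u1 u2 sK eu.
  by apply: nu; exists u1, u2.
subst u => spf.
have [f' [rs [spf' E]]] := collect sK erefl erefl spf.
suff rs0 : dpoly j rs =h tzero (u1 ++ j :: u2) (j :: v).
  have fE : f =h f' by rewrite E rs0 teq_addr0.
  rewrite fE; apply: IHK => // h s ss gs.
  by rewrite -(sem_sound fE) ?f0 //= sz.
apply: dpoly0 => i ir.
have [e|ne] := eqVneq (size (u1 ++ u2)) (size v); last first.
  by apply: IHn => // h s _ _; rewrite sem_size.
apply: IHn => // g s ss gs.
pose p := \poly_(i < size rs) sem (nth (tzero _ _) rs i) g s.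
suff p0 : p = 0 by have := coef_poly (size rs) (fun i => sem (nth (tzero _ _) rs i) g s) i;
  rewrite -/p p0 coef0 ir.
(* Beyond the sum of the positive entries of [s], [t] is positive and different from all of them. *)
apply: (@poly_inf_root _ (\sum_(x <- s) x)) => t tM.
have s0 x : x \in s -> 0 < x by case/andP: gs => _ /allP; apply.
have M0 : 0 <= \sum_(x <- s) x by rewrite big_seq sumr_ge0 // => x /s0/ltW.
have t0 : 0 < t := le_lt_trans M0 tM.
have nts : t \notin s.
  apply/negP => ts; move: tM; rewrite (perm_big _ (perm_to_rem ts)) big_cons /=.
  rewrite ltNge => /negP; apply; rewrite lerDl big_seq sumr_ge0 // => x /mem_rem/s0/ltW //.
have gts : generic (t :: s) by move: gs; rewrite /generic /= nts t0 => /andP[-> ->].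
(* The test function requires [t] at place [K], which hides all pulls from smaller positions.
   Dividing by [Wcoef] cancels the leading coefficient of [W], so that the coefficients of [p] do
   not depend on [t]. *)
pose q s' : seq rat := take K s' ++ drop K.+1 s'.
pose h s' := if nth 0 s' K == t then g (q s') / Wcoef u1 j t (q s') else 0.
have h0 s' : perm_eq s' (t :: s) -> (index t s' < K)%N -> h s' = 0.
  move=> ps it; rewrite /h; case: eqP => // nt.
  have us : uniq s' by rewrite (perm_uniq ps); case/andP: gts.
  have Ks : (K < size s')%N.
    by rewrite (perm_size ps) /= ss -sz -e size_cat sK ltnS leq_addr.
  by move: it; rewrite -nt index_uniq // ltnn.
have := f0 h (t :: s); rewrite /= ss => /(_ erefl gts).
rewrite (sem_sound E) //=; last by rewrite ss sz.
rewrite (sem_spK0 spf' gts _ h0) ?ss ?sz // add0r sem_dpoly => E0.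
rewrite /root /p horner_poly; apply/eqP; rewrite -[RHS]E0.
apply: eq_bigr => k _; rewrite mulrC; congr (_ * _).
apply: sem_local; first by rewrite ss sz.
move=> s' ps; have ps' : perm_eq (t :: s') (t :: s) by rewrite perm_cons.
have gts' : generic (t :: s') by rewrite (generic_perm ps').
have ss' : size s' = size (u1 ++ u2) by rewrite (perm_size ps) ss e sz.
have Ks : (K <= size s')%N by rewrite ss' size_cat sK leq_addr.
rewrite sem_W_lead //; last first.
  move=> s'' ps'' it; apply: h0; first exact: perm_trans ps'' ps'.
  by rewrite -sK.
have qE : q (take K s' ++ t :: drop K s') = s'.
  have szt : size (take K s') = K by rewrite size_takel.
  rewrite /q take_cat szt ltnn subnn take0 cats0.
  by rewrite drop_cat szt ltnNge leqnSn /= subSnn /= drop0 cat_take_drop.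
have nK : nth 0 (take K s' ++ t :: drop K s') K = t.
  by rewrite nth_cat size_takel // ltnn subnn.
rewrite sK /h nK eqxx qE mulrCA mulfV ?mulr1 //.
by apply: Wcoef_neq0; rewrite // sK.
Qed.

Theorem sem_complete u v (f g : term u v) :
  (forall h s, size s = size v -> generic s -> sem f h s = sem g h s) -> f =h g.
Proof.
move=> E; have F : (f \os g)%T =h tzero u v.
  apply: (sem_complete0 (n := size v)) => // h s ss gs.
  by rewrite /= E // subrr.
by rewrite -(teq_addr0 g); apply: teq_subr.
Qed.

(** * Retracts in the Karoubi envelope *)

Lemma sem_big u v (I : Type) (r : seq I) (P : pred I) (f : I -> term u v) h s :
  sem (\big[@tadd u v / tzero u v]_(i <- r | P i) f i) h s =
  \sum_(i <- r | P i) sem (f i) h s.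
Proof.
elim: r => [|i r IH]; first by rewrite !big_nil.
by rewrite !big_cons; case: ifP => _ //; rewrite sem_add IH.
Qed.

Lemma sem_ext_gen u v (f : term u v) (h h' : fn) s :
  (forall s, size s = size u -> generic s -> h s = h' s) ->
  size s = size v -> generic s -> sem f h s = sem f h' s.
Proof.
move=> E sz gs; have [e|ne] := eqVneq (size u) (size v); last by rewrite !sem_size.
apply: sem_local => // s' ps; apply: E; first by rewrite (perm_size ps) sz e.
by rewrite (generic_perm ps).
Qed.

Definition act (X Y : obj) (M : hom X Y) (F : idx X -> fn) (y : idx Y) : fn :=
  fun s => \sum_(x : idx X) sem (M x y) (F x) s.

Definition feq (Z : obj) (F G : idx Z -> fn) : Prop :=
  forall z s, size s = size (wd z) -> generic s -> F z s = G z s.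

Definition hzero (X Y : obj) : hom X Y := fun x y => tzero (wd x) (wd y).
Definition hadd (X Y : obj) (M N : hom X Y) : hom X Y :=
  fun x y => (M x y \oa N x y)%T.

(** A family of functions supported at one index isolates one entry of a matrix, and there
    [sem_complete] applies. *)
Lemma heqP X Y (M N : hom X Y) : heq M N <-> forall F, feq (act M F) (act N F).
Proof.
split=> [E F y s sz gs|E x y].
  by apply: eq_bigr => x _; apply: sem_sound.
apply: sem_complete => h s sz gs.
have H (M0 : hom X Y) :
    act M0 (fun x' => if x' == x then h else fun=> 0) y s = sem (M0 x y) h s.
  rewrite /act (bigD1 x) //= eqxx big1 ?addr0 // => x' /negbTE->.
  exact: sem0.
by rewrite -!H; apply: E.
Qed.

Lemma act_comp X Y Z (M : hom Y Z) (N : hom X Y) F z s :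
  act (hcomp M N) F z s = act M (act N F) z s.
Proof.
rewrite /act /hcomp.
under [RHS]eq_bigr => y _ do rewrite sem_sum.
by rewrite [RHS]exchange_big; apply: eq_bigr => x _; rewrite sem_big.
Qed.

Lemma act_ext X Y (M : hom X Y) F G : feq F G -> feq (act M F) (act M G).
Proof. by move=> E y s sz gs; apply: eq_bigr => x _; apply: sem_ext_gen => //; apply: E. Qed.

Lemma act0 X Y F y s : act (@hzero X Y) F y s = 0.
Proof. by rewrite /act big1. Qed.

Lemma act_fun0 X Y (M : hom X Y) y s : act M (fun _ _ => 0) y s = 0.
Proof. by rewrite /act big1 // => x _; rewrite sem0. Qed.

Lemma act_add X Y (M N : hom X Y) F y s :
  act (hadd M N) F y s = act M F y s + act N F y s.
Proof. by rewrite /act -big_split. Qed.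

Lemma act_funD X Y (M : hom X Y) F G y s :
  act M (fun x s => F x s + G x s) y s = act M F y s + act M G y s.
Proof. by rewrite /act -big_split; apply: eq_bigr => x _; exact: semD. Qed.

(** A splitting of the idempotent [e] of [A] by [B]. Letting [e] run through partial sums of the
    identity, a direct sum is built one summand at a time. *)
Definition retract (A : kpair) (e : hom (kobj A) (kobj A)) (B : kpair) : Prop :=
  kobj_ok B /\
  exists (M : hom (kobj A) (kobj B)) (N : hom (kobj B) (kobj A)),
    [/\ khom_ok M, khom_ok N, heq (hcomp N M) e & heq (hcomp M N) (kidem B)].

Lemma retract_kiso A B : kobj_ok A -> retract (kidem A) B -> kiso A B.
Proof. by move=> okA [okB H]; split. Qed.

Lemma heq_trans X Y (M N P : hom X Y) : heq M N -> heq N P -> heq M P.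
Proof. by move=> E E' x y; apply: teq_trans (E x y) (E' x y). Qed.

Lemma retract_eq A e e' B : heq e e' -> retract (A := A) e B -> retract e' B.
Proof.
move=> E [okB [M [N [okM okN NM MN]]]]; split=> //; exists M, N; split=> //.
exact: heq_trans NM E.
Qed.

Lemma retract0 A : retract (@hzero (kobj A) (kobj A)) kzero.
Proof.
split; first by split; case.
exists (fun x (y : void) => match y with end), (fun (x : void) y => match x with end).
split.
- by split=> [x []|x []|x []].
- by split=> [[]|[]|[]].
- apply/heqP => F y s sz gs; rewrite act_comp act0 /act big1 //; by case.
- by case.
Qed.

Definition hpair X Y1 Y2 (M1 : hom X Y1) (M2 : hom X Y2) : hom X (osum Y1 Y2) :=
  fun x y => match y return term (wd x) (@wd (osum Y1 Y2) y) with
  | inl y => M1 x y | inr y => M2 x y end.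

Definition hcopair X1 X2 Y (M1 : hom X1 Y) (M2 : hom X2 Y) : hom (osum X1 X2) Y :=
  fun x y => match x return term (@wd (osum X1 X2) x) (wd y) with
  | inl x => M1 x y | inr x => M2 x y end.

Lemma act_inl X1 X2 Y (M1 : hom X1 Y) (M2 : hom X2 Y)
    (F : idx (osum X1 X2) -> fn) y s :
  act (hcopair M1 M2) F y s
  = act M1 (fun x => F (inl x)) y s + act M2 (fun x => F (inr x)) y s.
Proof. by rewrite /act big_sumType. Qed.

Lemma act_hsum_l X Y X' Y' (M : hom X Y) (M' : hom X' Y') F y s :
  act (hsum M M') F (inl y) s = act M (fun x => F (inl x)) y s.
Proof. by rewrite /act big_sumType /= [X in _ + X]big1 ?addr0. Qed.

Lemma act_hsum_r X Y X' Y' (M : hom X Y) (M' : hom X' Y') F y s :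
  act (hsum M M') F (inr y) s = act M' (fun x => F (inr x)) y s.
Proof. by rewrite /act big_sumType /= [X in X + _]big1 ?add0r. Qed.

Lemma act_eq X Y (M N : hom X Y) F y s : heq M N ->
  size s = size (wd y) -> generic s -> act M F y s = act N F y s.
Proof. by move/heqP => E; apply: E. Qed.

Lemma retract_sum A e1 e2 B1 B2 :
  heq (hcomp e1 e2) (@hzero _ _) -> heq (hcomp e2 e1) (@hzero _ _) ->
  retract (A := A) e1 B1 -> retract (A := A) e2 B2 ->
  retract (A := A) (hadd e1 e2) (ksum B1 B2).
Proof.
move=> e12 e21 [[okB1 idB1] [M1 [N1 [[okM1 BM1 M1A] [okN1 AN1 N1B] NM1 MN1]]]].
move=> [[okB2 idB2] [M2 [N2 [[okM2 BM2 M2A] [okN2 AN2 N2B] NM2 MN2]]]].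
(* The mixed composites vanish: [M2 N1 = M2 (N2 M2) (N1 M1) N1 = M2 e2 e1 N1 = 0]. *)
have cross (B1' B2' : kpair) (M1' : hom (kobj A) (kobj B1'))
    (N1' : hom (kobj B1') (kobj A)) (M2' : hom (kobj A) (kobj B2'))
    (N2' : hom (kobj B2') (kobj A)) (e1' e2' : hom (kobj A) (kobj A)) :
    heq (hcomp (kidem B2') M2') M2' -> heq (hcomp N1' (kidem B1')) N1' ->
    heq (hcomp N1' M1') e1' -> heq (hcomp N2' M2') e2' ->
    heq (hcomp M1' N1') (kidem B1') -> heq (hcomp M2' N2') (kidem B2') ->
    heq (hcomp e2' e1') (@hzero _ _) ->
    forall F, feq (act M2' (act N1' F)) (fun _ _ => 0).
  move=> h1 h2 h3 h4 h5 h6 h7 F y s sz gs.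
  rewrite -(act_eq _ h1) // act_comp -(act_eq _ h6) // act_comp.
  rewrite -[RHS](act_fun0 M2' y s); apply: act_ext => // z t szt gt.
  transitivity (act (hcomp e2' e1') (act N1' F) z t); last by rewrite (act_eq _ h7) ?act0.
  rewrite act_comp -(act_eq _ h4) // act_comp; apply: act_ext => // z' t' sz' gt'.
  apply: act_ext => // z1 t1 sz1 gt1.
  rewrite -(act_eq _ h3) // act_comp.
  rewrite -(act_eq _ h2) // act_comp; apply: act_ext => // z2 t2 sz2 gt2.
  by rewrite -(act_eq _ h5) // act_comp.
split.
  split; first by move=> [x|x] [y|y]; [exact: okB1|exact: homog_zero|exact: homog_zero|exact: okB2].
  apply/heqP => F [y|y] s sz gs; rewrite act_comp ?act_hsum_l ?act_hsum_r.
    transitivity (act (hcomp (kidem B1) (kidem B1)) (fun x => F (inl x)) y s).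
      rewrite act_comp; apply: act_ext => // z t szt gt; exact: act_hsum_l.
    exact: act_eq.
  transitivity (act (hcomp (kidem B2) (kidem B2)) (fun x => F (inr x)) y s).
    rewrite act_comp; apply: act_ext => // z t szt gt; exact: act_hsum_r.
  exact: act_eq.
exists (hpair M1 M2), (hcopair N1 N2).
split.
- split=> [x [y|y]|x [y|y]|x [y|y]]; [exact: okM1|exact: okM2| | | | ].
  + apply: teq_trans _ (BM1 x y).
    apply: sem_complete => h s sz gs; rewrite !sem_big big_sumType /=.
    by rewrite [X in _ + X]big1 ?addr0.
  + apply: teq_trans _ (BM2 x y).
    apply: sem_complete => h s sz gs; rewrite !sem_big big_sumType /=.
    by rewrite [X in X + _]big1 ?add0r.
  + exact: M1A.
  + exact: M2A.
- split=> [[x|x] y|[x|x] y|[x|x] y]; [exact: okN1|exact: okN2| | | | ].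
  + exact: AN1.
  + exact: AN2.
  + apply: teq_trans _ (N1B x y).
    apply: sem_complete => h s sz gs; rewrite !sem_big big_sumType /=.
    by rewrite [X in _ + X]big1 ?addr0 // => z _; rewrite sem0.
  + apply: teq_trans _ (N2B x y).
    apply: sem_complete => h s sz gs; rewrite !sem_big big_sumType /=.
    by rewrite [X in X + _]big1 ?add0r // => z _; rewrite sem0.
- apply/heqP => F y s sz gs; rewrite act_add -(act_eq _ NM1) // -(act_eq _ NM2) //.
  by rewrite !act_comp act_inl.
- apply/heqP => F [y|y] s sz gs.
    rewrite act_hsum_l -(act_eq _ MN1) // !act_comp.
    transitivity (act M1 (fun z t => act N1 (fun x => F (inl x)) z t
                                   + act N2 (fun x => F (inr x)) z t) y s).
      by apply: act_ext => // z t szt gt; rewrite act_inl.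
    rewrite act_funD (cross _ _ M2 N2 M1 N1 e2 e1) ?addr0 //.
  rewrite act_hsum_r -(act_eq _ MN2) // !act_comp.
  transitivity (act M2 (fun z t => act N1 (fun x => F (inl x)) z t
                                 + act N2 (fun x => F (inr x)) z t) y s).
    by apply: act_ext => // z t szt gt; rewrite act_inl.
  by rewrite act_funD (cross _ _ M1 N1 M2 N2 e1 e2) ?add0r.
Qed.

Definition hsumv (X Y : obj) (I : Type) (r : seq I) (P : pred I)
    (e : I -> hom X Y) : hom X Y :=
  fun x y => \big[@tadd (wd x) (wd y) / tzero (wd x) (wd y)]_(i <- r | P i) e i x y.

Lemma act_sumv X Y I (r : seq I) (P : pred I) (e : I -> hom X Y) F y s :
  act (hsumv r P e) F y s = \sum_(i <- r | P i) act (e i) F y s.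
Proof. by rewrite /act exchange_big; apply: eq_bigr => x _; rewrite sem_big. Qed.

Lemma act_fun_sum X Y (M : hom X Y) I (r : seq I) (P : pred I) (F : I -> idx X -> fn) y s :
  act M (fun x s => \sum_(i <- r | P i) F i x s) y s = \sum_(i <- r | P i) act M (F i) y s.
Proof. by rewrite /act exchange_big; apply: eq_bigr => x _; exact: sem_sum. Qed.

Lemma orth_suml X (I : eqType) (r : seq I) (P : pred I) (e : I -> hom X X) (f : hom X X) :
  {in r, forall i, P i -> heq (hcomp (e i) f) (@hzero _ _)} ->
  heq (hcomp (hsumv r P e) f) (@hzero _ _).
Proof.
move=> E; apply/heqP => F y s sz gs.
rewrite act_comp act_sumv act0 big_seq_cond big1 // => i /andP[ir Pi].
by rewrite -act_comp (act_eq _ (E i ir Pi)) // act0.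
Qed.

Lemma orth_sumr X (I : eqType) (r : seq I) (P : pred I) (e : I -> hom X X) (f : hom X X) :
  {in r, forall i, P i -> heq (hcomp f (e i)) (@hzero _ _)} ->
  heq (hcomp f (hsumv r P e)) (@hzero _ _).
Proof.
move=> E; apply/heqP => F y s sz gs.
rewrite act_comp act0.
transitivity (act f (fun x s => \sum_(i <- r | P i) act (e i) F x s) y s).
  by apply: act_ext => // z t szt gt; rewrite act_sumv.
rewrite act_fun_sum big_seq_cond big1 // => i /andP[ir Pi].
by rewrite -act_comp (act_eq _ (E i ir Pi)) // act0.
Qed.

Lemma retract_big A (I : eqType) (r : seq I) (P : pred I)
    (e : I -> hom (kobj A) (kobj A)) (B : I -> kpair) : uniq r ->
  (forall i j, i != j -> P i -> P j -> heq (hcomp (e i) (e j)) (@hzero _ _)) ->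
  (forall i, P i -> retract (e i) (B i)) ->
  retract (A := A) (hsumv r P e) (\big[ksum/kzero]_(i <- r | P i) B i).
Proof.
move=> + orth ret; elim: r => [|i r IH] /=.
  move=> _; rewrite big_nil; apply: retract_eq (retract0 A) => x y.
  by rewrite /hsumv big_nil.
case/andP=> ir /IH{}IH; rewrite big_cons; case: ifP => Pi.
  apply: (@retract_eq _ (hadd (e i) (hsumv r P e))).
    by move=> x y; rewrite /hsumv big_cons Pi.
  apply: retract_sum (ret _ Pi) IH.
    apply: orth_sumr => j jr Pj; apply: orth => //.
    by apply: contraNneq ir => ->.
  apply: orth_suml => j jr Pj; apply: orth => //.
  by apply: contraNneq ir => <-.
by apply: retract_eq IH => x y; rewrite /hsumv big_cons Pi.
Qed.

(** * Divided differences *)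

Section Swap.
Variable T : eqType.
Implicit Type s : seq T.

Lemma size_swapk k s : size (swapk k s) = size s.
Proof. by elim: k s => [|k IH] [|x s] //=; [case: s | rewrite IH]. Qed.

Lemma perm_swapk k s : perm_eq (swapk k s) s.
Proof.
elim: k s => [|k IH] [|x s] //=; last by rewrite perm_cons.
by case: s => [|y s] //=; rewrite (perm_catCA [:: y] [:: x] s).
Qed.

Lemma swapkK k s : swapk k (swapk k s) = s.
Proof. by elim: k s => [|k IH] [|x s] //=; [case: s | rewrite IH]. Qed.

Lemma swapkC k l s : (k.+1 < l)%N -> swapk k (swapk l s) = swapk l (swapk k s).
Proof.
elim: k l s => [|k IH] [|l] [|x s] //= kl; last by rewrite IH.
by case: l kl => [|l] // _; case: s => [|y s].
Qed.

Lemma swapk_braid k s : (k.+2 < size s)%N ->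
  swapk k (swapk k.+1 (swapk k s)) = swapk k.+1 (swapk k (swapk k.+1 s)).
Proof.
elim: k s => [|k IH] [|x s] //=; last by move=> ks; rewrite IH.
by case: s => [|y [|z s]].
Qed.

Lemma nth_swapk x0 k s i : (k.+1 < size s)%N ->
  nth x0 (swapk k s) i =
  nth x0 s (if i == k then k.+1 else if i == k.+1 then k else i).
Proof.
elim: k s i => [|k IH] [|x s] i //=; first by case: s i => [|y s] [|[|i]].
by case: i => [|i] // ks; rewrite /= IH // !eqSS; case: eqP => // _; case: eqP.
Qed.

Lemma swapk_catl k s s' : (k.+1 < size s)%N -> swapk k (s ++ s') = swapk k s ++ s'.
Proof.
elim: k s => [|k IH] [|x s] //=; first by case: s.
by move=> ks; rewrite IH.
Qed.

Lemma swapk_catr n k s s' : size s = n -> swapk (n + k) (s ++ s') = s ++ swapk k s'.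
Proof. by elim: s n => [|x s IH] [|n] //= [sz]; rewrite IH. Qed.

(** Adjacent transpositions generate all permutations. The relation [R] is left open because the
    lemma serves both for the symmetry of functions and for signs. *)
Lemma perm_adjacent (R : seq T -> seq T -> Prop) :
  (forall s, R s s) -> (forall s2 s1 s3, R s1 s2 -> R s2 s3 -> R s1 s3) ->
  (forall s x y s', R (s ++ x :: y :: s') (s ++ y :: x :: s')) ->
  forall s s', perm_eq s s' -> R s s'.
Proof.
move=> Rr Rt Ra s s' ps; rewrite -[s]cat0s -[s']cat0s.
elim: s s' [::] ps => [|x s IH] s' p ps.
  by move: ps; rewrite perm_sym => /perm_nilP->.
have xs' : x \in s' by rewrite -(perm_mem ps) mem_head.
have mv q1 q2 : R (p ++ x :: q1 ++ q2) (p ++ q1 ++ x :: q2).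
  elim: q1 p {IH} => [|y q1 IH] p //=.
  apply: Rt (Ra p x y (q1 ++ q2)) _.
  by rewrite -(cat_rcons y p (x :: _)) -(cat_rcons y p (q1 ++ _)); apply: IH.
case/splitPr: xs' ps => p1 p2.
rewrite perm_sym perm_catC /= perm_cons perm_sym => ps.
have ps' : perm_eq s (p1 ++ p2) by rewrite (perm_trans ps) // perm_catC.
by apply: Rt (mv p1 p2); rewrite -(cat_rcons x p s) -(cat_rcons x p (p1 ++ p2)); apply: IH.
Qed.
End Swap.

Definition ddk (k : nat) (h : fn) : fn := fun s =>
  (h s - h (swapk k s)) / (nth 0 s k - nth 0 s k.+1).

Definition ddw (ks : seq nat) (h : fn) : fn := foldr ddk h ks.

Definition pt n (s : seq rat) : Prop := size s = n /\ uniq s.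

Lemma pt_swapk n k s : pt n s -> pt n (swapk k s).
Proof. by case=> sz us; split; rewrite ?size_swapk // (perm_uniq (perm_swapk k s)). Qed.

Lemma pt_perm n s s' : perm_eq s s' -> pt n s -> pt n s'.
Proof. by move=> ps [sz us]; split; rewrite -?(perm_size ps) // -(perm_uniq ps). Qed.

Lemma nth_sub_neq0 (n i j : nat) s : pt n s -> (i < n)%N -> (j < n)%N -> i != j ->
  nth 0 s i - nth 0 s j != 0 :> rat.
Proof. by case=> sz us li lj ij; rewrite subr_eq0 nth_uniq ?sz. Qed.

Definition eqo n (F G : fn) := forall s, pt n s -> F s = G s.

Lemma ddk_ext n k (F G : fn) : eqo n F G -> eqo n (ddk k F) (ddk k G).
Proof. by move=> E s ps; rewrite /ddk !E //; apply: pt_swapk. Qed.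

Lemma ddw_ext n ks (F G : fn) : eqo n F G -> eqo n (ddw ks F) (ddw ks G).
Proof. by move=> E; elim: ks => //= k ks IH; apply: ddk_ext. Qed.

Lemma ddw0 n ks (F : fn) : eqo n F (fun=> 0) -> eqo n (ddw ks F) (fun=> 0).
Proof.
move=> F0; elim: ks => //= k ks IH s ps.
by rewrite /ddk !IH ?subrr ?mul0r //; apply: pt_swapk.
Qed.

Lemma ddw_cat ks ks' h : ddw (ks ++ ks') h = ddw ks (ddw ks' h).
Proof. by rewrite /ddw foldr_cat. Qed.

Lemma ddk_sq n k h : (k.+1 < n)%N -> eqo n (ddk k (ddk k h)) (fun=> 0).
Proof.
move=> kn s ps; rewrite /ddk swapkK !nth_swapk ?(ps.1) // eqxx.
rewrite (gtn_eqF (ltnSn k)) eqxx.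
have d : nth 0 s k - nth 0 s k.+1 != 0 by apply: nth_sub_neq0 ps _ _ _; lia.
have d' : nth 0 s k.+1 - nth 0 s k != 0 by apply: nth_sub_neq0 ps _ _ _; lia.
by field; apply/andP; split.
Qed.

Lemma ddk_comm n k l h : (k.+1 < l)%N -> (l.+1 < n)%N ->
  eqo n (ddk k (ddk l h)) (ddk l (ddk k h)).
Proof.
move=> kl ln s ps; have kn : (k.+1 < n)%N by lia.
rewrite /ddk (swapkC _ kl) !nth_swapk ?(ps.1) //.
have -> : (l == k) = false by lia.
have -> : (l == k.+1) = false by lia.
have -> : (l.+1 == k) = false by lia.
have -> : (l.+1 == k.+1) = false by lia.
have -> : (k == l) = false by lia.
have -> : (k == l.+1) = false by lia.
have -> : (k.+1 == l) = false by lia.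
have -> : (k.+1 == l.+1) = false by lia.
have d : nth 0 s k - nth 0 s k.+1 != 0 by apply: nth_sub_neq0 ps _ _ _; lia.
have d' : nth 0 s l - nth 0 s l.+1 != 0 by apply: nth_sub_neq0 ps _ _ _; lia.
by field; apply/andP; split.
Qed.

Lemma ddk_braid n k h : (k.+2 < n)%N ->
  eqo n (ddk k (ddk k.+1 (ddk k h))) (ddk k.+1 (ddk k (ddk k.+1 h))).
Proof.
move=> kn s ps; rewrite /ddk !swapkK.
have sz := ps.1; have kn1 : (k.+1 < n)%N by lia.
rewrite !(nth_swapk, size_swapk) ?sz //; try lia.
have e1 : (k == k.+1) = false by lia.
have e2 : (k.+1 == k) = false by lia.
have e3 : (k == k.+2) = false by lia.
have e4 : (k.+2 == k) = false by lia.
have e5 : (k.+1 == k.+2) = false by lia.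
have e6 : (k.+2 == k.+1) = false by lia.
rewrite !(eqxx, e1, e2, e3, e4, e5, e6).
rewrite -(swapk_braid (s := s)) ?sz //.
set x := nth 0 s k; set y := nth 0 s k.+1; set z := nth 0 s k.+2.
have d1 : x - y != 0 by apply: nth_sub_neq0 ps _ _ _; lia.
have d2 : y - z != 0 by apply: nth_sub_neq0 ps _ _ _; lia.
have d3 : x - z != 0 by apply: nth_sub_neq0 ps _ _ _; lia.
have d4 : y - x != 0 by apply: nth_sub_neq0 ps _ _ _; lia.
have d5 : z - y != 0 by apply: nth_sub_neq0 ps _ _ _; lia.
have d6 : z - x != 0 by apply: nth_sub_neq0 ps _ _ _; lia.
by field; do ?[apply/andP; split].
Qed.

Definition cyc n := rev (iota 0 n).

Lemma longest_wordS n : longest_word n.+1 = longest_word n ++ cyc n.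
Proof. by rewrite /longest_word -addn1 iotaD map_cat flatten_cat /= cats0. Qed.

Lemma size_cyc n : size (cyc n) = n.
Proof. by rewrite size_rev size_iota. Qed.

Lemma cyc_lt n e : (e \in cyc n) = (e < n)%N.
Proof. by rewrite mem_rev mem_iota. Qed.

Lemma nth_cyc n i : (i < n)%N -> nth 0%N (cyc n) i = (n - i.+1)%N.
Proof.
move=> li; rewrite nth_rev size_iota // nth_iota //.
by rewrite ltn_subrL (leq_ltn_trans _ li).
Qed.

Lemma cycS n : cyc n.+1 = n :: cyc n.
Proof. by rewrite /cyc -addn1 iotaD rev_cat. Qed.

Lemma ddw_cyc_comm n m k h : (m < k)%N -> (k.+1 < n)%N ->
  eqo n (ddw (cyc m) (ddk k h)) (ddk k (ddw (cyc m) h)).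
Proof.
elim: m => [|m IH] mk kn s ps //; rewrite cycS /=.
rewrite (ddk_ext _ (IH (ltnW mk) kn)) //.
by apply: ddk_comm ps.
Qed.

(** The letter [k.+1] commutes with the letters below [k], becomes [k] by one braid move with the
    letters [k.+1] and [k], and then commutes with the larger ones. *)
Lemma ddw_cyc_pass n m k h : (k.+1 < m)%N -> (m < n)%N ->
  eqo n (ddw (cyc m) (ddk k.+1 h)) (ddk k (ddw (cyc m) h)).
Proof.
elim: m => [|m IH] // km mn s ps; rewrite cycS /=.
move: km; rewrite ltnS leq_eqVlt => /orP[/eqP e|km]; last first.
  rewrite (ddk_ext _ (IH km (ltnW mn))) //.
  by symmetry; apply: ddk_comm ps.
subst m; rewrite cycS /=.
have H : eqo n (ddw (cyc k) (ddk k.+1 h)) (ddk k.+1 (ddw (cyc k) h)).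
  by apply: ddw_cyc_comm => //; exact: mn.
rewrite (ddk_ext _ (ddk_ext _ H)) //.
by symmetry; apply: (ddk_braid _ mn).
Qed.

(** By [ddw_cyc_pass] the letters of the second cycle move to the left, lowered by one, except its
    final 0. That one meets the final 0 of the first cycle, and a divided difference squares to
    zero. *)
Lemma ddw_cyc2 n m h : (m < n)%N ->
  eqo n (ddw (cyc m) (ddw (cyc m) h)) (fun s => if m is 0 then h s else 0).
Proof.
case: m => [|m] mn s ps //.
suff H j : (j <= m)%N -> ddw (cyc m.+1) (ddw (cyc j.+1) h) s =
    ddw (rev (iota 0 j)) (ddw (cyc m.+1) (ddk 0 h)) s.
  rewrite H //.
  suff E : eqo n (ddw (cyc m.+1) (ddk 0 h)) (fun=> 0).
    exact: ddw0 E s ps.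
  have E1 t : pt n t -> ddw (cyc m.+1) (ddk 0 h) t = 0.
    move=> pt0; rewrite /cyc /= rev_cons -cats1 ddw_cat /=.
    have E2 : eqo n (ddk 0 (ddk 0 h)) (fun=> 0) by apply: ddk_sq; apply: leq_ltn_trans mn.
    exact: ddw0 E2 t pt0.
  exact: E1.
elim: j h s ps => [|j IH] h s ps jm; first by rewrite /= .
rewrite (cycS j.+1) [ddw (_ :: _) _]/= (ddw_cyc_pass _ _ mn ps) //.
have -> : rev (iota 0 j.+1) = j :: rev (iota 0 j) by rewrite -/(cyc _) cycS.
rewrite /=.
have E : eqo n (ddw (cyc m.+1) (ddw (cyc j.+1) h))
               (ddw (rev (iota 0 j)) (ddw (cyc m.+1) (ddk 0 h))).
  by move=> t pt0; apply: IH => //; apply: ltnW.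
exact: (ddk_ext _ E) s ps.
Qed.

(** Induction settles all letters but the largest. That one commutes with the initial part of the
    word and turns the next cycle into a second copy of the cycle that follows, so [ddw_cyc2]
    applies. *)
Lemma ddk_longest n m k h : (k.+1 < m)%N -> (m <= n)%N ->
  eqo n (ddk k (ddw (longest_word m) h)) (fun=> 0).
Proof.
elim: m k h => [|m IH] k h // km mn s ps.
rewrite longest_wordS ddw_cat.
move: km; rewrite ltnS leq_eqVlt => /orP[/eqP e|km]; last by rewrite IH // ltnW.
case: m e IH mn => [|m] // [->] IH mn; rewrite longest_wordS ddw_cat.
have comm l h0 : (l < m.+1)%N ->
    eqo n (ddk m (ddw (longest_word l) h0)) (ddw (longest_word l) (ddk m h0)).
  elim: l h0 => [|l IHl] h0 lm t ptt //; rewrite longest_wordS !ddw_cat.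
  rewrite IHl //; last exact: ltnW.
  apply: (ddw_ext _ _ ptt) => {}t {}ptt; symmetry; apply: ddw_cyc_comm ptt => //.
rewrite comm //.
have E : eqo n (ddk m (ddw (cyc m) (ddw (cyc m.+1) h))) (fun=> 0).
  move=> t ptt; transitivity (ddw (cyc m.+1) (ddw (cyc m.+1) h) t).
    by rewrite {2}cycS.
  by rewrite (ddw_cyc2 _ _ ptt).
exact: ddw0 E s ps.
Qed.

Lemma longest_sym n h s s' : pt n s -> perm_eq s s' ->
  ddw (longest_word n) h s = ddw (longest_word n) h s'.
Proof.
move=> ps pss.
pose F := ddw (longest_word n) h.
suff [] : perm_eq s s' /\ (pt n s -> F s = F s') by move=> _; apply.
move: pss; apply: (@perm_adjacent _ (fun s s' => perm_eq s s' /\ (pt n s -> F s = F s'))).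
- by [].
- move=> s2 s1 s3 [p12 E] [p23 E']; split; first exact: perm_trans p23.
  by move=> p1; rewrite E // E' //; apply: pt_perm p1.
- move=> {ps s s'} s x y s'; split.
    by rewrite perm_cat2l (perm_catCA [:: x] [:: y] s').
  move=> ps; have sz := ps.1; move: sz; rewrite size_cat /= => sz.
  have ks : ((size s).+1 < n)%N by rewrite -sz !addnS !ltnS leq_addr.
  have := ddk_longest h ks (leqnn n) ps.
  rewrite /ddk swapk_cat => /eqP.
  rewrite mulf_eq0 invr_eq0 (negbTE (nth_sub_neq0 ps _ _ _)) ?orbF; last first.
  - by rewrite neq_ltn ltnSn.
  - by [].
  - exact: ltnW.
  by rewrite subr_eq0 => /eqP.
Qed.

(** * Alternating sums *)

Definition pm n (w : 'S_n) (s : seq rat) : seq rat :=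
  [seq nth 0 s (w i) | i <- enum 'I_n].

Lemma size_pm n (w : 'S_n) s : size (pm w s) = n.
Proof. by rewrite size_map size_enum_ord. Qed.

Lemma nth_pm n (w : 'S_n) s (i : 'I_n) : nth 0 (pm w s) i = nth 0 s (w i).
Proof. by rewrite (nth_map i) ?nth_ord_enum // size_enum_ord. Qed.

Lemma perm_pm n (w : 'S_n) s : size s = n -> perm_eq (pm w s) s.
Proof.
move=> sz; have {2}-> : s = [seq nth 0 s i | i <- [seq val i | i <- enum 'I_n]].
  by rewrite val_enum_ord -sz map_nth_iota0 // take_size.
rewrite -map_comp /pm.
have -> : [seq nth 0 s (w i) | i <- enum 'I_n] =
          [seq (nth 0 s \o val) i | i <- [seq w i | i <- enum 'I_n]].
  by rewrite -[RHS]map_comp.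
apply: perm_map; apply: uniq_perm.
- by rewrite (map_inj_uniq (@perm_inj _ w)) enum_uniq.
- exact: enum_uniq.
by move=> i; rewrite mem_enum -{1}(permKV w i) map_f ?mem_enum.
Qed.

(** Exponents decrease along the rows, so that [dlt 0 n] is the product of the diagonal entries. *)
Definition Vd n (s : seq rat) : rat :=
  \det (\matrix_(i < n, j < n) nth 0 s j ^+ (n - i.+1)).

Lemma Vd_neq0 n s : pt n s -> Vd n s != 0.
Proof.
move=> ps; rewrite /Vd.
pose a : 'rV[rat]_n := \row_j nth 0 s j.
have -> : \matrix_(i < n, j < n) nth 0 s j ^+ (n - i.+1) =
          row_perm (perm (@rev_ord_inj n)) (Vandermonde n a).
  by apply/matrixP => i j; rewrite !mxE permE.
rewrite row_permE det_mulmx det_perm det_Vandermonde mulf_neq0 ?signr_eq0 //.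
apply/prodf_neq0 => i _; apply/prodf_neq0 => j ij; rewrite !mxE.
by apply: nth_sub_neq0 ps _ _ _ => //; rewrite neq_ltn ij orbT.
Qed.

Definition Alt n (h : fn) : fn := fun s =>
  (\sum_(w : 'S_n) (-1) ^+ w * h (pm w s)) / Vd n s.

Lemma Alt_local n h h' s : pt n s ->
  (forall s', pt n s' -> perm_eq s' s -> h s' = h' s') -> Alt n h s = Alt n h' s.
Proof.
move=> ps E; congr (_ / _); apply: eq_bigr => w _.
have pw := perm_pm w ps.1.
by rewrite E //; apply: pt_perm ps; rewrite perm_sym.
Qed.

Lemma Alt_ext n h h' : eqo n h h' -> eqo n (Alt n h) (Alt n h').
Proof. by move=> E s ps; apply: Alt_local => // s' ps' _; apply: E. Qed.

Lemma AltZ n c h s : Alt n (fun s => c * h s) s = c * Alt n h s.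
Proof.
rewrite /Alt mulrA mulr_sumr; congr (_ / _).
by apply: eq_bigr => w _; rewrite mulrCA.
Qed.

Lemma AltD n h h' s : Alt n (fun s => h s + h' s) s = Alt n h s + Alt n h' s.
Proof.
rewrite /Alt -mulrDl -big_split; congr (_ / _).
by apply: eq_bigr => w _; rewrite mulrDr.
Qed.

Lemma AltZ_sym n (c h : fn) s : pt n s ->
  (forall s', perm_eq s' s -> c s' = c s) ->
  Alt n (fun s => c s * h s) s = c s * Alt n h s.
Proof.
by move=> ps E; rewrite -AltZ; apply: Alt_local => // s' _ /E->.
Qed.

Lemma Alt_fubini n n' (H : seq rat -> seq rat -> rat) s s' :
  Alt n (fun t => Alt n' (H t) s') s = Alt n' (fun t' => Alt n (H^~ t') s) s'.
Proof.
rewrite /Alt.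
transitivity (\sum_(w : 'S_n) \sum_(w' : 'S_n')
  (-1) ^+ w * (-1) ^+ w' * H (pm w s) (pm w' s') / Vd n s / Vd n' s').
  rewrite mulr_suml; apply: eq_bigr => w _.
  rewrite mulrA mulr_sumr !mulr_suml; apply: eq_bigr => w' _.
  by rewrite -!mulrA; congr (_ * (_ * (_ * _))); rewrite mulrC.
rewrite exchange_big /= [RHS]mulr_suml; apply: eq_bigr => w' _.
rewrite mulrA mulr_sumr !mulr_suml; apply: eq_bigr => w _.
by rewrite -!mulrA mulrCA; congr (_ * (_ * (_ * _))).
Qed.

Section Adjacent.
Variables (n k : nat) (kn : (k.+1 < n)%N).
Let i0 : 'I_n := Ordinal (ltnW kn).
Let i1 : 'I_n := Ordinal kn.
Let t := tperm i0 i1.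

Lemma swapk_pm (w : 'S_n) s : swapk k (pm w s) = pm (t * w)%g s.
Proof.
apply: (@eq_from_nth _ 0); rewrite size_swapk ?size_pm // => i li.
rewrite nth_swapk ?size_pm //.
rewrite -[i]/(val (Ordinal li)) nth_pm permM; case: tpermP => [->|->|ni0 ni1] /=.
- by rewrite eqxx -[k.+1]/(val i1) nth_pm.
- by rewrite eqn_leq ltnn andFb eqxx -[X in nth 0 _ X]/(val i0) nth_pm.
- case: eqP => [e|_]; first by case: ni0; apply: val_inj.
  case: eqP => [e|_]; first by case: ni1; apply: val_inj.
  by rewrite -[i]/(val (Ordinal li)) nth_pm.
Qed.

Lemma odd_swap (w : 'S_n) : odd_perm (t * w)%g = ~~ odd_perm w.
Proof. by rewrite odd_mul_tperm -val_eqE /= ltn_eqF. Qed.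

Lemma Alt_swap h s : Alt n (fun s => h (swapk k s)) s = - Alt n h s.
Proof.
rewrite /Alt -mulNr; congr (_ / _); rewrite -sumrN.
rewrite (reindex_inj (mulgI t)); apply: eq_bigr => w _.
rewrite -swapk_pm swapkK odd_swap signrN mulNr; congr (- (_ * _)).
Qed.

(** The nilHecke identity [d_k x_k d_k = d_k] seen through an antisymmetrizer: the second half of
    [ddk] is brought to the form of the first by [Alt_swap], and the two coefficients add up to
    [E]. *)
Lemma Alt_ddk (E h : fn) s : pt n s ->
  (forall s', pt n s' -> E (swapk k s') = E s') ->
  Alt n (fun s => E s * (nth 0 s k * ddk k h s)) s = Alt n (fun s => E s * h s) s.
Proof.
move=> ps Esym.
pose g s := E s * nth 0 s k / (nth 0 s k - nth 0 s k.+1).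
pose F s := g (swapk k s) * h s.
transitivity (Alt n (fun s => g s * h s) s
              + (-1) * Alt n (fun s => F (swapk k s)) s).
  rewrite -AltZ -AltD; apply: Alt_ext (ps) => s' ps'.
  by rewrite /F swapkK /g /ddk; ring.
rewrite (Alt_swap F) mulN1r opprK -AltD; apply: Alt_ext (ps) => s' ps'.
rewrite -mulrDl; congr (_ * _).
rewrite /g Esym // !nth_swapk ?(ps'.1) // !eqxx gtn_eqF //.
have d : nth 0 s' k - nth 0 s' k.+1 != 0 by apply: nth_sub_neq0 ps' _ _ _; lia.
have d' : nth 0 s' k.+1 - nth 0 s' k != 0 by apply: nth_sub_neq0 ps' _ _ _; lia.
by field; apply/andP; split.
Qed.
End Adjacent.

Definition bprod off j (s : seq rat) : rat := \prod_(x <- take j (drop off s)) x.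

Lemma bprod0 off s : bprod off 0 s = 1.
Proof. by rewrite /bprod take0 big_nil. Qed.

Lemma bprodS off j s : (off + j < size s)%N ->
  bprod off j.+1 s = bprod off j s * nth 0 s (off + j).
Proof.
move=> lj; rewrite /bprod (take_nth 0) ?size_drop ?ltn_subRL //.
by rewrite -cats1 big_cat big_seq1 nth_drop.
Qed.

Lemma bprod_swapk off j k s : (k.+1 < j)%N || (j <= k)%N -> (off + j <= size s)%N ->
  bprod off j (swapk (off + k) s) = bprod off j s.
Proof.
move=> kj lj; rewrite /bprod.
have so : size (take off s) = off by rewrite size_takel // (leq_trans (leq_addr _ _) lj).
rewrite -[s](cat_take_drop off) swapk_catr // !drop_cat so ltnn subnn !drop0.
have sd : (j <= size (drop off s))%N.
  by rewrite size_drop -(leq_add2l off) subnKC // (leq_trans (leq_addr _ _) lj).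
set u := drop off s in sd *.
have sj : size (take j u) = j by rewrite size_takel.
have {2}-> : u = take j u ++ drop j u by rewrite cat_take_drop.
have {1}-> : u = take j u ++ drop j u by rewrite cat_take_drop.
case/orP: kj => [kj|jk].
  rewrite swapk_catl ?sj // !take_cat !size_swapk sj ltnn subnn take0 !cats0.
  exact/perm_big/perm_swapk.
by rewrite -(subnKC jk) swapk_catr // !take_cat sj ltnn subnn !take0.
Qed.

Lemma ddw_mull n (E h : fn) ks :
  (forall k, k \in ks -> forall s, pt n s -> E (swapk k s) = E s) ->
  eqo n (ddw ks (fun s => E s * h s)) (fun s => E s * ddw ks h s).
Proof.
elim: ks => [|k ks IH] Es s ps //=.
rewrite (ddk_ext _ (IH _)) //; last by move=> k' k'ks; apply: Es; rewrite inE k'ks orbT.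
by rewrite /ddk Es ?mem_head // -mulrBr mulrA.
Qed.

Definition shw off (ks : seq nat) := [seq (off + k)%N | k <- ks].

Lemma Alt_cyc n off j h : (off + j < n)%N || (j == 0%N) ->
  eqo n (Alt n h) (Alt n (fun s => bprod off j s * ddw (shw off (cyc j)) h s)).
Proof.
elim: j h => [|j IH] h lj s ps.
  by apply: Alt_ext (ps) => s' ps'; rewrite bprod0 mul1r.
have lj' : ((off + j).+1 < n)%N by rewrite -addnS; case/orP: lj.
rewrite IH //; last by apply/orP; left; apply: ltnW.
rewrite -(Alt_ddk lj' _ ps); last first.
  by move=> s' ps'; rewrite bprod_swapk ?leqnn ?orbT // ps'.1 ltnW // ltnW.
apply: Alt_ext (ps) => s' ps'.
by rewrite cycS /= bprodS ?mulrA // ps'.1 ltnW.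
Qed.

(** The monomial [x_1^(n-1) ... x_(n-1)] as the product of the initial partial products of lengths
    below [n], one for each cycle in [longest_word n]. *)
Fixpoint dlt off n (s : seq rat) : rat :=
  if n is n'.+1 then dlt off n' s * bprod off n' s else 1.

Lemma mem_longest n k : k \in longest_word n -> (k.+1 < n)%N.
Proof.
elim: n => // n IH; rewrite longest_wordS mem_cat /cyc mem_rev mem_iota add0n.
by case/orP => [/IH/ltnW|].
Qed.

(** In other words an antisymmetrizer absorbs the idempotent [delta_n D_n] of a block of points.
    Cycles are split off one by one; the partial product of length [n] is invariant under the
    letters of [longest_word n] and can be moved past them. *)
Lemma Alt_absorb m off n h : (off + n <= m)%N ->
  eqo m (Alt m h) (Alt m (fun s => dlt off n s * ddw (shw off (longest_word n)) h s)).
Proof.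
elim: n h => [|n IH] h lm s ps.
  by apply: Alt_ext (ps) => s' ps'; rewrite mul1r.
rewrite (@Alt_cyc m off n) //; last by rewrite -addnS lm.
rewrite IH //; last by apply: leq_trans lm; rewrite leq_add2l.
apply: Alt_ext (ps) => s' ps'.
rewrite longest_wordS /shw map_cat ddw_cat (@ddw_mull m) //= ?mulrA //.
move=> k /mapP[l /mem_longest ll ->] s'' ps''; apply: bprod_swapk; first by rewrite ll.
by rewrite ps''.1; apply: leq_trans lm; rewrite leq_add2l.
Qed.

Definition ptens (fs : seq {poly rat}) (s : seq rat) : rat :=
  \prod_(q <- zip fs s) q.1.[q.2].

Lemma ptens_cat fs gs s t : size fs = size s ->
  ptens (fs ++ gs) (s ++ t) = ptens fs s * ptens gs t.
Proof. by move=> sz; rewrite /ptens zip_cat // big_cat. Qed.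

Lemma ptens_cons f fs x s : ptens (f :: fs) (x :: s) = f.[x] * ptens fs s.
Proof. by rewrite /ptens /= big_cons. Qed.

Lemma ptens_nil s : ptens [::] s = 1.
Proof. by rewrite /ptens; case: s => [|x s]; rewrite big_nil. Qed.

Lemma ptens_nth n fs s : size fs = n -> size s = n ->
  ptens fs s = \prod_(i < n) (nth 0 fs i).[nth 0 s i].
Proof.
move=> sf ss; rewrite /ptens (big_nth (0, 0)) big_mkord size_zip sf ss minnn.
by apply: eq_bigr => i _; rewrite nth_zip ?sf.
Qed.

Lemma Alt_ptens n fs s : size fs = n -> size s = n ->
  Alt n (ptens fs) s =
  \det (\matrix_(i < n, j < n) (nth 0 fs i).[nth 0 s j]) / Vd n s.
Proof.
move=> sf ss; rewrite /Alt; congr (_ / _); apply: eq_bigr => w _.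
rewrite (ptens_nth sf) ?size_pm //; congr (_ * _).
by apply: eq_bigr => i _; rewrite mxE nth_pm.
Qed.

(** An alternant of polynomials of degree less than [n] is this number times the Vandermonde
    determinant, so its quotient [Alt] does not depend on the points. *)
Definition dcoef n (fs : seq {poly rat}) : rat :=
  \det (\matrix_(i < n, j < n) (nth 0 fs i)`_(n - j.+1)).

Lemma det_dcoef n (fs : seq {poly rat}) (s : seq rat) :
  size fs = n -> {in fs, forall f : {poly rat}, (size f <= n)%N} ->
  \det (\matrix_(i < n, j < n) (nth 0 fs i).[nth 0 s j]) = dcoef n fs * Vd n s.
Proof.
move=> sf sz; rewrite /dcoef /Vd -det_mulmx; congr (\det _).
apply/matrixP => i j; rewrite !mxE.
have szi : (size (nth 0%R fs i) <= n)%N by apply: sz; rewrite mem_nth ?sf.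
rewrite (horner_coef_wide _ szi) (reindex_inj rev_ord_inj).
by apply: eq_bigr => k _; rewrite !mxE.
Qed.

Lemma Alt_dcoef n (fs : seq {poly rat}) s :
  pt n s -> size fs = n -> {in fs, forall f : {poly rat}, (size f <= n)%N} ->
  Alt n (ptens fs) s = dcoef n fs.
Proof.
move=> ps sf sz; rewrite Alt_ptens ?ps.1 // det_dcoef //.
by rewrite mulfK ?Vd_neq0.
Qed.

Lemma dcoef_monic n (fs : seq {poly rat}) : size fs = n ->
  (forall i, (i < n)%N -> size (nth 0 fs i) = (n - i)%N /\ nth 0 fs i \is monic) ->
  dcoef n fs = 1.
Proof.
move=> sf mf; rewrite /dcoef -det_tr det_trig.
  apply: big1 => i _; rewrite !mxE; have [si /monicP] := mf i (ltn_ord i).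
  by rewrite lead_coefE si subnS.
apply/is_trig_mxP => i j ij; rewrite !mxE nth_default //.
by have [-> _] := mf j (ltn_ord j); have := ltn_ord j; lia.
Qed.

Lemma dlt_ptens n s : size s = n -> dlt 0 n s = ptens [seq 'X^e | e <- cyc n] s.
Proof.
move=> sz; suff H j : (j <= n)%N ->
    dlt 0 j s = ptens [seq 'X^e | e <- cyc j] (take j s).
  by rewrite H // -sz take_size.
elim: j => [|j IH] lj; first by rewrite take0 ptens_nil.
rewrite [LHS]/= IH ?(ltnW lj) //.
have E k : (k <= n)%N -> ptens [seq 'X^e | e <- cyc k] (take k s) =
    \prod_(i < k) nth 0 s i ^+ (k - i.+1).
  move=> lk; rewrite (@ptens_nth k) ?size_map ?size_cyc ?size_takel ?sz //.
  apply: eq_bigr => i _.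
  by rewrite (nth_map 0%N) ?size_cyc // nth_cyc // hornerXn nth_take.
rewrite !E //; last exact: ltnW.
have -> : bprod 0 j s = \prod_(i < j) nth 0 s i.
  rewrite /bprod drop0 (big_nth 0) big_mkord size_takel ?sz ?(ltnW lj) //.
  by apply: eq_bigr => i _; rewrite nth_take.
rewrite big_ord_recr /= subnn expr0 mulr1 -big_split; apply: eq_bigr => i _ /=.
by rewrite -exprSr; congr (_ ^+ _); have := ltn_ord i; lia.
Qed.

Lemma Alt_dlt n : eqo n (Alt n (dlt 0 n)) (fun=> 1).
Proof.
move=> s ps.
have E : eqo n (dlt 0 n) (ptens [seq 'X^e | e <- cyc n]).
  by move=> s' ps'; rewrite dlt_ptens ?ps'.1.
have nE i : (i < n)%N -> nth 0 [seq 'X^e | e <- cyc n] i = 'X^(n - i.+1) :> {poly rat}.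
  by move=> li; rewrite (nth_map 0%N) ?size_cyc // nth_cyc.
rewrite (Alt_ext E) // Alt_dcoef ?dcoef_monic ?size_map ?size_cyc //.
  by move=> i li; rewrite nE // size_polyXn monicXn; split => //; lia.
by move=> f /mapP[e]; rewrite mem_rev mem_iota => le ->; rewrite size_polyXn.
Qed.

(** In [Alt h = Alt (delta D h)] the factor [D h] is symmetric and comes out, and
    [Alt delta = 1]. *)
Lemma ddw_longest n h : eqo n (ddw (longest_word n) h) (Alt n h).
Proof.
move=> s ps; rewrite (@Alt_absorb n 0 n) //.
have -> : shw 0 (longest_word n) = longest_word n by rewrite /shw map_id.
transitivity (Alt n (fun s' => ddw (longest_word n) h s' * dlt 0 n s') s); last first.
  by congr (Alt n _ s); apply: funext => s'; rewrite mulrC.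
rewrite AltZ_sym ?Alt_dlt ?mulr1 ?ps.1 // => s' ps'.
by apply: longest_sym => //; apply: (pt_perm _ ps); rewrite perm_sym.
Qed.

Lemma Alt_sym n h s s' : pt n s -> perm_eq s s' -> Alt n h s = Alt n h s'.
Proof.
move=> ps pss; rewrite -!ddw_longest //; last exact: pt_perm ps.
exact: longest_sym.
Qed.

(** * Alternants and determinants *)

Definition altf (c : nat) (Phi : seq {poly rat} -> rat) : Prop :=
  forall A x y B, size (A ++ x :: y :: B) = c ->
    Phi (A ++ x :: y :: B) = - Phi (A ++ y :: x :: B).

(** The sign is chosen before [Phi] and [f]. Later the rows vary with the points while their labels
    do not, so one sign serves at all points. *)
Lemma altf_perm (T : eqType) (labs labs' : seq T) : perm_eq labs labs' ->
  exists e : bool, forall c Phi (f : T -> {poly rat}), altf c Phi -> size labs = c ->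
    Phi (map f labs) = (-1) ^+ e * Phi (map f labs').
Proof.
move=> pl.
pose R l l' := perm_eq l l' /\ exists e : bool, forall c Phi (f : T -> {poly rat}),
  altf c Phi -> size l = c -> Phi (map f l) = (-1) ^+ e * Phi (map f l').
suff [] : R labs labs' by [].
apply: (perm_adjacent _ _ _ pl) => {labs labs' pl}.
- by move=> s; split=> //; exists false => c Phi f _ _; rewrite expr0 mul1r.
- move=> s2 s1 s3 [p12 [e1 E1]] [p23 [e2 E2]]; split; first exact: perm_trans p23.
  exists (e1 (+) e2) => c Phi f aP sz.
  by rewrite (E1 _ _ _ aP sz) (E2 c) -?(perm_size p12) // signr_addb mulrA.
- move=> s x y s'; split; first by rewrite perm_cat2l (perm_catCA [:: x] [:: y] s').
  exists true => c Phi f aP sz; rewrite expr1 mulN1r !map_cat /=.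
  by apply: aP; rewrite -sz !size_cat /= !size_map.
Qed.

Lemma dup_perm (T : eqType) (s : seq T) : ~~ uniq s ->
  exists x r, perm_eq s [:: x, x & r].
Proof.
elim: s => //= x s IH; rewrite negb_and negbK => /orP[xs|/IH[y [r pr]]].
  by exists x, (rem x s); rewrite perm_cons; apply: perm_to_rem.
exists y, (x :: r); rewrite -(perm_cons x) in pr; apply: perm_trans pr _.
by rewrite perm_sym (perm_catCA [:: y; y] [:: x] r).
Qed.

Lemma altf_dup (T : eqType) (labs : seq T) c Phi (f : T -> {poly rat}) :
  altf c Phi -> size labs = c -> ~~ uniq labs -> Phi (map f labs) = 0.
Proof.
move=> aP sz /dup_perm[x [r pr]].
have [e E] := altf_perm pr; rewrite (E _ _ _ aP sz) /=.
have := aP [::] (f x) (f x) (map f r); rewrite /= size_map => /(_ _)/eqP.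
rewrite -sz (perm_size pr) => /(_ erefl).
rewrite -addr_eq0 -mulr2n mulrn_eq0 /= => /eqP->.
by rewrite mulr0.
Qed.

Lemma ptens_swap n A x y B s' : size (A ++ x :: y :: B) = n -> size s' = n ->
  ptens (A ++ x :: y :: B) s' = ptens (A ++ y :: x :: B) (swapk (size A) s').
Proof.
move=> sz sz'.
have kn : ((size A).+1 < n)%N by rewrite -sz size_cat /= !addnS !ltnS leq_addr.
rewrite (@ptens_nth n _ _ sz sz') (@ptens_nth n) ?size_swapk //; last first.
  by rewrite -sz !size_cat.
rewrite (reindex_inj (@perm_inj _ (tperm (Ordinal (ltnW kn)) (Ordinal kn)))).
apply: eq_bigr => i _; rewrite !nth_swapk ?sz' //.
case: tpermP => [->|->|n0 n1] /=.
- rewrite !eqxx !nth_cat ltnNge leqnSn /= subSnn ltnn subnn /=.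
  by rewrite ?eqxx.
- rewrite gtn_eqF // eqxx !nth_cat ltnn subnn ltnNge leqnSn /= subSnn /=.
  by [].
- have i0 : (i == size A :> nat) = false by apply/eqP => e; apply: n0; apply: val_inj.
  have i1 : (i == (size A).+1 :> nat) = false by apply/eqP => e; apply: n1; apply: val_inj.
  rewrite i0 i1 !nth_cat; case: ltnP => // li; congr (_.[_]).
  case: (i - size A)%N (subnKC li) => [|[|k]] //= e; last first.
  - by move: i1; rewrite -e addn1 eqxx.
  - by move: i0; rewrite -e addn0 eqxx.
Qed.

Lemma altf_ptens n s : pt n s -> altf n (fun fs => Alt n (ptens fs) s).
Proof.
move=> ps A x y B sz.
have kn : ((size A).+1 < n)%N by rewrite -sz size_cat /= !addnS !ltnS leq_addr.
rewrite -(Alt_swap kn); apply: (Alt_local ps) => s' _ ps'.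
by rewrite (ptens_swap sz) // (perm_size ps') ps.1.
Qed.

Lemma poly_sumX n (f : {poly rat}) : (size f <= n)%N -> f = \sum_(i < n) f`_i *: 'X^i.
Proof.
move=> sf; rewrite -poly_def; apply/polyP => i; rewrite coef_poly.
by case: ltnP => // li; rewrite nth_default // (leq_trans sf).
Qed.

Section Functional.
Variables (phi : {poly rat} -> rat).
Hypothesis phiD : forall p q, phi (p + q) = phi p + phi q.
Hypothesis phiZ : forall c p, phi (c *: p) = c * phi p.

Lemma phi_sum n (F : 'I_n -> {poly rat}) : phi (\sum_i F i) = \sum_i phi (F i).
Proof.
have phi0 : phi 0 = 0 by rewrite -(scale0r (0 : {poly rat})) phiZ mul0r.
exact: (big_morph phi phiD phi0).
Qed.

Lemma phi_coef n (f : {poly rat}) : (size f <= n)%N ->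
  phi f = \sum_(i < n) f`_i * phi 'X^i.
Proof.
by move=> sf; rewrite {1}(poly_sumX sf) phi_sum; apply: eq_bigr => i _; rewrite phiZ.
Qed.

(** The values of [phi] on the monomials form a vector killed by the coefficient matrix, and [g]
    shows that this vector is not zero. *)
Lemma dcoef_functional n (fs : seq {poly rat}) (g : {poly rat}) :
  size fs = n -> {in fs, forall f : {poly rat}, (size f <= n)%N} ->
  {in fs, forall f, phi f = 0} -> (size g <= n)%N -> phi g != 0 ->
  dcoef n fs = 0.
Proof.
move=> sf szf f0 sg g0; apply/eqP; rewrite /dcoef -det_tr; apply/det0P.
exists (\row_j phi 'X^(n - j.+1)).
  apply: contraNneq g0 => r0; rewrite (phi_coef sg) big1 // => i _.
  have /rowP/(_ (rev_ord i)) := r0; rewrite !mxE /= => E.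
  have e : (n - (n - i.+1).+1)%N = i by have := ltn_ord i; lia.
  by rewrite -[in X in _ * phi 'X^X]e E mulr0.
apply/rowP => i; rewrite !mxE.
have fi : nth 0 fs i \in fs by rewrite mem_nth ?sf.
rewrite -[RHS](f0 _ fi) (phi_coef (szf _ fi)) (reindex_inj rev_ord_inj).
apply: eq_bigr => j _; rewrite !mxE mulrC /=.
have -> // : (n - (n - j.+1).+1)%N = j by have := ltn_ord j; lia.
Qed.
End Functional.

Definition chi (L : seq rat) : {poly rat} := \prod_(y <- L) ('X + y%:P).

Lemma XaddC (y : rat) : 'X + y%:P = 'X - (- y)%:P.
Proof. by rewrite polyCN opprK. Qed.

Lemma chi_monic L : chi L \is monic.
Proof. by apply: monic_prod => y _; rewrite XaddC monicXsubC. Qed.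

Lemma size_chi L : size (chi L) = (size L).+1.
Proof.
rewrite /chi; under eq_bigr => y _ do rewrite XaddC.
by rewrite size_prod_XsubC.
Qed.

Lemma horner_chi L x : (chi L).[x] = \prod_(y <- L) (x + y).
Proof. by rewrite /chi horner_prod; apply: eq_bigr => y _; rewrite !hornerE. Qed.

Lemma chi_cat L L' : chi (L ++ L') = chi L * chi L'.
Proof. by rewrite /chi big_cat. Qed.

Lemma chi_perm L L' : perm_eq L L' -> chi L = chi L'.
Proof. by move=> pl; apply: perm_big. Qed.

Lemma chi_root L y : y \in L -> (chi L).[- y] = 0.
Proof.
move=> yL; rewrite horner_chi (perm_big _ (perm_to_rem yL)) big_cons addNr.
exact: mul0r.
Qed.

Lemma size_chiX L e : size (chi L * 'X^e) = (size L + e.+1)%N.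
Proof. by rewrite size_monicM ?chi_monic ?monic_neq0 ?monicXn // size_chi size_polyXn addSn. Qed.

Lemma chiX_monic L e : chi L * 'X^e \is monic.
Proof. by rewrite rpredM ?chi_monic ?monicXn. Qed.

Definition evdet n (fs : seq {poly rat}) (s : seq rat) : rat :=
  \det (\matrix_(i < n, j < n) (nth 0 fs i).[nth 0 s j]).

Lemma evdet_block r p F G S T : size F = r -> size S = r ->
  (forall f t, f \in F -> t \in T -> f.[t] = 0) ->  size T = p ->
  evdet (r + p) (F ++ G) (S ++ T) = evdet r F S * evdet p G T.
Proof.
move=> sF sS FT sT; rewrite /evdet -[X in \det X]submxK.
have -> : ursubmx (\matrix_(i < r + p, j < r + p) (nth 0 (F ++ G) i).[nth 0 (S ++ T) j]) = 0.
  apply/matrixP => i j; rewrite !mxE /= !nth_cat sF sS ltn_ord.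
  by rewrite ltnNge leq_addr /= addKn FT // mem_nth ?sF ?sT.
rewrite det_lblock; congr (_ * _); congr (\det _); apply/matrixP => i j; rewrite !mxE /=.
  by rewrite !nth_cat sF sS !ltn_ord.
by rewrite !nth_cat sF sS ![(_ + _ < r)%N]ltnNge !leq_addr /= !addKn.
Qed.

Lemma nth_rowX q n i : (i < n)%N ->
  nth 0 [seq q * 'X^e | e <- cyc n] i = q * 'X^(n - i.+1) :> {poly rat}.
Proof. by move=> li; rewrite (nth_map 0%N) ?size_cyc // nth_cyc. Qed.

Lemma evdet_scale n (q : {poly rat}) s : size s = n ->
  evdet n [seq q * 'X^e | e <- cyc n] s = (\prod_(x <- s) q.[x]) * Vd n s.
Proof.
move=> sz; rewrite /evdet /Vd mulrC.
have -> : \prod_(x <- s) q.[x] = \det (diag_mx (\row_(j < n) q.[nth 0 s j])).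
  by rewrite det_diag (big_nth 0) big_mkord sz; apply: eq_bigr => j _; rewrite mxE.
rewrite -det_mulmx; congr (\det _); apply/matrixP => i j; rewrite mul_mx_diag !mxE.
by rewrite nth_rowX // hornerM hornerXn mulrC.
Qed.

Lemma size_rowX (q : {poly rat}) n : size [seq q * 'X^e | e <- cyc n] = n :> nat.
Proof. by rewrite size_map size_cyc. Qed.

Lemma mem_rowX (q f : {poly rat}) n : f \in [seq q * 'X^e | e <- cyc n] ->
  exists2 e, (e < n)%N & f = q * 'X^e.
Proof. by case/mapP => e; rewrite mem_rev mem_iota => /andP[_ le] ->; exists e. Qed.

(** At the roots of [chi R] followed by those of [chi P] the matrix of values is block triangular.
    The family with [chi R] replaced by 1 has [dcoef] equal to 1 and values differing only by the
    factor [chi R] at the roots of [chi P]; comparing the two avoids factoring Vandermonde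
    determinants. *)
Lemma dcoef_resultant P R : uniq P -> uniq R ->
  dcoef (size R + size P)
    ([seq chi P * 'X^e | e <- cyc (size R)] ++ [seq chi R * 'X^e | e <- cyc (size P)])
  = \prod_(y <- P) \prod_(z <- R) (z - y).
Proof.
move=> uP uR; set n := (size R + size P)%N; set rows := _ ++ _.
have srows : size rows = n by rewrite size_cat !size_rowX.
have szrows : {in rows, forall f : {poly rat}, (size f <= n)%N}.
  by move=> f; rewrite mem_cat => /orP[] /mem_rowX[e le ->];
    rewrite size_chiX /n ?leq_add2l // addnC leq_add2r.
have [/hasP[y yP yR]|PR] := boolP (has (mem R) P).
  (* All rows vanish at a common root [- y], and the polynomial 1 does not. *)
  rewrite (@dcoef_functional (fun f => f.[- y]) _ _ n rows 1) //.
  - rewrite (perm_big _ (perm_to_rem yP)) big_cons.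
    by rewrite (perm_big _ (perm_to_rem yR)) big_cons /= subrr !mul0r.
  - by move=> p q; rewrite hornerD.
  - by move=> c p; rewrite hornerZ.
  - move=> f; rewrite mem_cat => /orP[] /mem_rowX[e _ ->];
    by rewrite hornerM chi_root ?mul0r.
  - rewrite size_poly1 /n; case: (P) yP => // z P' _; by rewrite /= addnS.
  - by rewrite hornerC oner_eq0.
pose S := map -%R R; pose T := map -%R P.
have ps : pt n (S ++ T).
  split; first by rewrite size_cat !size_map.
  rewrite -map_cat map_inj_uniq ?cat_uniq ?uP ?uR; last exact: oppr_inj.
  by rewrite PR.
have sS : size S = size R by rewrite size_map.
have sT : size T = size P by rewrite size_map.
have PT f t : f \in [seq chi P * 'X^e | e <- cyc (size R)] -> t \in T -> f.[t] = 0.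
  by move=> /mem_rowX[e _ ->] /mapP[y yP ->]; rewrite hornerM chi_root ?mul0r.
have E1 := det_dcoef (S ++ T) srows szrows.
rewrite -/(evdet _ _ _) evdet_block ?size_rowX // !evdet_scale // in E1.
pose rows1 := [seq chi P * 'X^e | e <- cyc (size R)] ++ [seq 1 * 'X^e | e <- cyc (size P)].
have srows1 : size rows1 = n by rewrite size_cat !size_rowX.
have szrows1 : {in rows1, forall f : {poly rat}, (size f <= n)%N}.
  move=> f; rewrite mem_cat => /orP[] /mem_rowX[e le ->].
    by rewrite size_chiX /n addnC leq_add2r.
  by rewrite mul1r size_polyXn /n (leq_trans le) // leq_addl.
have E2 := det_dcoef (S ++ T) srows1 szrows1.
rewrite -/(evdet _ _ _) evdet_block ?size_rowX // !evdet_scale // in E2.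
rewrite dcoef_monic // in E2; last first.
  move=> i li; rewrite /rows1 nth_cat size_rowX; case: ltnP => lr.
    rewrite nth_rowX // size_chiX chiX_monic; split => //.
    by rewrite subnSK // addnBA 1?ltnW // addnC.
  have lp : (i - size R < size P)%N by rewrite ltn_subLR.
  rewrite nth_rowX // mul1r size_polyXn monicXn; split => //.
  by rewrite subnSK // subnBA // addnC.
have prod1 : \prod_(x <- T) (1 : {poly rat}).[x] = 1.
  by rewrite big1 // => x _; rewrite hornerC.
rewrite prod1 !mul1r in E2.
have V0 := Vd_neq0 ps; move/eqP: E1; rewrite -E2.
have -> : \prod_(x <- S) (chi P).[x] * Vd (size R) S * (\prod_(x <- T) (chi R).[x] * Vd (size P) T)
  = \prod_(x <- T) (chi R).[x] * (\prod_(x <- S) (chi P).[x] * Vd (size R) S * Vd (size P) T).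
  by ring.
rewrite E2 => /eqP/(mulIf V0) <-; rewrite big_map; apply: eq_bigr => y _.
by rewrite horner_chi; apply: eq_bigr => z _; rewrite addrC.
Qed.

Lemma dcoef_peel n (f : {poly rat}) fs : size f = n.+1 -> f \is monic ->
  size fs = n -> {in fs, forall f : {poly rat}, (size f <= n)%N} ->
  dcoef n.+1 (f :: fs) = dcoef n fs.
Proof.
move=> sf mf sfs szfs; rewrite /dcoef (expand_det_col _ ord0) big_ord_recl.
rewrite big1 ?addr0 => [|i _]; last first.
  rewrite !mxE /= nth_default ?mul0r // subn1 /=.
  by apply: szfs; apply: mem_nth; rewrite sfs; apply: ltn_ord.
rewrite !mxE /= subn1 /=; move/monicP: mf; rewrite lead_coefE sf /= => ->.
rewrite mul1r /cofactor addn0 expr0 mul1r; congr (\det _).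
by apply/matrixP => i j; rewrite !mxE /= subSS.
Qed.

Lemma dcoef_top Y d rest : size rest = size Y ->
  {in rest, forall f : {poly rat}, (size f <= size Y)%N} ->
  dcoef (d + size Y) ([seq chi Y * 'X^e | e <- cyc d] ++ rest) = dcoef (size Y) rest.
Proof.
move=> sr szr; elim: d => [|d IH] //; rewrite cycS /= dcoef_peel ?chiX_monic //.
- by rewrite size_chiX addnS addnC.
- by rewrite size_cat size_rowX sr.
- move=> f; rewrite mem_cat => /orP[/mem_rowX[e le ->]|/szr le].
    by rewrite size_chiX addnC leq_add2r.
  exact: leq_trans le (leq_addl _ _).
Qed.

(** * Semantics of the divided powers *)

Lemma sem_hcast u v u' v' (eu : u = u') (ev : v = v') (f : term u v) :
  sem (hcast eu ev f) = sem f.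
Proof. by case: u' / eu; case: v' / ev. Qed.

Lemma sem_tens u v u' v' (f : term u v) (g : term u' v') h s t : size s = size v ->
  sem (f \ot g) h (s ++ t) = sem f (fun s' => sem g (fun t' => h (s' ++ t')) t) s.
Proof. by move=> sz; rewrite /= take_size_cat // drop_size_cat. Qed.

Lemma sem_dotE k u h s : size s = size u -> (k < size u)%N ->
  sem (dotE k u) h s = nth 0 s k * h s.
Proof.
elim: u k h s => [|i u IH] [|k] h [|x s] // [sz] ku; first exact: sem_dt.
by change (sem (lw i (dotE k u)) h (x :: s) = nth 0 s k * h (x :: s)); rewrite sem_lw IH.
Qed.

Lemma sem_dot_at i n k h s : size s = n -> (k < n)%N ->
  sem (dot_at i n k) h s = nth 0 s k * h s.
Proof.
elim: n k h s => [|n IH] [|k] h [|x s] // [sz] ku; first exact: (@sem_dt i (nseq n i)).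
by change (sem (lw i (dot_at i n k)) h (x :: s) = nth 0 s k * h (x :: s)); rewrite sem_lw IH.
Qed.

Lemma sem_cross_at i n k h s : size s = n -> (k.+1 < n)%N ->
  sem (cross_at i n k) h s = ddk k h s.
Proof.
elim: n k h s => [|n IH] [|k] h [|x s] // [sz] ku.
  case: n sz ku {IH} => [|n]; case: s => [|y s] // _ _.
  change (sem (cr i i (nseq n i)) h [:: x, y & s] = ddk 0 h [:: x, y & s]).
  by rewrite sem_cr /ddk /=; case: i => /=; ring.
by change (sem (lw i (cross_at i n k)) h (x :: s) = ddk k.+1 h (x :: s)); rewrite sem_lw IH.
Qed.

Lemma sem_tprod u (fs : seq (term u u)) h : sem (tprod fs) h = foldr (@sem u u) h fs.
Proof. by elim: fs => //= f fs ->. Qed.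

Lemma sem_Dlong i n h : eqo n (sem (Dlong i n) h) (Alt n h).
Proof.
move=> s ps; rewrite -(ddw_longest _ ps) /Dlong sem_tprod /ddw foldr_map.
have : {in longest_word n, forall k, (k.+1 < n)%N} by move=> k /mem_longest.
move: ps; elim: (longest_word n) s => //= k ks IH s ps lks.
rewrite sem_cross_at ?ps.1 ?lks ?mem_head //.
apply: (ddk_ext _ _ ps) => s' ps'; apply: IH => // k' k'ks.
by apply: lks; rewrite inE k'ks orbT.
Qed.

Lemma dltE n s : size s = n -> dlt 0 n s = \prod_(i < n) nth 0 s i ^+ (n - i.+1).
Proof.
move=> sz; rewrite dlt_ptens // (@ptens_nth n) ?size_map ?size_cyc //.
by apply: eq_bigr => i _; rewrite (nth_map 0%N) ?size_cyc // nth_cyc // hornerXn.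
Qed.

Lemma sem_delta i n h s : size s = n -> sem (delta i n) h s = dlt 0 n s * h s.
Proof.
move=> sz; rewrite dltE // -(big_mkord xpredT (fun k => nth 0 s k ^+ (n - k.+1))).
rewrite /index_iota subn0 /delta sem_tprod.
have : {in iota 0 n, forall k, (k < n)%N} by move=> k; rewrite mem_iota.
elim: (iota 0 n) h => [|k ks IH] h lks; first by rewrite big_nil mul1r.
rewrite /= foldr_cat big_cons /= -mulrA -IH; last first.
  by move=> k' k'ks; apply: lks; rewrite inE k'ks orbT.
elim: (n - k.+1)%N => [|m IHm]; first by rewrite mul1r.
by rewrite /= sem_dot_at // ?lks ?mem_head // IHm exprS mulrA.
Qed.

Lemma cf0_neq i j t a : i <> j -> cf0 i j t a = 0.
Proof. by case: i j => [] []. Qed.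

Lemma sem_W_neq i j x X t Z u2 h : i <> j -> size X = x ->
  sem (W (nseq x i) j u2) h (t :: X ++ Z) =
  (\prod_(q <- X) cf1 i j t q) * h (X ++ t :: Z).
Proof.
move=> ij; elim: X x h => [|q X IH] [|x] h // => [_|[sz]].
  by rewrite big_nil mul1r.
rewrite [nseq _ _]/= W_cons sem_comp [(q :: X) ++ Z]cat_cons sem_cr cf0_neq // mul0r add0r.
by rewrite sem_lw IH // big_cons mulrA.
Qed.

(* The strands of [u2] cross those of [u1] to their left. *)
Fixpoint bl (u1 u2 w : word) {struct u2} : term (u1 ++ u2 ++ w) (u2 ++ u1 ++ w) :=
  match u2 return term (u1 ++ u2 ++ w) (u2 ++ u1 ++ w) with
  | [::] => tid (u1 ++ w)
  | j :: u2' => (lw j (bl u1 u2' w) \oc W u1 j (u2' ++ w))%T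
  end.

Lemma bl_cons u1 j u2 w :
  bl u1 (j :: u2) w = (lw j (bl u1 u2 w) \oc W u1 j (u2 ++ w))%T.
Proof. by []. Qed.

Lemma sem_bl i j x y w X Y Z h : i <> j -> size X = x -> size Y = y ->
  sem (bl (nseq x i) (nseq y j) w) h (Y ++ X ++ Z) =
  (\prod_(t <- Y) \prod_(q <- X) cf1 i j t q) * h (X ++ Y ++ Z).
Proof.
move=> ij sX; elim: Y y h => [|t Y IH] [|y] h // => [_|[sz]].
  by rewrite big_nil mul1r.
rewrite -[nseq y.+1 j]/(j :: nseq y j) bl_cons sem_comp [(t :: Y) ++ _]cat_cons sem_lw IH //.
by rewrite sem_W_neq // big_cons mulrCA mulrA.
Qed.

(** The diagram of both morphisms: the strands of colour 2 form two groups, one exchanged with the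
    first group of colour 1 and the other with the second. *)
Definition bl2 (u1 u2 u3 u4 : word) :
    term (u1 ++ u2 ++ (u3 ++ u4 ++ [::])) (u2 ++ u1 ++ (u4 ++ u3 ++ [::])) :=
  ((tid u2 \ot (tid u1 \ot bl u3 u4 [::])) \oc bl u1 u2 (u3 ++ u4 ++ [::]))%T.

Lemma sem_tid u h s : sem (tid u) h s = h s.
Proof. by []. Qed.

Lemma sem_bl2 i j k l x y z w A B C D h : i <> j -> k <> l ->
  size A = x -> size B = y -> size C = z -> size D = w ->
  sem (bl2 (nseq x i) (nseq y j) (nseq z k) (nseq w l)) h (B ++ A ++ D ++ C) =
  (\prod_(t <- D) \prod_(q <- C) cf1 k l t q) *
  ((\prod_(t <- B) \prod_(q <- A) cf1 i j t q) * h (A ++ B ++ C ++ D)).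
Proof.
move=> ij kl sA sB sC sD; rewrite sem_comp sem_tens ?size_nseq // sem_tid.
rewrite sem_tens ?size_nseq // sem_tid -[D ++ C]cats0 -catA sem_bl //.
by rewrite cats0 sem_bl // cats0.
Qed.

(** * Multiplication by polynomials, and degrees of terms *)

Lemma In_mem (T : eqType) (x : T) s : List.In x s <-> x \in s.
Proof.
elim: s => //= y s IH; rewrite inE; split=> [[->|/IH->]|/orP[/eqP->|/IH]].
- by rewrite eqxx.
- by rewrite orbT.
- by left.
- by right.
Qed.

(* A product of factors [x_k] and [x_k + x_l], coded by [inl k] and
   [inr (k, l)]. *)
Definition fac u (f : nat + nat * nat) : term u u :=
  match f with
  | inl k => dotE k u
  | inr (k, l) => (dotE k u \oa dotE l u)%T
  end.

Definition fval (f : nat + nat * nat) (s : seq rat) : rat :=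
  match f with inl k => nth 0 s k | inr (k, l) => nth 0 s k + nth 0 s l end.

Definition fok n (f : nat + nat * nat) : bool :=
  match f with inl k => (k < n)%N | inr (k, l) => (k < n)%N && (l < n)%N end.

Definition mulT u (F : seq (nat + nat * nat)) : term u u := tprod (map (fac u) F).

Definition Fval (F : seq (nat + nat * nat)) (s : seq rat) : rat := \prod_(f <- F) fval f s.

Lemma sem_mulT u F h s : size s = size u -> all (fok (size u)) F ->
  sem (mulT u F) h s = Fval F s * h s.
Proof.
move=> sz; rewrite /Fval; elim: F => [|f F IH] /=; first by rewrite big_nil mul1r.
case/andP => okf /IH {}IH; rewrite big_cons -mulrA -IH -/(mulT u F).
case: f okf => [k|[k l]] /= okf; first by rewrite sem_dotE.
by case/andP: okf => k1 l1; rewrite !sem_dotE // mulrDl.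
Qed.

Lemma Fval_cat F G s : Fval (F ++ G) s = Fval F s * Fval G s.
Proof. by rewrite /Fval big_cat. Qed.

Fixpoint expo (off : nat) (es : seq nat) : seq (nat + nat * nat) :=
  if es is e :: es' then nseq e (inl off) ++ expo off.+1 es' else [::].

Definition sums off n off' n' : seq (nat + nat * nat) :=
  [seq inr (x, y) | x <- iota off n, y <- iota off' n'].

Lemma Fval_expo off es A S B : size A = off -> size S = size es ->
  Fval (expo off es) (A ++ S ++ B) = ptens [seq 'X^e | e <- es] S.
Proof.
elim: es off A S => [|e es IH] off A [|x S] //= sA => [_|[sS]].
  by rewrite /Fval ptens_nil big_nil.
rewrite Fval_cat ptens_cons -cat_rcons (IH off.+1) ?size_rcons ?sA //.
congr (_ * _); rewrite hornerXn /Fval big_nseq /=.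
rewrite nth_cat size_rcons sA ltnSn nth_rcons sA ltnn eqxx.
by elim: e => //= e ->; rewrite exprS.
Qed.

Lemma Fval_sums off n off' n' s : (off + n <= size s)%N -> (off' + n' <= size s)%N ->
  Fval (sums off n off' n') s =
  \prod_(x <- take n (drop off s)) \prod_(y <- take n' (drop off' s)) (x + y).
Proof.
move=> l1 l2; rewrite /Fval big_allpairs_dep /=.
have L o m : (o + m <= size s)%N -> (m <= size s - o)%N.
  by move=> l; rewrite -(leq_add2l o) subnKC // (leq_trans (leq_addr _ _) l).
rewrite -(map_nth_iota 0 (L _ _ l1)) -(map_nth_iota 0 (L _ _ l2)) [RHS]big_map.
by apply: eq_bigr => x _; rewrite [RHS]big_map.
Qed.

Lemma fok_expo n off es : (off + size es <= n)%N -> all (fok n) (expo off es).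
Proof.
elim: es off => [|e es IH] off //=; rewrite addnS => le.
by rewrite all_cat IH // andbT all_nseq /= (leq_ltn_trans _ le) ?leq_addr ?orbT.
Qed.

Lemma fok_sums n off m off' m' : (off + m <= n)%N -> (off' + m' <= n)%N ->
  all (fok n) (sums off m off' m').
Proof.
move=> l1 l2; apply/allP => f /allpairsP[[x y] /= []].
rewrite !mem_iota => /andP[_ lx] /andP[_ ly] -> /=.
by rewrite (leq_trans lx l1) (leq_trans ly l2).
Qed.

Lemma homog_lw d i u v (f : term u v) : homog d f -> homog d (lw i f).
Proof. by move=> hf; rewrite -[d]add0r; exact: (homog_tens (homog_id [:: i]) hf). Qed.

Lemma homog_dt i v : homog 2 (dt i v).
Proof. by have := homog_tens (homog_dot i) (homog_id v); rewrite addr0. Qed.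

Lemma homog_cr i j v : homog (- idot i j) (cr i j v).
Proof. by have := homog_tens (homog_cross i j) (homog_id v); rewrite addr0. Qed.

Lemma homog_dotE k u : (k < size u)%N -> homog 2 (dotE k u).
Proof.
elim: u k => [|i u IH] [|k] //= ku.
  exact: homog_dt.
exact: (homog_lw i (IH k ku)).
Qed.

Lemma homog_hcast d u v u' v' (eu : u = u') (ev : v = v') (f : term u v) :
  homog d f -> homog d (hcast eu ev f).
Proof. by case: u' / eu; case: v' / ev. Qed.

(** Membership is [List.In] because [term] carries no decidable equality. *)
Lemma homog_tprod d u (fs : seq (term u u)) :
  (forall f, List.In f fs -> homog d f) -> homog (d *+ size fs) (tprod fs).
Proof.
elim: fs => [|f fs IH] H /=; first by rewrite mulr0n; apply: homog_id.
rewrite mulrS; apply: homog_comp; first by apply: H; left.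
by apply: IH => g gfs; apply: H; right.
Qed.

Lemma homog_mulT u F : all (fok (size u)) F -> homog (2 *+ size F) (mulT u F).
Proof.
move=> okF; rewrite -(size_map (fac u)); apply: homog_tprod => f /List.in_map_iff[g [<- gF]].
have {gF}okg : fok (size u) g.
  elim: F okF gF => //= a F IH /andP[oka okF] [<-|]; [by []|exact: IH].
case: g okg => [k|[k l]] /=; first exact: homog_dotE.
by case/andP => *; apply: homog_add; apply: homog_dotE.
Qed.

Lemma homog_cross_at i n k : (k.+1 < n)%N -> homog (-2) (cross_at i n k).
Proof.
elim: n k => [|n IH] [|k] //= kn.
  case: n kn {IH} => [|n] // _.
  by have := homog_cr i i (nseq n i); case: i.
exact: (homog_lw i (IH k kn)).
Qed.

Lemma homog_dot_at i n k : (k < n)%N -> homog 2 (dot_at i n k).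
Proof.
elim: n k => [|n IH] [|k] //= kn.
  exact: homog_dt.
exact: (homog_lw i (IH k kn)).
Qed.

Definition tri n := (n * n.-1)./2.

Lemma triS n : tri n.+1 = (tri n + n)%N.
Proof. by rewrite /tri -!bin2 binS bin1. Qed.

Lemma size_longest n : size (longest_word n) = tri n.
Proof. by elim: n => // n IH; rewrite longest_wordS size_cat IH triS size_cyc. Qed.

Lemma homog_Dlong i n : homog ((-2) *+ tri n) (Dlong i n).
Proof.
rewrite -size_longest -(size_map (cross_at i n)); apply: homog_tprod.
move=> f /List.in_map_iff[k [<- kl]]; apply: homog_cross_at; apply: mem_longest.
exact/In_mem.
Qed.

Lemma homog_delta i n : homog (2 *+ tri n) (delta i n).
Proof.
set fs := flatten [seq nseq (n - k.+1) (dot_at i n k) | k <- iota 0 n].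
have -> : tri n = size fs.
  rewrite size_flatten /shape -map_comp.
  have -> : sumn [seq (size \o (fun k => nseq (n - k.+1) (dot_at i n k))) k | k <- iota 0 n]
          = sumn (cyc n).
    rewrite -[cyc n](mkseq_nth 0%N) /mkseq size_cyc; congr sumn.
    by apply/eq_in_map => k; rewrite mem_iota => lk /=; rewrite size_nseq nth_cyc.
  by elim: (n) => // m IHm; rewrite cycS /= -IHm triS addnC.
apply: homog_tprod => f; rewrite /fs => ff.
suff [k [lk ->]] : exists k, (k < n)%N /\ f = dot_at i n k by apply: homog_dot_at.
have : {in iota 0 n, forall k, (k < n)%N} by move=> k; rewrite mem_iota.
move: ff; elim: (iota 0 n) => //= k ks IH + lks.
move=> /List.in_app_iff[|/IH]; last first.
  by apply => k' k'ks; apply: lks; rewrite inE k'ks orbT.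
move=> fk; exists k; split; first by apply: lks; rewrite mem_head.
by elim: (n - k.+1)%N fk => //= m IHm [<-|/IHm].
Qed.

Lemma homog_cr_neq i j v : i <> j -> homog 1 (cr i j v).
Proof. by move=> ij; have := homog_cr i j v; case: i j ij => [] []. Qed.

Lemma homog_W i j x u2 : i <> j -> homog x%:Z (W (nseq x i) j u2).
Proof.
move=> ij; elim: x => [|x IH]; first exact: homog_id.
rewrite [nseq _ _]/= W_cons intS; apply: homog_comp.
  exact: homog_cr_neq.
exact: homog_lw.
Qed.

Lemma homog_bl i j x y w : i <> j -> homog (x * y)%N%:Z (bl (nseq x i) (nseq y j) w).
Proof.
move=> ij; elim: y => [|y IH]; first by rewrite muln0; apply: homog_id.
rewrite mulnS addnC PoszD; apply: homog_comp; last exact: homog_W.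
exact: homog_lw.
Qed.

Lemma homog_bl2 i j k l x y z w : i <> j -> k <> l ->
  homog (x * y + z * w)%N%:Z (bl2 (nseq x i) (nseq y j) (nseq z k) (nseq w l)).
Proof.
move=> ij kl; rewrite PoszD addrC; apply: homog_comp; last exact: homog_bl.
rewrite -[X in homog X _]add0r; apply: homog_tens; first exact: homog_id.
rewrite -[X in homog X _]add0r; apply: homog_tens; first exact: homog_id.
exact: homog_bl.
Qed.

Lemma size_expo off es : size (expo off es) = sumn es.
Proof. by elim: es off => //= e es IH off; rewrite size_cat size_nseq IH. Qed.

Lemma size_sums off n off' n' : size (sums off n off' n') = (n * n')%N.
Proof. by rewrite size_allpairs !size_iota. Qed.

Lemma sumn_cyc n : sumn (cyc n) = tri n.
Proof. by elim: n => // n IH; rewrite cycS /= IH triS addnC. Qed.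

(** * The operators of the decomposition *)

Notation fn3 := (seq rat -> seq rat -> seq rat -> rat).

Definition T3 x y z (H : fn3) : fn3 := fun A B C =>
  Alt x (fun A' => Alt y (fun B' => Alt z (fun C' => H A' B' C') C) B) A.

Definition dlt3 x y z : fn3 := fun A B C => dlt 0 x A * dlt 0 y B * dlt 0 z C.

Definition sym3 x y z (G : fn3) := forall A B C A' B' C',
  pt x A -> pt y B -> pt z C -> perm_eq A A' -> perm_eq B B' -> perm_eq C C' ->
  G A B C = G A' B' C'.

Lemma T3_sym x y z H : sym3 x y z (T3 x y z H).
Proof.
move=> A B C A' B' C' pA pB pC eA eB eC; rewrite /T3 (Alt_sym _ pA eA).
congr (Alt x _ A'); apply: funext => A1.
rewrite (Alt_sym _ pB eB); congr (Alt y _ B'); apply: funext => B1.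
exact: Alt_sym.
Qed.

Lemma T3_local x y z H H' A B C : pt x A -> pt y B -> pt z C ->
  (forall A' B' C', pt x A' -> pt y B' -> pt z C' ->
     perm_eq A' A -> perm_eq B' B -> perm_eq C' C -> H A' B' C' = H' A' B' C') ->
  T3 x y z H A B C = T3 x y z H' A B C.
Proof.
move=> pA pB pC E; apply: (Alt_local pA) => A' pA' eA.
by apply: (Alt_local pB) => B' pB' eB; apply: (Alt_local pC) => C' pC' eC; apply: E.
Qed.

Lemma T3Z x y z k H A B C :
  T3 x y z (fun A B C => k * H A B C) A B C = k * T3 x y z H A B C.
Proof.
rewrite /T3 -AltZ; congr (Alt x _ A); apply: funext => A'.
rewrite -AltZ; congr (Alt y _ B); apply: funext => B'.
by rewrite AltZ.
Qed.

(** The map from [G] to [dlt3 * G] thus identifies symmetric functions with the image of the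
    idempotent [e3]. The operators below act between spaces of symmetric functions. *)
Lemma T3_dlt x y z G A B C : pt x A -> pt y B -> pt z C -> sym3 x y z G ->
  T3 x y z (fun A B C => dlt3 x y z A B C * G A B C) A B C = G A B C.
Proof.
move=> pA pB pC sG.
transitivity (T3 x y z (fun A' B' C' => G A B C * dlt3 x y z A' B' C') A B C).
  apply: T3_local => // A' B' C' _ _ _ eA eB eC.
  by rewrite mulrC (sG A B C A' B' C') // perm_sym.
rewrite T3Z /T3 /dlt3 -[RHS]mulr1; congr (_ * _).
rewrite -[RHS](Alt_dlt pA); congr (Alt x _ A); apply: funext => A'.
transitivity (Alt y (fun B' => dlt 0 x A' * dlt 0 y B') B); last by rewrite AltZ Alt_dlt // mulr1.
congr (Alt y _ B); apply: funext => B'.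
by rewrite AltZ Alt_dlt // mulr1.
Qed.

Lemma pt_cat m n A B : pt (m + n) (A ++ B) -> size A = m -> pt m A /\ pt n B.
Proof.
move=> [sz us] sA; move: us; rewrite cat_uniq => /and3P[uA _ uB].
by split; split=> //; apply/eqP; rewrite -(eqn_add2l m) -{1}sA -size_cat sz.
Qed.

Lemma pt_take_drop m n X : pt (m + n) X -> pt m (take m X) /\ pt n (drop m X).
Proof.
move=> pX; apply: pt_cat; first by rewrite cat_take_drop.
by rewrite size_takel // pX.1 leq_addr.
Qed.

Definition w3 (i j : vertex) x y z : word := (nseq x i ++ nseq y j) ++ nseq z i.

Definition D3 i j x y z : term (w3 i j x y z) (w3 i j x y z) :=
  (Dlong i x \ot Dlong j y \ot Dlong i z)%T.

Definition e3 i j x y z : term (w3 i j x y z) (w3 i j x y z) :=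
  ((delta i x \oc Dlong i x) \ot (delta j y \oc Dlong j y) \ot
     (delta i z \oc Dlong i z))%T.

Lemma size_w3 i j x y z : size (w3 i j x y z) = (x + y + z)%N.
Proof. by rewrite !size_cat !size_nseq. Qed.

Section Sem3.
Variables (i j : vertex) (x y z : nat) (A B C : seq rat).
Hypotheses (pA : pt x A) (pB : pt y B) (pC : pt z C).

Lemma sem_tens3 (f : term (nseq x i) (nseq x i)) (g : term (nseq y j) (nseq y j))
    (k : term (nseq z i) (nseq z i)) h :
  sem (f \ot g \ot k) h (A ++ B ++ C) =
  sem f (fun A' => sem g (fun B' => sem k (fun C' => h (A' ++ B' ++ C')) C) B) A.
Proof.
rewrite catA sem_tens; last by rewrite !size_cat !size_nseq pA.1 pB.1.
rewrite sem_tens ?size_nseq ?pA.1 //.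
congr (sem f _ _); apply: funext => A'.
congr (sem g _ _); apply: funext => B'.
by congr (sem k _ _); apply: funext => C'; rewrite catA.
Qed.

Lemma sem_D3 h :
  sem (D3 i j x y z) h (A ++ B ++ C) = T3 x y z (fun A B C => h (A ++ B ++ C)) A B C.
Proof.
rewrite /D3 sem_tens3 sem_Dlong // /T3; congr (Alt x _ A).
apply: funext => A'.
rewrite sem_Dlong //; congr (Alt y _ B); apply: funext => B'.
by rewrite sem_Dlong.
Qed.

Lemma sem_e3 h : sem (e3 i j x y z) h (A ++ B ++ C) =
  dlt3 x y z A B C * T3 x y z (fun A B C => h (A ++ B ++ C)) A B C.
Proof.
have E n k (f : fn) s : pt n s -> sem (delta k n \oc Dlong k n) f s = dlt 0 n s * Alt n f s.
  by move=> ps; rewrite sem_comp sem_delta ?ps.1 // sem_Dlong.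
rewrite /e3 sem_tens3 E // /T3 /dlt3 -!mulrA; congr (_ * _); rewrite -!AltZ.
congr (Alt x _ A); apply: funext => A'.
rewrite E //; congr (_ * _); rewrite -AltZ.
by congr (Alt y _ B); apply: funext => B'; rewrite E.
Qed.
End Sem3.

Lemma pt_cat3 x y z s : size s = (x + y + z)%N -> uniq s ->
  exists A B C, [/\ pt x A, pt y B, pt z C & s = A ++ B ++ C].
Proof.
move=> sz us; exists (take x s), (take y (drop x s)), (drop y (drop x s)).
have ps : pt (x + (y + z)) s by split; rewrite // addnA.
have [pA pD] := pt_take_drop ps; have [pB pC] := pt_take_drop pD.
by split; rewrite // !cat_take_drop.
Qed.

Lemma generic_uniq s : generic s -> uniq s.
Proof. by case/andP. Qed.

Lemma ddw_catl ks h A C : {in ks, forall k, (k.+1 < size A)%N} ->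
  ddw ks h (A ++ C) = ddw ks (fun A' => h (A' ++ C)) A.
Proof.
elim: ks A => //= k ks IH A lks.
have lk : (k.+1 < size A)%N by apply: lks; rewrite mem_head.
have lks' : {in ks, forall k', (k'.+1 < size A)%N}.
  by move=> k' k'ks; apply: lks; rewrite inE k'ks orbT.
rewrite /ddk swapk_catl // !IH ?size_swapk //.
by rewrite !nth_cat lk (ltnW lk).
Qed.

Lemma dlt_take n m s : (n <= m)%N -> dlt 0 n (take m s) = dlt 0 n s.
Proof.
elim: n => //= n IH nm; rewrite IH 1?ltnW //; congr (_ * _).
by rewrite /bprod !drop0 take_takel // ltnW.
Qed.

Lemma Alt_absorb_head a c (F : fn) (G : fn) X : pt (a + c) X ->
  Alt (a + c) (fun X => dlt 0 a (take a X) * Alt a F (take a X) * G (drop a X)) X =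
  Alt (a + c) (fun X => F (take a X) * G (drop a X)) X.
Proof.
move=> pX; rewrite [RHS](@Alt_absorb _ 0 a) ?leq_addr //.
apply: Alt_ext (pX) => Y pY; rewrite dlt_take // -mulrA; congr (_ * _).
have [p1 p2] := pt_take_drop pY.
rewrite /shw map_id -{3}(cat_take_drop a Y) ddw_catl; last first.
  by move=> k /mem_longest; rewrite p1.1.
rewrite -(ddw_longest _ p1) mulrC -(@ddw_mull a (fun=> G (drop a Y))) //.
apply: (ddw_ext _ _ p1) => s ps; rewrite mulrC.
by rewrite take_size_cat ?ps.1 // drop_size_cat ?ps.1.
Qed.

Section Kernels.
Variables (a b c p r : nat) (ks ls : seq nat).

Definition rowsN (P R : seq rat) : seq {poly rat} :=
  [seq chi P * 'X^e | e <- cyc r] ++ [seq chi (P ++ R) * 'X^e | e <- ks].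

Definition rowsM (P R : seq rat) : seq {poly rat} :=
  [seq chi (P ++ R) * 'X^e | e <- ls] ++ [seq chi R * 'X^e | e <- cyc p].

(** The factors [dlt] normalize the antisymmetrizers: against a symmetric function [Alt] of [dlt] is
    1, so that no factorials arise. *)
Definition KM : fn3 := fun P X R =>
  dlt 0 p P * dlt 0 r R * (dlt 0 a (take a X) * ptens (rowsM P R) (drop a X)).

Definition KN : fn3 := fun A Y C =>
  dlt 0 p (take p Y) * dlt 0 r (drop p Y) * (dlt 0 c C *
  ptens (rowsN (take p Y) (drop p Y)) A).

Definition opM (f : fn3) : fn3 :=
  T3 p (a + c) r (fun P X R => KM P X R * f (take a X) (P ++ R) (drop a X)).

Definition opN (g : fn3) : fn3 :=
  T3 a b c (fun A Y C => KN A Y C * g (take p Y) (A ++ C) (drop p Y)).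

Lemma opM_reduce f P X R : sym3 a (p + r) c f ->
  pt p P -> pt (a + c) X -> pt r R -> uniq (P ++ R) ->
  opM f P X R = Alt (a + c) (fun X => dlt 0 a (take a X) *
    ptens (rowsM P R) (drop a X) * f (take a X) (P ++ R) (drop a X)) X.
Proof.
move=> sf pP pX pR uPR.
pose Q X := dlt 0 a (take a X) *
  ptens (rowsM P R) (drop a X) * f (take a X) (P ++ R) (drop a X).
change (opM f P X R = Alt (a + c) Q X).
have E P' X' R' : pt p P' -> pt (a + c) X' -> pt r R' ->
    perm_eq P' P -> perm_eq X' X -> perm_eq R' R ->
    KM P' X' R' * f (take a X') (P' ++ R') (drop a X') =
    dlt 0 p P' * (dlt 0 r R' * Q X').
  move=> pP' pX' pR' eP eX eR; rewrite /KM /Q.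
  have ePR : perm_eq (P' ++ R') (P ++ R) by rewrite perm_cat.
  have -> : rowsM P' R' = rowsM P R.
    by rewrite /rowsM (chi_perm ePR) (chi_perm eR).
  have [p1 p2] := pt_take_drop pX'.
  rewrite (sf _ (P' ++ R') _ (take a X') (P ++ R) (drop a X') p1 _ p2) //.
    by ring.
  by split; rewrite ?size_cat ?pP'.1 ?pR'.1 // (perm_uniq ePR).
rewrite /opM (T3_local (H' := fun P' X' R' => dlt 0 p P' * (dlt 0 r R' * Q X'))) //.
rewrite /T3.
transitivity (Alt p (fun P' => Alt (a + c) Q X * dlt 0 p P') P); last first.
  by rewrite AltZ Alt_dlt // mulr1.
congr (Alt p _ P); apply: funext => P'.
rewrite mulrC -AltZ; congr (Alt (a + c) _ X); apply: funext => X'.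
rewrite AltZ; congr (_ * _).
transitivity (Alt r (fun R' => Q X' * dlt 0 r R') R).
  by congr (Alt r _ R); apply: funext => R'; rewrite mulrC.
by rewrite AltZ Alt_dlt // mulr1.
Qed.

Lemma opN_reduce g A Y C : sym3 p (a + c) r g -> b = (p + r)%N ->
  pt a A -> pt b Y -> pt c C -> uniq (A ++ C) ->
  opN g A Y C = Alt b (fun Y => dlt 0 p (take p Y) * dlt 0 r (drop p Y) *
    g (take p Y) (A ++ C) (drop p Y) *
    Alt a (ptens (rowsN (take p Y) (drop p Y))) A) Y.
Proof.
move=> sg bpr pA pY pC uAC.
pose Q Y := dlt 0 p (take p Y) * dlt 0 r (drop p Y) * g (take p Y) (A ++ C) (drop p Y).
have E A' Y' C' : pt a A' -> pt b Y' -> pt c C' -> perm_eq A' A -> perm_eq Y' Y -> perm_eq C' C ->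
    KN A' Y' C' * g (take p Y') (A' ++ C') (drop p Y') =
    (Q Y' * ptens (rowsN (take p Y') (drop p Y')) A') * dlt 0 c C'.
  move=> pA' pY' pC' eA eY eC; rewrite /KN /Q.
  have eAC : perm_eq (A' ++ C') (A ++ C) by rewrite perm_cat.
  rewrite bpr in pY'; have [p1 p2] := pt_take_drop pY'.
  rewrite (sg (take p Y') (A' ++ C') (drop p Y') (take p Y') (A ++ C) (drop p Y') p1 _ p2) //.
    by ring.
  by split; rewrite ?size_cat ?pA'.1 ?pC'.1 // (perm_uniq eAC).
rewrite /opN (T3_local (H' := fun A' Y' C' =>
  (Q Y' * ptens (rowsN (take p Y') (drop p Y')) A') * dlt 0 c C')) //.
rewrite /T3.
transitivity (Alt a (fun A' => Alt b (fun Y' =>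
   Q Y' * ptens (rowsN (take p Y') (drop p Y')) A') Y) A).
  congr (Alt a _ A); apply: funext => A'.
  congr (Alt b _ Y); apply: funext => Y'.
  by rewrite AltZ Alt_dlt // mulr1.
rewrite Alt_fubini; congr (Alt b _ Y); apply: funext => Y'.
by rewrite AltZ.
Qed.
End Kernels.

(* Composing the two reductions, everything concerning the first colour is
   absorbed in one alternating sum over all the points of that colour. *)
Lemma opMN_reduce a b c p r p0 r0 ks ls g P X R :
  sym3 p0 (a + c) r0 g -> b = (p + r)%N -> b = (p0 + r0)%N -> (r0 + size ks = a)%N ->
  pt p P -> pt (a + c) X -> pt r R -> uniq (P ++ R) ->
  opM a c p r ls (opN a b c p0 r0 ks g) P X R =
  Alt b (fun Y => dlt 0 p0 (take p0 Y) * dlt 0 r0 (drop p0 Y) *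
    g (take p0 Y) X (drop p0 Y) *
    Alt (a + c) (ptens (rowsN r0 ks (take p0 Y) (drop p0 Y) ++ rowsM p ls P R)) X)
   (P ++ R).
Proof.
move=> sg bpr bpr0 sks pP pX pR uPR.
have pY : pt b (P ++ R) by split=> //; rewrite size_cat pP.1 pR.1 bpr.
rewrite opM_reduce //; last by rewrite -bpr; apply: T3_sym.
pose Q Y := dlt 0 p0 (take p0 Y) * dlt 0 r0 (drop p0 Y) * g (take p0 Y) X (drop p0 Y).
transitivity (Alt (a + c) (fun X' => Alt b (fun Y => Q Y * (dlt 0 a (take a X') *
   Alt a (ptens (rowsN r0 ks (take p0 Y) (drop p0 Y))) (take a X') *
   ptens (rowsM p ls P R) (drop a X'))) (P ++ R)) X).
  apply: (Alt_local pX) => X' pX' eX; have [p1 p2] := pt_take_drop pX'.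
  rewrite opN_reduce //; last by rewrite cat_take_drop; case: pX'.
  rewrite cat_take_drop -AltZ; apply: (Alt_local pY) => Y pY' eY.
  rewrite bpr0 in pY'; have [q1 q2] := pt_take_drop pY'.
  by rewrite /Q (sg _ X' _ (take p0 Y) X (drop p0 Y) q1 _ q2) //; ring.
rewrite Alt_fubini; apply: (Alt_local pY) => Y _ eY.
rewrite AltZ; congr (_ * _); rewrite Alt_absorb_head //.
apply: Alt_ext (pX) => X' pX'; have [p1 p2] := pt_take_drop pX'.
rewrite -ptens_cat ?cat_take_drop // p1.1 size_cat !size_map.
by rewrite size_cyc.
Qed.

(** A row is named by a kind, 0, 1 or 2 for [P0], [Y] or [R], and an exponent. These names do not
    involve the points, as [altf_perm] wants. *)
Definition rowlab (P0 Y R : seq rat) (l : nat * nat) : {poly rat} :=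
  chi (if l.1 == 0%N then P0 else if l.1 == 1%N then Y else R) * 'X^(l.2).

Definition labs p r ks ls : seq (nat * nat) :=
  [seq (0%N, e) | e <- cyc r] ++ [seq (1%N, e) | e <- ks] ++
  [seq (1%N, e) | e <- ls] ++ [seq (2%N, e) | e <- cyc p].

Lemma rows_labs p r ks ls P0 R0 P R : perm_eq (P0 ++ R0) (P ++ R) ->
  rowsN r ks P0 R0 ++ rowsM p ls P R =
  map (rowlab P0 (P ++ R) R) (labs p r ks ls).
Proof.
move=> eY; rewrite /rowsN /rowsM /labs (chi_perm eY) !map_cat -!map_comp -!catA.
by [].
Qed.

Lemma size_labs p r ks ls : size (labs p r ks ls) = (r + size ks + size ls + p)%N.
Proof. by rewrite !size_cat !size_map !size_cyc !addnA. Qed.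

Section Kappa.
Variables (m b n : nat) (X : seq rat).
Hypotheses (mE : m = (n + b)%N) (pX : pt m X).

(** A repeated exponent gives two equal rows. Otherwise some exponent below [n] is missing, and the
    corresponding coefficient of the quotient by [chi Y] vanishes on all rows: those built on [P0]
    and [R] have degree less than [b], hence quotient zero. *)
Lemma kappa_diff p0 r0 ks ls P0 R0 P R :
  perm_eq (P0 ++ R0) (P ++ R) -> size P0 = p0 -> size R0 = r0 ->
  size (P ++ R) = b -> all (ltn^~ n) ks -> all (ltn^~ n) ls ->
  (r0 + size ks + (size ls + size P))%N = m ->
  ~~ perm_eq (ks ++ ls) (iota 0 n) ->
  Alt m (ptens (rowsN r0 ks P0 R0 ++ rowsM (size P) ls P R)) X = 0.
Proof.
move=> eY sP0 sR0 sY ltk ltl sm np; rewrite (rows_labs _ _ _ _ eY).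
have slab : size (labs (size P) r0 ks ls) = m by rewrite size_labs -sm !addnA.
have [ukl|nukl] := boolP (uniq (ks ++ ls)); last first.
  apply: (altf_dup (c := m) (Phi := fun fs => Alt m (ptens fs) X)) => //.
    exact: altf_ptens.
  apply: contra nukl => ul.
  have : uniq [seq (1%N, e) | e <- ks ++ ls].
    move: ul; rewrite /labs cat_uniq => /and3P[_ _].
    by rewrite catA cat_uniq -map_cat => /and3P[].
  by rewrite map_inj_uniq // => x y [].
have allkl e : e \in ks ++ ls -> (e < n)%N.
  by rewrite mem_cat => /orP[/(allP ltk)|/(allP ltl)].
have [e en ekl] : exists2 e, (e < n)%N & e \notin ks ++ ls.
  have [/allP H|/allPn[e]] := boolP (all (mem (ks ++ ls)) (iota 0 n)); last first.
    by rewrite mem_iota => /andP[_ en] ekl; exists e.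
  case/negP: np; apply: uniq_perm; rewrite ?iota_uniq // => e.
  by apply/idP/idP => [/allkl|/H//]; rewrite mem_iota.
have [ek el] : e \notin ks /\ e \notin ls.
  by move: ekl; rewrite mem_cat negb_or => /andP.
pose Y := P ++ R.
have szYP : (size P + size R = b)%N by rewrite -size_cat.
have szY0 : (p0 + r0 = b)%N by rewrite -sP0 -sR0 -size_cat (perm_size eY).
have szrow : {in map (rowlab P0 Y R) (labs (size P) r0 ks ls),
    forall f : {poly rat}, (size f <= m)%N}.
  move=> f /mapP[l + ->]; rewrite !mem_cat /rowlab size_chiX.
  case/or4P => /mapP[k kin ->] /=.
  - move: kin; rewrite cyc_lt sP0 mE -szY0 => lk.
    by rewrite (leq_trans _ (leq_addl _ _)) // leq_add2l.
  - by rewrite sY mE addnC leq_add2r; apply: (allP ltk).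
  - by rewrite sY mE addnC leq_add2r; apply: (allP ltl).
  - move: kin; rewrite cyc_lt mE -szYP => lk.
    by rewrite (leq_trans _ (leq_addl _ _)) // addnC leq_add2r.
rewrite Alt_dcoef ?size_map //.
(* [e] is an exponent missing from [ks ++ ls]. *)
apply: (@dcoef_functional (fun q => (q %/ chi Y)`_e) _ _ m _ (chi Y * 'X^e)).
- by move=> q1 q2; rewrite divpD coefD.
- by move=> k q; rewrite divpZl coefZ.
- by rewrite size_map.
- exact: szrow.
- have c0 : chi Y != 0 by rewrite monic_neq0 ?chi_monic.
  move=> f /mapP[l + ->]; rewrite !mem_cat /rowlab.
  case/or4P => /mapP[k kin ->] /=.
  + rewrite divp_small ?coef0 // size_chiX size_chi ltnS sY -szY0 sP0 leq_add2l.
    by rewrite -cyc_lt.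
  + by rewrite mulKp // coefXn; case: eqP ek => // ->; rewrite kin.
  + by rewrite mulKp // coefXn; case: eqP el => // ->; rewrite kin.
  + rewrite divp_small ?coef0 // size_chiX size_chi ltnS sY -szYP addnC leq_add2r.
    by rewrite -cyc_lt.
- by rewrite size_chiX sY mE addnC leq_add2r.
- by rewrite mulKp ?monic_neq0 ?chi_monic // coefXn eqxx oner_eq0.
Qed.

End Kappa.

(** Once sorted, the rows begin with the [chi Y * 'X^e], monic of consecutive decreasing degrees.
    They peel off by [dcoef_top], and the rest is the resultant. *)
Lemma kappa_same p r n ks ls : perm_eq (ks ++ ls) (iota 0 n) ->
  exists e : bool, forall P0 R0 P R X, perm_eq (P0 ++ R0) (P ++ R) ->
    size P0 = p -> size R = r -> uniq (P ++ R) -> pt (n + (r + p)) X ->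
    size (P ++ R) = (r + p)%N ->
    Alt (n + (r + p)) (ptens (rowsN r ks P0 R0 ++ rowsM p ls P R)) X =
    (-1) ^+ e * \prod_(y <- P0) \prod_(z <- R) (z - y).
Proof.
move=> pkl.
pose labs' := [seq (1%N, e) | e <- cyc n] ++
  ([seq (0%N, e) | e <- cyc r] ++ [seq (2%N, e) | e <- cyc p]).
have pl : perm_eq (labs p r ks ls) labs'.
  rewrite /labs /labs' perm_catCA.
  apply: (@perm_trans _ ([seq (1%N, e) | e <- ks] ++ [seq (1%N, e) | e <- ls] ++
    ([seq (0%N, e) | e <- cyc r] ++ [seq (2%N, e) | e <- cyc p]))).
    by rewrite perm_cat2l perm_catCA.
  rewrite catA -map_cat perm_cat2r; apply: perm_map.
  by rewrite (perm_trans pkl) // perm_sym perm_rev.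
have [e E] := altf_perm pl; exists e => P0 R0 P R X eY sP0 sR uY pX sY.
rewrite (rows_labs _ _ _ _ eY).
rewrite (E (n + (r + p))%N (fun fs => Alt (n + (r + p)) (ptens fs) X)); last first.
- rewrite (perm_size pl) !size_cat !size_map !size_cyc //.
- exact: altf_ptens.
congr (_ * _).
have uY0 : uniq (P0 ++ R0) by rewrite (perm_uniq eY).
have uP0 : uniq P0 by move: uY0; rewrite cat_uniq => /and3P[].
have uR : uniq R by move: uY; rewrite cat_uniq => /and3P[].
rewrite -dcoef_resultant // sR sP0.
set rest := (X in _ = dcoef _ X).
have -> : map (rowlab P0 (P ++ R) R) labs' =
    [seq chi (P ++ R) * 'X^e | e <- cyc n] ++ rest.
  by rewrite /labs' !map_cat -!map_comp.
have srest : size rest = size (P ++ R) by rewrite sY size_cat !size_rowX.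
have szrest : {in rest, forall f : {poly rat}, (size f <= size (P ++ R))%N}.
  move=> f; rewrite mem_cat sY => /orP[] /mem_rowX[k lk ->].
    by rewrite size_chiX sP0 addnC leq_add2r.
  by rewrite size_chiX sR leq_add2l.
rewrite -sY in pX *; rewrite Alt_dcoef //; first by rewrite dcoef_top.
  by rewrite [LHS]size_cat srest size_map size_cyc.
move=> f; rewrite mem_cat => /orP[/mem_rowX[k lk ->]|/szrest le].
  by rewrite size_chiX addnC leq_add2r.
exact: leq_trans le (leq_addl _ _).
Qed.

Lemma dcoef_two (q : {poly rat}) p r : q \is monic -> size q = r.+1 ->
  dcoef (p + r) ([seq q * 'X^e | e <- cyc p] ++ [seq 1 * 'X^e | e <- cyc r]) = 1.
Proof.
move=> mq sq; apply: dcoef_monic; first by rewrite size_cat !size_rowX.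
move=> i li; rewrite nth_cat size_rowX; case: ltnP => ip.
  rewrite nth_rowX // rpredM ?monicXn // size_monicM ?monic_neq0 ?monicXn //.
  by rewrite sq size_polyXn; split => //; lia.
by rewrite nth_rowX ?mul1r ?size_polyXn ?monicXn; last lia; split => //; lia.
Qed.

Lemma ptens_scale (q : {poly rat}) es S : size S = size es ->
  ptens [seq q * 'X^e | e <- es] S =
  (\prod_(x <- S) q.[x]) * ptens [seq 'X^e | e <- es] S.
Proof.
elim: es S => [|e es IH] [|x S] //= => [_|[sz]]; first by rewrite !ptens_nil big_nil mul1r.
by rewrite !ptens_cons big_cons IH // hornerM; ring.
Qed.

Lemma ptens_vanish (R S : seq rat) es : size S = size es -> has (mem R) S ->
  ptens [seq \prod_(z <- R) ('X - z%:P) * 'X^e | e <- es] S = 0.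
Proof.
move=> sz /hasP[y yS yR]; rewrite ptens_scale // (perm_big _ (perm_to_rem yS)) big_cons /=.
rewrite (perm_big _ (perm_to_rem yR)) big_cons /= hornerM hornerXsubC subrr.
by rewrite !mul0r.
Qed.

(** Together with [prod_zero_has] this makes the product of the [z - y] a delta function on the
    splittings of [P ++ R]. *)
Lemma split_perm (P0 R0 P R : seq rat) : perm_eq (P0 ++ R0) (P ++ R) ->
  uniq (P ++ R) -> size P0 = size P -> ~~ has (mem R) P0 ->
  perm_eq P0 P /\ perm_eq R0 R.
Proof.
move=> eY uY sz nR.
have uY0 : uniq (P0 ++ R0) by rewrite (perm_uniq eY).
have uP0 : uniq P0 by move: uY0; rewrite cat_uniq => /and3P[].
have uP : uniq P by move: uY; rewrite cat_uniq => /and3P[].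
have sub : {subset P0 <= P}.
  move=> x xP0; have : x \in P ++ R by rewrite -(perm_mem eY) mem_cat xP0.
  by rewrite mem_cat => /orP[//|xR]; case/hasP: nR; exists x.
have pP : perm_eq P0 P.
  by apply: uniq_perm => //; have [] := uniq_min_size uP0 sub; rewrite ?sz.
split=> //; rewrite -(perm_cat2l P); apply: perm_trans eY.
by rewrite perm_sym perm_cat2r.
Qed.

Lemma prod_zero_has (P0 R : seq rat) : has (mem R) P0 ->
  \prod_(y <- P0) \prod_(z <- R) (z - y) = 0.
Proof.
case/hasP => y yP yR; rewrite (perm_big _ (perm_to_rem yP)) big_cons /=.
by rewrite (perm_big _ (perm_to_rem yR)) big_cons /= subrr !mul0r.
Qed.

Lemma prod_scale (k : rat) (F : rat -> rat) (s : seq rat) :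
  \prod_(x <- s) (k * F x) = k ^+ size s * \prod_(x <- s) F x.
Proof.
elim: s => [|x s IH]; first by rewrite !big_nil mulr1.
by rewrite !big_cons IH exprS; ring.
Qed.

(** Only the splitting into [P] and [R] survives, so [g P X R] comes out of the alternating sum.
    What is left is the [Alt] of monic polynomials of degrees [p + r - 1, ..., 0], which is 1. *)
Lemma opMN_same a c p r n ks ls : perm_eq (ks ++ ls) (iota 0 n) ->
  (a + c = n + (r + p))%N -> (r + size ks = a)%N ->
  exists e : bool, forall g P X R, sym3 p (a + c) r g ->
    pt p P -> pt (a + c) X -> pt r R -> uniq (P ++ R) ->
    opM a c p r ls (opN a (p + r) c p r ks g) P X R = (-1) ^+ e * g P X R.
Proof.
move=> pkl acE sks; have [e E] := kappa_same p r pkl.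
exists (e (+) odd (r * p)) => g P X R sg pP pX pR uY.
have sY : size (P ++ R) = (p + r)%N by rewrite size_cat pP.1 pR.1.
rewrite (opMN_reduce ls sg) //.
have pX' : pt (n + (r + p)) X by rewrite -acE.
(* The values of this monic polynomial at the first [p] points give the resultant up to
   [(-1) ^+ (r * p)], so that the resultant can be absorbed into the rows. *)
pose q := \prod_(z <- R) ('X - z%:P).
have mq : q \is monic by apply: monic_prod_XsubC.
have sq : size q = r.+1 by rewrite size_prod_XsubC pR.1.
transitivity (Alt (p + r) (fun Y => ((-1) ^+ (e (+) odd (r * p)) * g P X R) *
   ptens ([seq q * 'X^e | e <- cyc p] ++ [seq 1 * 'X^e | e <- cyc r]) Y) (P ++ R)).
  have pPR : pt (p + r) (P ++ R) by [].
  apply: (Alt_local pPR) => Y pY eY; have [p1 p2] := pt_take_drop pY.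
  rewrite acE E ?cat_take_drop ?p1.1 ?pR.1 ?sY //; last by rewrite addnC.
  have [hR|nR] := boolP (has (mem R) (take p Y)).
    rewrite prod_zero_has // !mulr0.
    rewrite -[X in ptens _ X](cat_take_drop p Y) ptens_cat ?size_rowX ?p1.1 //.
    by rewrite ptens_vanish ?mul0r ?mulr0 // p1.1 size_cyc.
  have [e1 e2] : perm_eq (take p Y) P /\ perm_eq (drop p Y) R.
    by apply: split_perm; rewrite ?cat_take_drop // p1.1 pP.1.
  rewrite (sg _ X _ P X R p1 _ p2) //.
  rewrite -[X in ptens _ X](cat_take_drop p Y) ptens_cat ?size_rowX ?p1.1 // ptens_scale; last first.
    by rewrite p1.1 size_cyc.
  rewrite ptens_scale; last by rewrite p2.1 size_cyc.
  rewrite !dlt_ptens ?p1.1 ?p2.1 //.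
  have -> : \prod_(x <- drop p Y) (1 : {poly rat}).[x] = 1.
    by rewrite big1 // => x _; rewrite hornerC.
  have -> : \prod_(y <- take p Y) \prod_(z <- R) (z - y) =
      (-1) ^+ (r * p) * \prod_(y <- take p Y) q.[y].
    rewrite exprM -{2}p1.1 -prod_scale; apply: eq_bigr => y _.
    rewrite /q horner_prod -{1}pR.1 -prod_scale; apply: eq_bigr => z _.
    by rewrite hornerXsubC mulN1r opprB.
  rewrite -(signr_odd _ (r * p)) signr_addb.
  by move: ((-1) ^+ e) ((-1) ^+ odd (r * p)) => s1 s2; ring.
rewrite AltZ Alt_dcoef ?size_cat ?size_rowX ?dcoef_two ?mulr1 //.
move=> f; rewrite mem_cat => /orP[] /mem_rowX[k lk ->].
  rewrite size_monicM ?monic_neq0 ?monicXn // sq size_polyXn; lia.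
rewrite mul1r size_polyXn; lia.
Qed.

Lemma opMN_diff a b c p r p0 r0 n ks ls g P X R :
  sym3 p0 (a + c) r0 g -> b = (p + r)%N -> b = (p0 + r0)%N -> (r0 + size ks = a)%N ->
  (size ls + p = c)%N -> (a + c = n + b)%N ->
  all (ltn^~ n) ks -> all (ltn^~ n) ls -> ~~ perm_eq (ks ++ ls) (iota 0 n) ->
  pt p P -> pt (a + c) X -> pt r R -> uniq (P ++ R) ->
  opM a c p r ls (opN a b c p0 r0 ks g) P X R = 0.
Proof.
move=> sg bpr bpr0 sks sls acE ltk ltl np pP pX pR uY.
have sY : size (P ++ R) = b by rewrite size_cat pP.1 pR.1.
rewrite (opMN_reduce ls sg) //.
transitivity (Alt b (fun Y => 0 * (fun=> 0) Y) (P ++ R)); last by rewrite AltZ mul0r.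
have pPR : pt b (P ++ R) by [].
apply: (Alt_local pPR) => Y pY eY; rewrite bpr0 in pY; have [p1 p2] := pt_take_drop pY.
rewrite -pP.1 (@kappa_diff (a + c) b n X acE pX p0) ?mulr0 ?mul0r //.
- by rewrite cat_take_drop.
- exact: p1.1.
- exact: p2.1.
- by rewrite pP.1 sks sls.
Qed.

(** * Multilinearity and joint injectivity *)

Lemma ptens_lin A (k : rat) (g h : {poly rat}) B s : (size A < size s)%N ->
  ptens (A ++ (k *: g + h) :: B) s =
  k * ptens (A ++ g :: B) s + ptens (A ++ h :: B) s.
Proof.
elim: A s => [|f A IH] [|x s] //= sz; rewrite !ptens_cons.
  by rewrite hornerD hornerZ; ring.
by rewrite IH //; ring.
Qed.

Inductive pspan (L : Type) (V : L -> Prop) (B : L -> {poly rat}) : {poly rat} -> Prop :=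
| pspan0 : pspan V B 0
| pspanS k l g : V l -> pspan V B g -> pspan V B (k *: B l + g).

Lemma pspan_sum_in (L : eqType) (V : L -> Prop) (B : L -> {poly rat})
    (s : seq L) (k : L -> rat) :
  (forall l, l \in s -> V l) -> pspan V B (\sum_(l <- s) k l *: B l).
Proof.
move=> Vl; elim: s Vl => [|i s IH] Vl; first by rewrite big_nil; apply: pspan0.
rewrite big_cons; apply: pspanS; first by apply: Vl; rewrite mem_head.
by apply: IH => l ls; apply: Vl; rewrite inE ls orbT.
Qed.

Definition plin (c : nat) (Phi : seq {poly rat} -> rat) : Prop :=
  forall A k g h B, size (A ++ g :: B) = c ->
    Phi (A ++ (k *: g + h) :: B) = k * Phi (A ++ g :: B) + Phi (A ++ h :: B).

(** The entries of [gs] are expanded from the left, one at a time; in the claim [K], [ls] records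
    those already replaced by members of the spanning family. *)
Lemma plin_span c Phi (L : Type) (V : L -> Prop) (B : L -> {poly rat}) pre :
  plin c Phi ->
  (forall ls, (forall l, List.In l ls -> V l) -> (size pre + size ls)%N = c ->
     Phi (pre ++ map B ls) = 0) ->
  forall gs, (forall g, List.In g gs -> pspan V B g) -> (size pre + size gs)%N = c ->
     Phi (pre ++ gs) = 0.
Proof.
move=> lP H gs Sgs sz.
suff K ls : (forall l, List.In l ls -> V l) -> (size pre + size ls + size gs)%N = c ->
    Phi (pre ++ map B ls ++ gs) = 0.
  by apply: (K [::]) => //; rewrite addn0.
elim: gs ls Sgs {sz} => [|g gs IH] ls Sgs Vls sz.
  by rewrite cats0; apply: H => //; rewrite addn0 in sz.
have Sg : pspan V B g by apply: Sgs; left.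
have szA h : size ((pre ++ map B ls) ++ h :: gs) = c by rewrite !size_cat size_map.
rewrite catA; elim: Sg => [|k l h Vl _ IHh].
  (* Linearity at [0 = (-1) *: 0 + 0] gives the value zero on a zero entry. *)
  have := lP (pre ++ map B ls) (-1) 0 0 gs (szA _).
  rewrite scaler0 addr0 => E; rewrite {}E.
  by ring.
rewrite (lP _ _ _ _ _ (szA _)) IHh addr0 -cat_rcons.
rewrite rcons_cat -map_rcons -catA IH ?mulr0 //.
- by move=> g' g'gs; apply: Sgs; right.
- by move=> l'; rewrite -cats1 => /List.in_app_iff[/Vls|[<-|[]]].
- by rewrite size_rcons addnS addSn -sz /= addnS.
Qed.

Lemma mul_span (q v : {poly rat}) N : (size v <= N)%N ->
  pspan (fun e => (e < N)%N) (fun e => q * 'X^e) (q * v).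
Proof.
move=> sv.
have -> : q * v = \sum_(l <- iota 0 N) v`_l *: (q * 'X^l).
  rewrite -{1}(subn0 N) -/(index_iota 0 N) big_mkord.
  by rewrite {1}(poly_sumX sv) mulr_sumr; apply: eq_bigr => l _; rewrite scalerAr.
by apply: pspan_sum_in => l; rewrite mem_iota.
Qed.

Section Injective.
Variables (a b c n : nat) (f : fn3) (Y X0 : seq rat).
Hypotheses (sf : sym3 a b c f) (mE : (a + c = n + b)%N).
Hypotheses (pY : pt b Y) (pX : pt (a + c) X0).

(** What [opM_reduce] leaves of [opM], with arbitrary polynomials instead of [rowsM]. *)
Definition pairing (gs : seq {poly rat}) : rat :=
  Alt (a + c) (fun X => dlt 0 a (take a X) * ptens gs (drop a X) *
                        f (take a X) Y (drop a X)) X0.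

Lemma pairing_altf : altf c pairing.
Proof.
move=> A x y B sz.
have lA : ((size A).+1 < c)%N by rewrite -sz size_cat /= !addnS !ltnS leq_addr.
have kn : ((a + size A).+1 < a + c)%N by rewrite -addnS ltn_add2l.
rewrite /pairing -(Alt_swap kn); apply: (Alt_local pX) => X pX' eX.
have [p1 p2] := pt_take_drop pX'.
have -> : swapk (a + size A) X = take a X ++ swapk (size A) (drop a X).
  by rewrite -{1}(cat_take_drop a X) swapk_catr // p1.1.
rewrite take_size_cat ?p1.1 // drop_size_cat ?p1.1 // (ptens_swap sz) ?p2.1 //.
congr (_ * _); apply: sf => //.
by rewrite perm_sym perm_swapk.
Qed.

Lemma pairing_lin : plin c pairing.
Proof.
move=> A k g h B sz; rewrite /pairing -AltZ -AltD.
apply: Alt_ext (pX) => X pX'; have [_ p2] := pt_take_drop pX'.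
rewrite ptens_lin; first by ring.
by rewrite p2.1 -sz size_cat /= addnS ltnS leq_addr.
Qed.

(** Multiples of [chi Y], and the Lagrange polynomials of the points [- y] up to scalars: Euclidean
    division by [chi Y] and interpolation of the remainder expand any polynomial of degree less than
    [a + c]. *)
Definition basisf (l : nat + rat) : {poly rat} :=
  match l with inl l => chi Y * 'X^l | inr y => chi (rem y Y) end.

Definition basisV (l : nat + rat) : bool :=
  match l with inl l => (l < n)%N | inr y => y \in Y end.

Lemma chi_rem_neq0 y : y \in Y -> (chi (rem y Y)).[- y] != 0.
Proof.
move=> yY; rewrite horner_chi prodf_seq_neq0; apply/allP => z zr /=.
rewrite addrC subr_eq0; apply/eqP => e; move: zr.
by rewrite e mem_rem_uniq ?pY.2 // !inE eqxx.
Qed.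

Lemma chi_rem_eq0 y z : y \in Y -> z \in Y -> z != y -> (chi (rem y Y)).[- z] = 0.
Proof. by move=> yY zY zy; rewrite chi_root // mem_rem_uniq ?pY.2 // !inE zy. Qed.

Lemma basis_span (g : {poly rat}) : (size g <= a + c)%N -> pspan basisV basisf g.
Proof.
move=> sg; have c0 : chi Y != 0 by rewrite monic_neq0 ?chi_monic.
set q := g %/ chi Y; set d := g %% chi Y.
have sq : (size q <= n)%N.
  by rewrite size_divp // size_chi /= pY.1 leq_subLR addnC -mE.
have sd : (size d <= b)%N by rewrite -ltnS -pY.1 -size_chi ltn_modp.
pose k (l : nat + rat) : rat :=
  match l with inl l => q`_l | inr y => d.[- y] / (chi (rem y Y)).[- y] end.
suff -> : g = \sum_(l <- [seq inl l | l <- iota 0 n] ++ [seq inr y | y <- Y])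
    k l *: basisf l.
  apply: pspan_sum_in => l; rewrite mem_cat => /orP[] /mapP[x xin ->] //=.
  by rewrite mem_iota in xin.
rewrite big_cat !big_map /= {1}(divp_eq g (chi Y)) -/q -/d; congr (_ + _).
  rewrite -{1}(subn0 n) -/(index_iota 0 n) big_mkord mulrC.
  by rewrite {1}(poly_sumX sq) mulr_sumr; apply: eq_bigr => l _; rewrite scalerAr.
(* The remainder and its interpolation have degree less than [b] and agree at the [b] points
   [- y]. *)
apply/eqP; rewrite -subr_eq0; apply: contraT => h0.
set h := d - _ in h0.
have sh : (size h <= b)%N.
  rewrite (leq_trans (size_polyD _ _)) // geq_max sd size_polyN /=.
  rewrite big_seq; apply: (leq_trans (size_sum _ _ _)); apply/bigmax_leqP_seq => y yY _.
  rewrite (leq_trans (size_scale_leq _ _)) // size_chi size_rem ?yY //.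
  by rewrite pY.1 -pY.1 prednK //; case: (Y) yY.
have := max_poly_roots h0 (rs := map -%R Y).
rewrite size_map pY.1 ltnNge sh => H; suff: false by []; apply: H.
  apply/allP => _ /mapP[y yY ->]; rewrite /root /h hornerD hornerN horner_sum subr_eq0.
  rewrite (perm_big _ (perm_to_rem yY)) big_cons /= hornerZ divfK ?chi_rem_neq0 //.
  rewrite big_seq big1 ?addr0 // => z; rewrite mem_rem_uniq ?pY.2 // !inE => /andP[zy zY].
  have yz : y != z by rewrite eq_sym.
  by rewrite hornerZ (chi_rem_eq0 zY yY yz) mulr0.
by rewrite map_inj_uniq ?pY.2 //; apply: oppr_inj.
Qed.

Hypothesis Hyp : forall p r ls P R, b = (p + r)%N -> (size ls + p)%N = c ->
  sorted ltn ls -> all (ltn^~ n) ls -> perm_eq (P ++ R) Y -> size P = p -> size R = r ->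
  pairing (rowsM p ls P R) = 0.

(** With [R] the complement of [P] in [Y], [chi (rem y Y) = chi R * chi (rem y P)] is a combination
    of the [chi R * 'X^e] with [e < size P]. An alternating form needs [size P] distinct such
    exponents, that is, all of them; so only a multiple of the value at [rowsM] remains. *)
Lemma pairing_split ls P : sorted ltn ls -> all (ltn^~ n) ls -> uniq P ->
  {subset P <= Y} -> (size ls + size P)%N = c ->
  pairing ([seq chi Y * 'X^l | l <- ls] ++ [seq chi (rem y Y) | y <- P]) = 0.
Proof.
move=> sls lls uP PY sc.
pose R := [seq y <- Y | y \notin P].
have ePR : perm_eq (P ++ R) Y.
  have pf : perm_eq (filter (mem P) Y ++ R) Y by rewrite (perm_filterC (mem P) Y).
  apply: perm_trans pf; rewrite perm_cat2r; apply: uniq_perm => //; first exact: filter_uniq pY.2.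
  by move=> y; rewrite mem_filter /=; case: (boolP (y \in P)) => //= /PY.
have bE : b = (size P + size R)%N by rewrite -size_cat (perm_size ePR) pY.1.
apply: (plin_span (B := fun e => chi R * 'X^e) (V := fun e => (e < size P)%N)
  pairing_lin); last first.
- by rewrite !size_map.
- move=> g /List.in_map_iff[y [<- /In_mem yP]].
  have : perm_eq (y :: rem y Y) (y :: (rem y P ++ R)).
    apply: (@perm_trans _ Y); first by rewrite perm_sym perm_to_rem ?PY.
    apply: (@perm_trans _ (P ++ R)); first by rewrite perm_sym.
    by rewrite -cat_cons perm_cat2r perm_to_rem.
  rewrite perm_cons => /chi_perm ->; rewrite chi_cat mulrC.
  apply: mul_span; rewrite size_chi size_rem // prednK //.
  by case: (P) yP.
move=> es Ves; rewrite size_map => ses.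
pose lb (l : nat * nat) := rowlab [::] Y R l.
pose labs1 := [seq (1%N, l) | l <- ls] ++ [seq (2%N, e) | e <- es].
have E es' : [seq chi Y * 'X^l | l <- ls] ++ [seq chi R * 'X^e | e <- es'] =
    map lb ([seq (1%N, l) | l <- ls] ++ [seq (2%N, e) | e <- es']).
  by rewrite map_cat -!map_comp.
have slab : size labs1 = c by rewrite size_cat !size_map.
have ses' : size es = size P by apply/eqP; rewrite -(eqn_add2l (size ls)) sc ses.
rewrite E; have [uL|nL] := boolP (uniq labs1); last first.
  exact: (altf_dup lb pairing_altf slab nL).
have ues : uniq es.
  move: uL; rewrite cat_uniq => /and3P[_ _].
  by rewrite map_inj_uniq // => x y [].
have pes : perm_eq es (cyc (size P)).
  apply: uniq_perm => //; first by rewrite rev_uniq iota_uniq.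
  have sub : {subset es <= cyc (size P)}.
    by move=> e /In_mem ees; rewrite cyc_lt; apply: Ves.
  have [] := uniq_min_size ues sub => //.
  by rewrite size_cyc ses'.
have pl : perm_eq labs1 ([seq (1%N, l) | l <- ls] ++ [seq (2%N, e) | e <- cyc (size P)]).
  by rewrite perm_cat2l perm_map.
have [e Ee] := altf_perm pl; rewrite (Ee _ _ lb pairing_altf slab) -E.
have := Hyp bE sc sls lls ePR erefl erefl.
by rewrite /rowsM (chi_perm ePR) => ->; rewrite mulr0.
Qed.

(** Multilinearity reduces to members of the basis, alternation to distinct ones, listed as in
    [pairing_split]. *)
Lemma pairing0 gs : size gs = c -> (forall g : {poly rat}, g \in gs -> (size g <= a + c)%N) ->
  pairing gs = 0.
Proof.
move=> sgs Sgs.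
apply: (plin_span (B := basisf) (V := basisV) pairing_lin (pre := [::])) => //; last first.
  by move=> g /In_mem ggs; apply: basis_span; apply: Sgs.
rewrite /= => bs Vbs sbs.
have {}Vbs l : l \in bs -> basisV l by move=> /In_mem; apply: Vbs.
have [ub|nub] := boolP (uniq bs); last exact: (altf_dup basisf pairing_altf sbs nub).
pose il (l : nat + rat) := if l is inl k then Some k else None.
pose ir (l : nat + rat) := if l is inr k then Some k else None.
pose ls := sort leq (pmap il bs); pose P := pmap ir bs.
have pb : perm_eq bs (map inl ls ++ map inr P).
  apply: (@perm_trans _ (map inl (pmap il bs) ++ map inr P)).
    rewrite /P; elim: (bs) => // -[l|y] s IH /=; first by rewrite perm_cons.
    by rewrite perm_sym (perm_catCA _ [:: inr y]) /= perm_cons perm_sym.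
  by rewrite perm_cat2r; apply: perm_map; rewrite perm_sym perm_sort.
have ub' : uniq (map inl ls ++ map inr P : seq (nat + rat)) by rewrite -(perm_uniq pb).
have uls : uniq ls.
  by move: ub'; rewrite cat_uniq => /and3P[+ _ _]; rewrite map_inj_uniq // => x y [].
have uP : uniq P.
  by move: ub'; rewrite cat_uniq => /and3P[_ _]; rewrite map_inj_uniq // => x y [].
have [e Ee] := altf_perm pb; rewrite (Ee _ _ basisf pairing_altf sbs).
rewrite map_cat -!map_comp (_ : [seq (basisf \o inl) i | i <- ls] =
  [seq chi Y * 'X^l | l <- ls]) // (_ : [seq (basisf \o inr) i | i <- P] =
  [seq chi (rem y Y) | y <- P]) // pairing_split ?mulr0 //.
- by rewrite ltn_sorted_uniq_leq uls sort_sorted //; apply: leq_total.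
- apply/allP => l lls; have := Vbs (inl l); rewrite (perm_mem pb) mem_cat map_f //.
  by apply.
- move=> y yP; have := Vbs (inr y); rewrite (perm_mem pb) mem_cat.
  by rewrite (map_f inr yP) orbT; apply.
- by rewrite -(size_map (@inl nat rat) ls) -(size_map (@inr nat rat) P) -size_cat -(perm_size pb).
Qed.

(** The rows [q * 'X^e], with [q] vanishing on [A], kill every splitting of [X0] except the one into
    [A] and [C]. The pairing with them is therefore [f A Y C] up to a sign. *)
Lemma sym3_inj A C : pt a A -> pt c C -> X0 = A ++ C -> f A Y C = 0.
Proof.
move=> pA pC eX.
pose q := \prod_(x <- A) ('X - x%:P) : {poly rat}.
have mq : q \is monic by apply: monic_prod_XsubC.
have sq : size q = a.+1 by rewrite size_prod_XsubC pA.1.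
have := @pairing0 [seq q * 'X^e | e <- cyc c].
rewrite size_rowX => /(_ erefl) H.
have {}H : pairing [seq q * 'X^e | e <- cyc c] = 0.
  apply: H => g /mem_rowX[e le ->].
  by rewrite size_monicM ?monic_neq0 ?monicXn // sq size_polyXn addSn /= addnS ltn_add2l.
pose l1 : seq (bool * nat) := [seq (true, e) | e <- cyc a] ++ [seq (false, e) | e <- cyc c].
pose l2 : seq (bool * nat) := [seq (false, e) | e <- cyc c] ++ [seq (true, e) | e <- cyc a].
pose F (l : bool * nat) : {poly rat} := (if l.1 then 1 else q) * 'X^(l.2).
have sl1 : size l1 = (a + c)%N by rewrite size_cat !size_map !size_cyc.
have pl : perm_eq l1 l2 by rewrite /l1 perm_catC.
have [e Ee] := altf_perm pl.
have E2 : Alt (a + c) (ptens (map F l1)) X0 = (-1) ^+ e.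
  rewrite (Ee _ (fun fs => Alt (a + c) (ptens fs) X0) F (altf_ptens pX) sl1).
  rewrite map_cat -!map_comp -[RHS]mulr1; congr (_ * _).
  rewrite Alt_dcoef //; first by rewrite addnC; apply: dcoef_two.
    by rewrite size_cat !size_map !size_cyc addnC.
  move=> g; rewrite mem_cat => /orP[] /mem_rowX[k lk ->].
    by rewrite size_monicM ?monic_neq0 ?monicXn // sq size_polyXn addSn /= addnS ltn_add2l.
  by rewrite mul1r size_polyXn (leq_trans lk) // leq_addr.
have : pairing [seq q * 'X^e | e <- cyc c] = f A Y C * (-1) ^+ e.
  rewrite -E2 -AltZ; apply: (Alt_local pX) => X pX' eXX; have [p1 p2] := pt_take_drop pX'.
  have -> : map F l1 = [seq 1 * 'X^e | e <- cyc a] ++ [seq q * 'X^e | e <- cyc c].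
    by rewrite map_cat -!map_comp.
  rewrite -[X in ptens (_ ++ _) X](cat_take_drop a X) ptens_cat ?size_rowX ?p1.1 //.
  have -> : [seq 1 * 'X^e | e <- cyc a] = [seq 'X^e | e <- cyc a] :> seq {poly rat}.
    by apply: eq_map => k; rewrite mul1r.
  rewrite dlt_ptens ?p1.1 //.
  have [hA|nA] := boolP (has (mem A) (drop a X)).
    by rewrite ptens_vanish ?mulr0 ?mul0r // p2.1 size_cyc.
  have [e2 e1] : perm_eq (drop a X) C /\ perm_eq (take a X) A.
    apply: split_perm; rewrite ?p2.1 ?pC.1 //.
      apply: (@perm_trans _ (take a X ++ drop a X)); first by rewrite perm_catC.
      rewrite cat_take_drop; apply: perm_trans eXX _.
      by rewrite eX perm_catC.
    by rewrite uniq_catC -eX pX.2.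
  by rewrite (sf (A' := A) (B' := Y) (C' := C) p1 pY p2) //; ring.
by rewrite H => /esym/eqP; rewrite mulf_eq0 signr_eq0 orbF => /eqP.
Qed.
End Injective.

Lemma opM_inj a b c n f A Y C : sym3 a b c f -> (a + c = n + b)%N ->
  pt a A -> pt b Y -> pt c C -> uniq (A ++ C) ->
  (forall p r ls P R, b = (p + r)%N -> (size ls + p)%N = c ->
    sorted ltn ls -> all (ltn^~ n) ls -> pt p P -> pt r R -> perm_eq (P ++ R) Y ->
    opM a c p r ls f P (A ++ C) R = 0) ->
  f A Y C = 0.
Proof.
move=> sf mE pA pY pC uAC H.
have pX : pt (a + c) (A ++ C) by split; rewrite // size_cat pA.1 pC.1.
apply: (sym3_inj sf mE pY pX) => // p r ls P R bE sls ols lls ePR sP sR.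
have uPR : uniq (P ++ R) by rewrite (perm_uniq ePR) pY.2.
have pPR : pt (p + r) (P ++ R) by split; rewrite // size_cat sP sR.
have [pP pR] := pt_cat pPR sP.
rewrite -(H p r ls P R) // opM_reduce //; last by rewrite -bE.
apply: Alt_ext (pX) => X pX'; have [p1 p2] := pt_take_drop pX'.
by congr (_ * _); apply: sf => //; rewrite perm_sym.
Qed.

(** * The two morphisms *)

Section Terms.
Variables (a b c p r : nat) (ks ls : seq nat).

Definition wX := w3 vx1 vx2 a b c.
Definition wY := w3 vx2 vx1 p (a + c) r.

Lemma wXE : b = (p + r)%N ->
  nseq a vx1 ++ nseq p vx2 ++ (nseq r vx2 ++ nseq c vx1 ++ [::]) = wX.
Proof. by move=> e; rewrite /wX /w3 e nseqD cats0 -!catA. Qed.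

Lemma wYE : nseq p vx2 ++ nseq a vx1 ++ (nseq c vx1 ++ nseq r vx2 ++ [::]) = wY.
Proof. by rewrite /wY /w3 nseqD cats0 -!catA. Qed.

(** The equation [b = p + r] is tested rather than assumed, so that the term exists for all indices;
    the other branch is a default value. *)
Definition crM : term wX wY :=
  match b =P (p + r)%N with
  | ReflectT e => hcast (wXE e) wYE
      (bl2 (nseq a vx1) (nseq p vx2) (nseq r vx2) (nseq c vx1))
  | ReflectF _ => tzero wX wY
  end.

Definition crN : term wY wX :=
  match b =P (p + r)%N with
  | ReflectT e => hcast wYE (wXE e)
      (bl2 (nseq p vx2) (nseq a vx1) (nseq c vx1) (nseq r vx2))
  | ReflectF _ => tzero wY wX
  end.

(* The factors [x + y] of [chi] that do not occur here come from the mixed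
   crossings, cf. [KM_val] and [KN_val]. *)
Definition FM := expo 0 (cyc p) ++ expo (p + (a + c)) (cyc r) ++ expo p (cyc a) ++
  expo (p + a) (ls ++ cyc p) ++ sums (p + a) (c - p) 0 p.

Definition FN := expo a (cyc p) ++ expo (a + p) (cyc r) ++ expo (a + b) (cyc c) ++
  expo 0 (cyc r ++ ks) ++ sums r (a - r) (a + p) r.

(** The sign is carried by this term alone, so that its composite with [Nt] becomes the idempotent
    itself. *)
Definition Mt (e : bool) : term wX wY :=
  let T := (e3 vx2 vx1 p (a + c) r \oc mulT wY FM \oc crM \oc D3 vx1 vx2 a b c)%T in
  if e then topp T else T.

Definition Nt : term wY wX :=
  (e3 vx1 vx2 a b c \oc mulT wX FN \oc crN \oc D3 vx2 vx1 p (a + c) r)%T.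

Hypotheses (bE : b = (p + r)%N) (pc : (p <= c)%N) (ra : (r <= a)%N).
Hypotheses (sls : size ls = (c - p)%N) (sks : size ks = (a - r)%N).

Lemma sem_crM h P A C R : size P = p -> size A = a -> size C = c -> size R = r ->
  sem crM h (P ++ A ++ C ++ R) =
  (\prod_(t <- C) \prod_(q <- R) (t + q)) * h (A ++ P ++ R ++ C).
Proof.
move=> sP sA sC sR; rewrite /crM; case: eqP => // e; rewrite sem_hcast sem_bl2 //.
congr (_ * _); rewrite big1 ?mul1r // => t _; by rewrite big1.
Qed.

Lemma sem_crN h P A C R : size P = p -> size A = a -> size C = c -> size R = r ->
  sem crN h (A ++ P ++ R ++ C) =
  (\prod_(t <- A) \prod_(q <- P) (t + q)) * h (P ++ A ++ C ++ R).
Proof.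
move=> sP sA sC sR; rewrite /crN; case: eqP => // e; rewrite sem_hcast sem_bl2 //.
rewrite [X in X * _]big1 ?mul1r // => t _; by rewrite big1.
Qed.

(** The crossings supply [t + q] for all [t] in [C] and [q] in [R], and [sums] pairs the first
    [c - p] points of [C] with [P]. This amounts to [chi (P ++ R)] at those points and [chi R] at
    the other [p]. *)
Lemma KM_val P A C R : size P = p -> size A = a -> size C = c -> size R = r ->
  Fval FM (P ++ A ++ C ++ R) * (\prod_(t <- C) \prod_(q <- R) (t + q)) =
  KM a p r ls P (A ++ C) R.
Proof.
clear sks.
move=> sP sA sC sR; rewrite /FM !Fval_cat.
have E1 : Fval (expo 0 (cyc p)) (P ++ A ++ C ++ R) = ptens [seq 'X^e | e <- cyc p] P.
  by rewrite -[P ++ _]cat0s Fval_expo ?size_cyc.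
have E2 : Fval (expo (p + (a + c)) (cyc r)) (P ++ A ++ C ++ R) = ptens [seq 'X^e | e <- cyc r] R.
  have -> : P ++ A ++ C ++ R = (P ++ A ++ C) ++ R ++ [::] by rewrite cats0 -!catA.
  by rewrite Fval_expo ?size_cyc // !size_cat sP sA sC.
have E3 : Fval (expo p (cyc a)) (P ++ A ++ C ++ R) = ptens [seq 'X^e | e <- cyc a] A.
  by rewrite Fval_expo ?size_cyc.
have E4 : Fval (expo (p + a) (ls ++ cyc p)) (P ++ A ++ C ++ R) =
    ptens [seq 'X^e | e <- ls ++ cyc p] C.
  by rewrite catA Fval_expo ?size_cat ?sls ?size_cyc ?sP ?sA // subnK.
rewrite {}E1 {}E2 {}E3 {}E4 [P ++ A ++ C ++ R]catA.
rewrite Fval_sums; last first.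
- by rewrite add0n !size_cat sP sA sC sR; lia.
- by rewrite !size_cat sP sA sC sR; lia.
rewrite drop_size_cat ?size_cat ?sP ?sA // take_cat sC.
have -> : (if (c - p < c)%N then take (c - p) C else C ++ take (c - p - c) R) = take (c - p) C.
  case: ltnP => // h; have e : (c - p = c)%N by apply/eqP; rewrite eqn_leq h leq_subr.
  by rewrite e subnn take0 cats0 -sC take_size.
rewrite drop0 -catA take_size_cat // /KM take_size_cat // drop_size_cat //.
rewrite !dlt_ptens // /rowsM map_cat.
rewrite -[X in ptens ([seq 'X^e | e <- ls] ++ _) X](cat_take_drop (c - p) C).
rewrite -[X in _ = _ * (_ * ptens _ X)](cat_take_drop (c - p) C).
have sC1 : size (take (c - p) C) = (c - p)%N by rewrite size_takel // sC leq_subr.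
have sC2 : size (drop (c - p) C) = p by rewrite size_drop sC subKn.
rewrite !ptens_cat ?size_map ?sls ?sC1 // !ptens_scale ?sC1 ?sC2 ?sls ?size_cyc //.
rewrite -[in X in _ * X = _](cat_take_drop (c - p) C) big_cat /=.
have -> : \prod_(x <- take (c - p) C) (chi (P ++ R)).[x] =
  (\prod_(x <- take (c - p) C) \prod_(y <- P) (x + y)) *
  (\prod_(x <- take (c - p) C) \prod_(y <- R) (x + y)).
  rewrite -big_split; apply: eq_bigr => x _ /=.
  by rewrite chi_cat hornerM !horner_chi.
have -> : \prod_(x <- drop (c - p) C) (chi R).[x] =
  \prod_(x <- drop (c - p) C) \prod_(y <- R) (x + y).
  by apply: eq_bigr => x _; rewrite horner_chi.
by ring.
Qed.

(** Here the crossings supply the sums over [A] and [P], and [sums] pairs the last [a - r] points of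
    [A] with [R]. *)
Lemma KN_val P A C R : size P = p -> size A = a -> size C = c -> size R = r ->
  Fval FN (A ++ P ++ R ++ C) * (\prod_(t <- A) \prod_(q <- P) (t + q)) =
  KN c p r ks A (P ++ R) C.
Proof.
clear sls.
move=> sP sA sC sR; rewrite /FN !Fval_cat.
have E1 : Fval (expo a (cyc p)) (A ++ P ++ R ++ C) = ptens [seq 'X^e | e <- cyc p] P.
  by rewrite Fval_expo ?size_cyc.
have E2 : Fval (expo (a + p) (cyc r)) (A ++ P ++ R ++ C) = ptens [seq 'X^e | e <- cyc r] R.
  by rewrite catA Fval_expo ?size_cyc // size_cat sP sA.
have E3 : Fval (expo (a + b) (cyc c)) (A ++ P ++ R ++ C) = ptens [seq 'X^e | e <- cyc c] C.
  have -> : A ++ P ++ R ++ C = (A ++ P ++ R) ++ C ++ [::] by rewrite cats0 -!catA.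
  by rewrite Fval_expo ?size_cyc // !size_cat sP sA sR bE.
have E4 : Fval (expo 0 (cyc r ++ ks)) (A ++ P ++ R ++ C) =
    ptens [seq 'X^e | e <- cyc r ++ ks] A.
  by rewrite -[A ++ _]cat0s Fval_expo // size_cat sks size_cyc subnKC.
rewrite {}E1 {}E2 {}E3 {}E4.
rewrite Fval_sums; last first.
- by rewrite !size_cat sP sA sC sR; lia.
- by rewrite !size_cat sP sA sC sR; lia.
have -> : take (a - r) (drop r (A ++ P ++ R ++ C)) = drop r A.
  rewrite drop_cat sA; case: ltnP => h.
    by rewrite take_cat size_drop sA ltnn subnn take0 cats0.
  have e : r = a by apply/eqP; rewrite eqn_leq ra h.
  by rewrite e subnn take0 drop_oversize ?sA.
rewrite [A ++ P ++ _]catA drop_size_cat ?size_cat ?sA ?sP // take_size_cat //.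
rewrite /KN take_size_cat // drop_size_cat // !dlt_ptens // /rowsN map_cat.
rewrite -[X in ptens ([seq 'X^e | e <- cyc r] ++ _) X](cat_take_drop r A).
rewrite -[X in _ = _ * (_ * ptens _ X)](cat_take_drop r A).
have sA1 : size (take r A) = r by rewrite size_takel // sA.
have sA2 : size (drop r A) = (a - r)%N by rewrite size_drop sA.
rewrite !ptens_cat ?size_map ?size_cyc ?sA1 // !ptens_scale ?sA1 ?sA2 ?sks ?size_cyc //.
rewrite -[in X in _ * X = _](cat_take_drop r A) big_cat /=.
have -> : \prod_(x <- drop r A) (chi (P ++ R)).[x] =
  (\prod_(x <- drop r A) \prod_(y <- P) (x + y)) *
  (\prod_(x <- drop r A) \prod_(y <- R) (x + y)).
  rewrite -big_split; apply: eq_bigr => x _ /=.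
  by rewrite chi_cat hornerM !horner_chi.
have -> : \prod_(x <- take r A) (chi P).[x] =
  \prod_(x <- take r A) \prod_(y <- P) (x + y).
  by apply: eq_bigr => x _; rewrite horner_chi.
by ring.
Qed.

Lemma fok_FM : all (fok (size wY)) FM.
Proof.
clear sks.
rewrite /wY size_w3 /FM !all_cat !fok_expo ?fok_sums //;
  rewrite ?size_cat ?size_cyc ?sls; lia.
Qed.

Lemma fok_FN : all (fok (size wX)) FN.
Proof.
clear sls.
rewrite /wX size_w3 /FN !all_cat !fok_expo ?fok_sums //;
  rewrite ?size_cat ?size_cyc ?sks; lia.
Qed.

Definition cur (h : fn) : fn3 := fun A B C => h (A ++ B ++ C).

Lemma sem_Mt e h P X R : pt p P -> pt (a + c) X -> pt r R -> uniq (P ++ R) ->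
  sem (Mt e) h (P ++ X ++ R) =
  (-1) ^+ e * (dlt3 p (a + c) r P X R * opM a c p r ls (T3 a b c (cur h)) P X R).
Proof.
clear sks.
move=> pP pX pR uPR.
suff E : sem (e3 vx2 vx1 p (a + c) r \oc mulT wY FM \oc crM \oc D3 vx1 vx2 a b c) h (P ++ X ++ R)
   = dlt3 p (a + c) r P X R * opM a c p r ls (T3 a b c (cur h)) P X R.
  by rewrite /Mt; case: e => /=; rewrite -E ?expr0 ?mul1r ?expr1 ?mulN1r.
rewrite !sem_comp sem_e3 //; congr (_ * _); apply: T3_local => // P' X' R' pP' pX' pR' eP eX eR.
have uPR' : uniq (P' ++ R') by rewrite (perm_uniq (_ : perm_eq _ (P ++ R))) // perm_cat.
have [pA pC] := pt_take_drop pX'.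
rewrite sem_mulT ?fok_FM //; last first.
  by rewrite /wY size_w3 !size_cat pP'.1 pX'.1 pR'.1 addnA.
have eX' : P' ++ X' ++ R' = P' ++ take a X' ++ drop a X' ++ R'.
  by rewrite -{1}(cat_take_drop a X') -catA.
rewrite eX' sem_crM ?pP'.1 ?pA.1 ?pC.1 ?pR'.1 // mulrA KM_val ?pP'.1 ?pA.1 ?pC.1 ?pR'.1 //.
rewrite cat_take_drop; congr (_ * _).
have -> : take a X' ++ P' ++ R' ++ drop a X' = take a X' ++ (P' ++ R') ++ drop a X'.
  by rewrite -!catA.
rewrite sem_D3 //; split=> //; rewrite size_cat pP'.1 pR'.1 bE //.
Qed.

Lemma sem_Nt h A Y C : pt a A -> pt b Y -> pt c C -> uniq (A ++ C) ->
  sem Nt h (A ++ Y ++ C) =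
  dlt3 a b c A Y C * opN a b c p r ks (T3 p (a + c) r (cur h)) A Y C.
Proof.
clear sls.
move=> pA pY pC uAC.
rewrite !sem_comp sem_e3 //; congr (_ * _); apply: T3_local => // A' Y' C' pA' pY' pC' eA eY eC.
have uAC' : uniq (A' ++ C') by rewrite (perm_uniq (_ : perm_eq _ (A ++ C))) // perm_cat.
have [pP pR] : pt p (take p Y') /\ pt r (drop p Y').
  by apply: pt_take_drop; rewrite -bE.
rewrite sem_mulT ?fok_FN //; last first.
  by rewrite /wX size_w3 !size_cat pA'.1 pY'.1 pC'.1 addnA.
have eY' : A' ++ Y' ++ C' = A' ++ take p Y' ++ drop p Y' ++ C'.
  by rewrite -{1}(cat_take_drop p Y') -catA.
rewrite eY' sem_crN ?pA'.1 ?pP.1 ?pC'.1 ?pR.1 // mulrA KN_val ?pA'.1 ?pP.1 ?pC'.1 ?pR.1 //.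
rewrite cat_take_drop; congr (_ * _).
have -> : take p Y' ++ A' ++ C' ++ drop p Y' = take p Y' ++ (A' ++ C') ++ drop p Y'.
  by rewrite -!catA.
rewrite sem_D3 //; split=> //; rewrite size_cat pA'.1 pC'.1 //.
Qed.

Lemma homog_D3 i j x y z : homog ((-2) *+ (tri x + tri y + tri z)) (D3 i j x y z).
Proof. by rewrite !mulrnDr; apply: homog_tens; [apply: homog_tens|]; apply: homog_Dlong. Qed.

Lemma homog_e3 i j x y z : homog 0 (e3 i j x y z).
Proof.
have E k n : homog 0 (delta k n \oc Dlong k n).
  have := homog_comp (homog_delta k n) (homog_Dlong k n).
  by rewrite mulNrn addrN.
rewrite -[0]addr0; apply: homog_tens; last exact: E.
by rewrite -[0]addr0; apply: homog_tens; apply: E.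
Qed.

Lemma homog_crM : homog (a * p + r * c)%N%:Z crM.
Proof.
rewrite /crM; case: eqP => // e; apply: homog_hcast; exact: homog_bl2.
Qed.

Lemma homog_crN : homog (p * a + c * r)%N%:Z crN.
Proof.
rewrite /crN; case: eqP => // e; apply: homog_hcast; exact: homog_bl2.
Qed.

Lemma homog_Mt e : homog
  (2 *+ (tri p + tri r + tri a + (sumn ls + tri p) + (c - p) * p)
   + (a * p + r * c)%N%:Z - 2 *+ (tri a + tri b + tri c)) (Mt e).
Proof.
clear sks.
have H : homog (2 *+ (tri p + tri r + tri a + (sumn ls + tri p) + (c - p) * p)
   + (a * p + r * c)%N%:Z - 2 *+ (tri a + tri b + tri c))
   (e3 vx2 vx1 p (a + c) r \oc mulT wY FM \oc crM \oc D3 vx1 vx2 a b c).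
  apply: homog_comp; last by rewrite -mulNrn; apply: homog_D3.
  apply: homog_comp; last exact: homog_crM.
  rewrite -[X in homog X]add0r; apply: homog_comp; first exact: homog_e3.
  have sF : size FM = (tri p + tri r + tri a + (sumn ls + tri p) + (c - p) * p)%N; last first.
    by rewrite -sF; apply: homog_mulT fok_FM.
  by rewrite /FM !size_cat !size_expo size_sums sumn_cat !sumn_cyc !addnA.
by rewrite /Mt; case: e => //; apply: homog_opp.
Qed.

Lemma homog_Nt : homog
  (2 *+ (tri p + tri r + tri c + (tri r + sumn ks) + (a - r) * r)
   + (p * a + c * r)%N%:Z - 2 *+ (tri p + tri (a + c) + tri r)) Nt.
Proof.
clear sls.
apply: homog_comp; last by rewrite -mulNrn; apply: homog_D3.
apply: homog_comp; last exact: homog_crN.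
rewrite -[X in homog X]add0r; apply: homog_comp; first exact: homog_e3.
have sF : size FN = (tri p + tri r + tri c + (tri r + sumn ks) + (a - r) * r)%N; last first.
  by rewrite -sF; apply: homog_mulT fok_FN.
by rewrite /FN !size_cat !size_expo size_sums sumn_cat !sumn_cyc !addnA.
Qed.
End Terms.

(** * Partitions in a box *)

Section Partitions.
Local Open Scope nat_scope.
Variables (k l : nat).

(* The box partition [al] encoded as the strictly increasing sequence of
   exponents [k + l - 1 - (al_i + k - 1 - i)]. *)
Definition lsof (al : k.-tuple 'I_l.+1) : seq nat :=
  mkseq (fun i => (k + l).-1 - (nth 0 [seq val x | x <- al] i + (k.-1 - i))) k.

Definition ksof (ls : seq nat) : seq nat := [seq e <- iota 0 (k + l) | e \notin ls].

Lemma size_lsof al : size (lsof al) = k.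
Proof. exact: size_mkseq. Qed.

Lemma nth_al (al : k.-tuple 'I_l.+1) i : nth 0 [seq val x | x <- al] i <= l.
Proof.
have [li|li] := ltnP i k; last by rewrite nth_default // size_map size_tuple.
by rewrite (nth_map ord0) ?size_tuple // -ltnS ltn_ord.
Qed.

Lemma lsofE al i : i < k ->
  nth 0 (lsof al) i + nth 0 [seq val x | x <- al] i + (k.-1 - i) = (k + l).-1.
Proof.
move=> li; rewrite nth_mkseq //; have := nth_al al i.
by move: (nth 0 _ i) => v lv; lia.
Qed.

Lemma lsof_lt al : all (ltn^~ (k + l)) (lsof al).
Proof.
apply/allP => x /mapP[i]; rewrite /= mem_iota => /andP[_ li] ->.
by move: (nth _ _ _) => v; lia.
Qed.

Lemma lsof_sorted al : al \in parts k l -> sorted ltn (lsof al).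
Proof.
rewrite inE => /(sortedP 0) sal; apply/(sortedP 0) => i; rewrite size_lsof => li.
have := sal i; rewrite size_map size_tuple => /(_ li).
have := lsofE al li; have := lsofE al (ltnW li); have := nth_al al i.
by rewrite /=; move: (nth 0 _ i) (nth 0 _ i.+1) (nth 0 _ i) (nth 0 _ i.+1) => *; lia.
Qed.

Lemma lsof_inj : injective lsof.
Proof.
move=> al al' E; apply: val_inj; apply: (inj_map val_inj).
apply: (@eq_from_nth _ 0); rewrite !size_map !size_tuple // => i li.
by have := lsofE al li; rewrite -(lsofE al' li) E => /addIn /addnI.
Qed.

Lemma sorted_ltn_gap (s : seq nat) i j : sorted ltn s -> i <= j -> j < size s ->
  nth 0 s i + (j - i) <= nth 0 s j.
Proof.
move=> /(sortedP 0) ss; elim: j => [|j IH]; first by case: i => // *; rewrite addn0.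
rewrite leq_eqVlt => /orP[/eqP->|ij] js; first by rewrite subnn addn0.
by have := ss j js; have := IH ij (ltnW js) => /=; lia.
Qed.

Lemma lsof_surj (ls : seq nat) : sorted ltn ls -> all (ltn^~ (k + l)) ls -> size ls = k ->
  exists2 al, al \in parts k l & lsof al = ls.
Proof.
move=> sls lls sz.
pose v i := (k + l).-1 - (nth 0 ls i + (k.-1 - i)).
have B i : i < k -> nth 0 ls i + (k.-1 - i) <= (k + l).-1 /\ i <= nth 0 ls i.
  move=> li; split.
    have := @sorted_ltn_gap ls i k.-1 sls; rewrite sz => /(_ _ _) H.
    have {}H : nth 0 ls i + (k.-1 - i) <= nth 0 ls k.-1 by apply: H; lia.
    have : nth 0 ls k.-1 < k + l by apply: (allP lls); rewrite mem_nth // sz; lia.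
    by lia.
  have := @sorted_ltn_gap ls 0 i sls (leq0n _); rewrite sz => /(_ li); lia.
pose al : k.-tuple 'I_l.+1 := [tuple inord (v i) | i < k].
have vE i : i < k -> nth 0 [seq val x | x <- al] i = v i.
  move=> li; rewrite (nth_map ord0) ?size_tuple // -[i]/(val (Ordinal li)) -tnth_nth.
  rewrite tnth_mktuple /= inordK //; have [] := B i li; rewrite /v; lia.
exists al.
  rewrite inE; apply/(sortedP 0) => i; rewrite size_map size_tuple => li.
  rewrite (vE _ li) (vE _ (ltnW li)); change (v i.+1 <= v i); rewrite /v.
  have := (sortedP 0 sls) i; rewrite sz => /(_ li).
  have [] := B _ li; have [] := B _ (ltnW li); rewrite /ltn /=.
  by move: (nth 0 ls i) (nth 0 ls i.+1) => *; lia.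
apply: (@eq_from_nth _ 0); rewrite size_lsof // => i li.
rewrite nth_mkseq // vE // /v; have [] := B i li; lia.
Qed.

Lemma sumn_lsof al : sumn (lsof al) + psize al + tri k = k * (k + l).-1.
Proof.
have -> : sumn (lsof al) = \sum_(i < k) nth 0 (lsof al) i.
  by rewrite sumnE (big_nth 0) big_mkord size_lsof.
have -> : psize al = \sum_(i < k) nth 0 [seq val x | x <- al] i.
  by rewrite /psize -(big_map val xpredT id) (big_nth 0) big_mkord size_map size_tuple.
have -> : tri k = \sum_(i < k) (k.-1 - i).
  rewrite -sumn_cyc sumnE (big_nth 0) big_mkord size_cyc; apply: eq_bigr => i _.
  by rewrite nth_cyc //; have := ltn_ord i; lia.
rewrite -!big_split /= (eq_bigr (fun=> (k + l).-1)); last first.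
  by move=> i _; rewrite lsofE.
by rewrite sum_nat_const card_ord.
Qed.

Lemma perm_ksof (ls : seq nat) : uniq ls -> all (ltn^~ (k + l)) ls ->
  perm_eq (ksof ls ++ ls) (iota 0 (k + l)).
Proof.
move=> uls lls; rewrite perm_catC.
have pf : perm_eq (filter (mem ls) (iota 0 (k + l)) ++ ksof ls) (iota 0 (k + l)).
  by rewrite (perm_filterC (mem ls)).
apply: perm_trans pf; rewrite perm_cat2r; apply: uniq_perm => //.
  by rewrite filter_uniq ?iota_uniq.
move=> e; rewrite mem_filter /= mem_iota add0n /=.
by case: (boolP (e \in ls)) => //= /(allP lls) /= el; rewrite [(e < _)%N]el.
Qed.

Lemma ksof_lt ls : all (ltn^~ (k + l)) (ksof ls).
Proof. by apply/allP => e; rewrite mem_filter mem_iota => /andP[_ /andP[]]. Qed.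

Section Valid.
Variables (al : k.-tuple 'I_l.+1).
Hypothesis valid : al \in parts k l.

Lemma uniq_lsof : uniq (lsof al).
Proof. by have := lsof_sorted valid; rewrite ltn_sorted_uniq_leq => /andP[]. Qed.

Lemma perm_ksof_lsof : perm_eq (ksof (lsof al) ++ lsof al) (iota 0 (k + l)).
Proof. exact: perm_ksof uniq_lsof (lsof_lt al). Qed.

Lemma size_ksof : size (ksof (lsof al)) = l.
Proof.
have := perm_size perm_ksof_lsof; rewrite size_cat size_lsof size_iota.
by move/eqP; rewrite addnC eqn_add2l => /eqP.
Qed.

Lemma sumn_ksof : sumn (ksof (lsof al)) + sumn (lsof al) = tri (k + l).
Proof.
rewrite -sumn_cat (perm_sumn perm_ksof_lsof).
by rewrite -sumn_cyc /cyc sumn_rev.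
Qed.

Lemma lsof_unique ls : perm_eq (ksof (lsof al) ++ ls) (iota 0 (k + l)) ->
  sorted ltn ls -> ls = lsof al.
Proof.
move=> pl sls; apply: (irr_sorted_eq ltn_trans ltnn sls (lsof_sorted valid)).
have : perm_eq ls (lsof al).
  rewrite -(perm_cat2l (ksof (lsof al))); apply: perm_trans pl _.
  by rewrite perm_sym perm_ksof_lsof.
by move/perm_mem.
Qed.
End Valid.
Lemma triD x y : tri (x + y) = tri x + tri y + x * y.
Proof. by elim: y => [|y IH]; rewrite ?addn0 ?muln0 ?addn0 // addnS !triS IH mulnS; lia. Qed.

Lemma tri2 x : 2 * tri x = x * x.-1.
Proof. by elim: x => // x IH; rewrite triS mulnDr IH; case: x {IH} => //= x; lia. Qed.

End Partitions.

(** * Degrees of the two morphisms *)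

Section Degrees.
Variables (a b c p r : nat).
Hypotheses (bE : b = (p + r)%N) (pc : (p <= c)%N) (ra : (r <= a)%N).
Variable (al : (c - p).-tuple 'I_(a - r).+1).
Let ls := lsof al.
Let ks := ksof (c - p) (a - r) ls.

(** The shifts of the two objects, collected from the divided powers and from the summand. *)
Let degX : int := - (tri a)%:Z - (tri b)%:Z - (tri c)%:Z.
Let degY : int := - (tri p)%:Z - (tri (a + c))%:Z - (tri r)%:Z +
  ((2 * psize al)%N%:Z - ((c - p) * (a - r))%N%:Z).

Lemma degree_M :
  2 *+ (tri p + tri r + tri a + (sumn ls + tri p) + (c - p) * p)
   + (a * p + r * c)%N%:Z - 2 *+ (tri a + tri b + tri c) = degX - degY.
Proof.
rewrite /degX /degY bE.
have := sumn_lsof al; rewrite -/ls; move: (sumn ls) (psize al) => sl ps.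
have : (c - p + p = c)%N by rewrite subnK.
have : (a - r + r = a)%N by rewrite subnK.
move: (c - p)%N (a - r)%N => k l <- <- S.
have T := tri2 k.
have K : (k * (k + l).-1 + k = k * k + k * l)%N.
  by case: (k) => // k'; rewrite addSn /=; lia.
have K2 : (k * k.-1 + k = k * k)%N by case: (k) => //= k'; lia.
rewrite !triD; move: (tri p) (tri r) (tri k) (tri l) S T => Tp Tr Tk Tl S T.
by move: (k * (k + l).-1)%N (k * k.-1)%N S T K K2 => *; lia.
Qed.

Hypothesis valid : al \in parts (c - p) (a - r).

(** The two exponent sets share out [0, ..., k + l - 1], with [k = c - p] and [l = a - r], which
    makes the degrees of the two terms opposite. *)
Lemma degree_N :
  2 *+ (tri p + tri r + tri c + (tri r + sumn ks) + (a - r) * r)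
   + (p * a + c * r)%N%:Z - 2 *+ (tri p + tri (a + c) + tri r) = degY - degX.
Proof.
rewrite -[RHS]opprB -degree_M bE.
have := sumn_ksof valid; rewrite -/ls -/ks; move: (sumn ls) (sumn ks) => sl sk.
have : (c - p + p = c)%N by rewrite subnK.
have : (a - r + r = a)%N by rewrite subnK.
by move: (c - p)%N (a - r)%N => k l <- <-; rewrite !triD; lia.
Qed.
End Degrees.

(** * Compatibility with the idempotents of the divided powers *)

Section Triples.
Variables (i j : vertex) (x y z : nat).

Lemma T3_sem_e3 h A B C : pt x A -> pt y B -> pt z C ->
  T3 x y z (cur (sem (e3 i j x y z) h)) A B C = T3 x y z (cur h) A B C.
Proof.
move=> pA pB pC; rewrite -[RHS](T3_dlt pA pB pC); last exact: T3_sym.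
by apply: T3_local => // A' B' C' pA' pB' pC' _ _ _; exact: sem_e3.
Qed.

Lemma e3_idem : (e3 i j x y z \oc e3 i j x y z)%T =h e3 i j x y z.
Proof.
apply: sem_complete => h s; rewrite size_w3 => sz /generic_uniq us.
have [A [B [C [pA pB pC ->]]]] := pt_cat3 sz us.
by rewrite sem_comp !sem_e3 // -/(cur _) -/(cur h) T3_sem_e3.
Qed.

Lemma D3_e3 : (D3 i j x y z \oc e3 i j x y z)%T =h D3 i j x y z.
Proof.
apply: sem_complete => h s; rewrite size_w3 => sz /generic_uniq us.
have [A [B [C [pA pB pC ->]]]] := pt_cat3 sz us.
by rewrite sem_comp !sem_D3 // -/(cur _) -/(cur h) T3_sem_e3.
Qed.
End Triples.

Section MtNt.
Variables (a b c p r : nat) (ks ls : seq nat).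

Lemma e3_Nt : (e3 vx1 vx2 a b c \oc Nt a b c p r ks)%T =h Nt a b c p r ks.
Proof.
apply: sem_complete => h s sz gs.
exact: (sem_sound (e3_idem vx1 vx2 a b c)).
Qed.

Lemma Nt_e3 : (Nt a b c p r ks \oc e3 vx2 vx1 p (a + c) r)%T =h Nt a b c p r ks.
Proof.
apply: sem_complete => h s sz gs; rewrite sem_comp /Nt ![sem (_ \oc D3 _ _ _ _ _)%T _ _]sem_comp.
apply: sem_ext_gen => // t szt gt.
exact: (sem_sound (D3_e3 vx2 vx1 p (a + c) r)).
Qed.

Lemma e3_Mt e : (e3 vx2 vx1 p (a + c) r \oc Mt a b c p r ls e)%T =h Mt a b c p r ls e.
Proof.
have E h s : size s = size (wY a c p r) -> generic s ->
    sem (e3 vx2 vx1 p (a + c) r \oc Mt a b c p r ls false) h s = sem (Mt a b c p r ls false) h s.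
  move=> sz gs; exact: (sem_sound (e3_idem vx2 vx1 p (a + c) r)).
apply: sem_complete => h s sz gs; case: e; last exact: E.
have -> : sem (e3 vx2 vx1 p (a + c) r \oc Mt a b c p r ls true) h s =
   - sem (e3 vx2 vx1 p (a + c) r \oc Mt a b c p r ls false) h s.
  exact: (semN (e3 vx2 vx1 p (a + c) r) (sem (Mt a b c p r ls false) h) s).
by rewrite E.
Qed.

Lemma Mt_e3 e : (Mt a b c p r ls e \oc e3 vx1 vx2 a b c)%T =h Mt a b c p r ls e.
Proof.
have E h s : size s = size (wY a c p r) -> generic s ->
    sem (Mt a b c p r ls false \oc e3 vx1 vx2 a b c) h s = sem (Mt a b c p r ls false) h s.
  move=> sz gs; rewrite sem_comp /Mt ![sem (_ \oc D3 _ _ _ _ _)%T _ _]sem_comp.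
  apply: sem_ext_gen => // t szt gt.
  exact: (sem_sound (D3_e3 vx1 vx2 a b c)).
apply: sem_complete => h s sz gs; case: e; last exact: E.
exact: (congr1 -%R (E h s sz gs)).
Qed.
End MtNt.

Lemma opM_local a c p r ls f f' P X R : pt p P -> pt (a + c) X -> pt r R -> uniq (P ++ R) ->
  (forall A Y C, pt a A -> pt (p + r) Y -> pt c C -> uniq (A ++ C) -> f A Y C = f' A Y C) ->
  opM a c p r ls f P X R = opM a c p r ls f' P X R.
Proof.
move=> pP pX pR uPR E; apply: T3_local => // P' X' R' pP' pX' pR' eP eX eR.
have [pA pC] := pt_take_drop pX'; congr (_ * _); apply: E => //.
  split; last by rewrite (perm_uniq (_ : perm_eq _ (P ++ R))) // perm_cat.
  by rewrite size_cat pP'.1 pR'.1.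
by rewrite cat_take_drop; case: pX'.
Qed.

(** The antisymmetrizer applied first in the next term cancels the factor [dlt3] left by the [e3] of
    [Nt], so terms compose as the operators do. *)
Lemma T3_sem_Nt a b c p r ks h A Y C : b = (p + r)%N -> (p <= c)%N -> (r <= a)%N ->
  size ks = (a - r)%N -> pt a A -> pt b Y -> pt c C -> uniq (A ++ C) ->
  T3 a b c (cur (sem (Nt a b c p r ks) h)) A Y C =
  opN a b c p r ks (T3 p (a + c) r (cur h)) A Y C.
Proof.
move=> bE pc ra sks pA pY pC uAC; set g := opN _ _ _ _ _ _ _.
rewrite -[RHS](T3_dlt pA pY pC); last exact: T3_sym.
apply: T3_local => // A' Y' C' pA' pY' pC' eA eY eC.
apply: sem_Nt => //.
by rewrite (perm_uniq (_ : perm_eq _ (A ++ C))) // perm_cat.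
Qed.

Lemma sem_MtNt a b c p r p0 r0 ls ks e h P X R :
  b = (p + r)%N -> (p <= c)%N -> (r <= a)%N -> size ls = (c - p)%N ->
  b = (p0 + r0)%N -> (p0 <= c)%N -> (r0 <= a)%N -> size ks = (a - r0)%N ->
  pt p P -> pt (a + c) X -> pt r R -> uniq (P ++ R) ->
  sem (Mt a b c p r ls e) (sem (Nt a b c p0 r0 ks) h) (P ++ X ++ R) =
  (-1) ^+ e * (dlt3 p (a + c) r P X R *
    opM a c p r ls (opN a b c p0 r0 ks (T3 p0 (a + c) r0 (cur h))) P X R).
Proof.
move=> bE pc ra sls bE0 pc0 ra0 sks pP pX pR uPR.
rewrite sem_Mt //; congr (_ * (_ * _)).
by apply: opM_local => // A Y C pA pY pC uAC; apply: T3_sem_Nt; rewrite // bE.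
Qed.

(** * The composites of the two morphisms for indexed summands *)

Section Index.
Variables (a b c : nat).

Definition idx_ok p r (al : (c - p).-tuple 'I_(a - r).+1) :=
  [/\ b = (p + r)%N, (p <= c)%N, (r <= a)%N & al \in parts (c - p) (a - r)].

Definition ko p r (al : (c - p).-tuple 'I_(a - r).+1) := ksof (c - p) (a - r) (lsof al).

(* The sign of the permutation which sorts the rows of the determinant that
   computes the composite of the two terms. *)
Definition sgno p r (al : (c - p).-tuple 'I_(a - r).+1) : bool :=
  epsilon (inhabits true) (fun e : bool => forall g P X R, sym3 p (a + c) r g ->
    pt p P -> pt (a + c) X -> pt r R -> uniq (P ++ R) ->
    opM a c p r (lsof al) (opN a b c p r (ko al) g) P X R = (-1) ^+ e * g P X R).

Definition Mo p r (al : (c - p).-tuple 'I_(a - r).+1) := Mt a b c p r (lsof al) (sgno al).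
Definition No p r (al : (c - p).-tuple 'I_(a - r).+1) := Nt a b c p r (ko al).

Lemma sgnoP p r (al : (c - p).-tuple 'I_(a - r).+1) : idx_ok al ->
  forall g P X R, sym3 p (a + c) r g ->
    pt p P -> pt (a + c) X -> pt r R -> uniq (P ++ R) ->
    opM a c p r (lsof al) (opN a b c p r (ko al) g) P X R = (-1) ^+ (sgno al) * g P X R.
Proof.
move=> [bE pc ra val]; rewrite /sgno; set Q := fun e : bool => _.
apply: (epsilon_spec (inhabits true) Q); rewrite /Q /ko bE.
apply: (opMN_same (n := (c - p + (a - r))%N)).
- exact: perm_ksof_lsof.
- by lia.
- by rewrite size_ksof // subnKC.
Qed.

Lemma MN_same p r (al : (c - p).-tuple 'I_(a - r).+1) : idx_ok al ->
  (Mo al \oc No al)%T =h e3 vx2 vx1 p (a + c) r.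
Proof.
move=> ok; have [bE pc ra val] := ok.
apply: sem_complete => h s; rewrite size_w3 => sz /generic_uniq us.
have [P [X [R [pP pX pR se]]]] := pt_cat3 sz us.
have uPR : uniq (P ++ R).
  by move: us; rewrite se uniq_catCA cat_uniq => /and3P[].
rewrite {}se sem_comp sem_MtNt ?size_lsof ?size_ksof // sgnoP //; last exact: T3_sym.
by rewrite sem_e3 // [X in _ * X]mulrCA signrMK.
Qed.

Lemma MN_diff p r p0 r0 (al : (c - p).-tuple 'I_(a - r).+1) (al0 : (c - p0).-tuple 'I_(a - r0).+1) :
  idx_ok al -> idx_ok al0 -> (lsof al != lsof al0) || (p != p0) ->
  (Mo al \oc No al0)%T =h tzero (wY a c p0 r0) (wY a c p r).
Proof.
move=> [bE pc ra val] [bE0 pc0 ra0 val0] ne.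
apply: sem_complete => h s; rewrite size_w3 => sz /generic_uniq us.
have [P [X [R [pP pX pR se]]]] := pt_cat3 sz us.
have uPR : uniq (P ++ R).
  by move: us; rewrite se uniq_catCA cat_uniq => /and3P[].
have nE : (c - p + (a - r) = c - p0 + (a - r0))%N by lia.
rewrite {}se sem_comp sem_MtNt ?size_lsof ?size_ksof //.
rewrite (@opMN_diff a b c p r p0 r0 (c - p + (a - r))) ?mulr0 ?size_lsof ?size_ksof ?subnK ?subnKC //.
- exact: T3_sym.
- by lia.
- by rewrite nE; apply: ksof_lt.
- exact: lsof_lt.
(* Complementary exponent sets would force [lsof al = lsof al0], hence equal lengths [c - p] and
   [c - p0], and then [p = p0] since both are at most [c]. *)
rewrite nE; apply/negP => pe.
have E := lsof_unique val0 pe (lsof_sorted val).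
have := congr1 size E; rewrite !size_lsof => pp.
move: ne; rewrite E eqxx /= => /eqP; apply; lia.
Qed.
End Index.

(** * The idempotents of the summands add up to the identity *)

Section Completeness.
Variables (a b c : nat).

Definition sumNM (h : fn) : fn := fun s =>
  \sum_(p < c.+1) \sum_(r < a.+1 | (p + r == b)%N)
    \sum_(al in parts (c - p) (a - r)) sem (No b al) (sem (Mo b al) h) s.

Lemma sem_sumNM u (f : term (wX a b c) u) h s : sem f (sumNM h) s =
  \sum_(p < c.+1) \sum_(r < a.+1 | (p + r == b)%N)
    \sum_(al in parts (c - p) (a - r)) sem f (sem (No b al) (sem (Mo b al) h)) s.
Proof.
rewrite /sumNM sem_sum; apply: eq_bigr => p _; rewrite sem_sum; apply: eq_bigr => r _.
by rewrite sem_sum.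
Qed.

Lemma idx_okI (p : 'I_c.+1) (r : 'I_a.+1) (al : (c - p).-tuple 'I_(a - r).+1) :
  (p + r == b)%N -> al \in parts (c - p) (a - r) -> idx_ok b al.
Proof. by move=> /eqP <- val; split; rewrite // -ltnS. Qed.

Lemma Mo_sumNM (p : 'I_c.+1) (r : 'I_a.+1) (al : (c - p).-tuple 'I_(a - r).+1) h s :
  (p + r == b)%N -> al \in parts (c - p) (a - r) ->
  size s = size (wY a c p r) -> generic s ->
  sem (Mo b al) (sumNM h) s = sem (Mo b al) h s.
Proof.
move=> prb val sz gs; have ok := idx_okI prb val.
rewrite sem_sumNM (bigD1 p) //= [X in _ + X]big1 => [|p0 nep]; last first.
  rewrite big1 // => r0 pr0; rewrite big1 // => al0 val0.
  rewrite (_ : sem _ _ s = sem (Mo b al \oc No b al0) (sem (Mo b al0) h) s) //.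
  rewrite (sem_sound (MN_diff ok (idx_okI pr0 val0) _)) //.
  by apply/orP; right; rewrite eq_sym.
rewrite addr0 (bigD1 r) //= [X in _ + X]big1 => [|r0 /andP[pr0 ner]]; last first.
  by case/eqP: ner; apply: val_inj; apply/eqP; rewrite -(eqn_add2l p) (eqP prb) (eqP pr0).
rewrite addr0 (bigD1 al) //= [X in _ + X]big1 => [|al0 /andP[val0 nea]]; last first.
  rewrite (_ : sem _ _ s = sem (Mo b al \oc No b al0) (sem (Mo b al0) h) s) //.
  rewrite (sem_sound (MN_diff ok (idx_okI prb val0) _)) //.
  by apply/orP; left; rewrite (inj_eq (@lsof_inj _ _)) eq_sym.
rewrite addr0 (_ : sem _ _ s = sem (Mo b al \oc No b al) (sem (Mo b al) h) s) //.
rewrite (sem_sound (MN_same ok)) // -sem_comp; apply: sem_sound => //; exact: e3_Mt.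
Qed.

Lemma sumNM_e3 h s : size s = size (wX a b c) -> generic s ->
  sem (e3 vx1 vx2 a b c) (sumNM h) s = sumNM h s.
Proof.
move=> sz gs; rewrite sem_sumNM; apply: eq_bigr => p _; apply: eq_bigr => r _.
apply: eq_bigr => al _; rewrite -sem_comp; apply: sem_sound => //; exact: e3_Nt.
Qed.

Lemma sumNM_id h s : (b <= a + c)%N -> size s = size (wX a b c) -> generic s ->
  sumNM h s = sem (e3 vx1 vx2 a b c) h s.
Proof.
move=> hb sz gs; apply/eqP; rewrite eq_sym -subr_eq0; apply/eqP.
(* The defect is fixed by [e3] and, by [Mo_sumNM], killed by every [Mo]; joint injectivity then
   applies to its symmetric part [G]. *)
pose u : fn := fun s => sem (e3 vx1 vx2 a b c) h s - sumNM h s.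
change (u s = 0).
have uE t : size t = size (wX a b c) -> generic t -> u t = sem (e3 vx1 vx2 a b c) u t.
  move=> szt gt; rewrite /u semD semN sumNM_e3 //; congr (_ - _).
  by rewrite -sem_comp -(sem_sound (e3_idem vx1 vx2 a b c)).
have [A [Y [C [pA pY pC se]]]] : exists A Y C, [/\ pt a A, pt b Y, pt c C & s = A ++ Y ++ C].
  by apply: pt_cat3; rewrite -?(size_w3 vx1 vx2) // generic_uniq.
rewrite uE // se sem_e3 //; set G := T3 a b c _.
suff -> : G A Y C = 0 by rewrite mulr0.
have uAC : uniq (A ++ C).
  by move: (generic_uniq gs); rewrite se uniq_catCA cat_uniq => /and3P[].
apply: (@opM_inj a b c (a + c - b)) => //; [exact: T3_sym|by rewrite subnK|].
move=> p r ls P R bE sls srt lls pP pR ePR.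
have pX : pt (a + c) (A ++ C) by split; rewrite // size_cat pA.1 pC.1.
(* The [c - p] distinct entries of [ls] lie below [a + c - b], and [b = p + r]: comparing the
   numbers gives the bound. *)
have ra : (r <= a)%N.
  have uls : uniq ls by move: srt; rewrite ltn_sorted_uniq_leq => /andP[].
  have : (size ls <= size (iota 0 (a + c - b)))%N.
    by apply: uniq_leq_size => // e /(allP lls) /= en; rewrite mem_iota.
  by rewrite size_iota; lia.
have pc : (p <= c)%N by rewrite -sls leq_addl.
have nE : (a + c - b = c - p + (a - r))%N by lia.
rewrite nE in lls.
have [|al val lsE] := lsof_surj srt lls; first by rewrite -sls addnK.
pose p' : 'I_c.+1 := Ordinal (pc : (p < c.+1)%N).
pose r' : 'I_a.+1 := Ordinal (ra : (r < a.+1)%N).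
have prb : (p' + r' == b)%N by rewrite bE.
have uPR : uniq (P ++ R) by rewrite (perm_uniq ePR); case: pY.
rewrite -(T3_dlt pP pX pR); last exact: T3_sym.
(* The zero function is written as a multiple so that [T3Z] evaluates it. *)
rewrite (T3_local (H' := fun _ _ _ => 0 * (fun _ _ _ => 0) A A A)) //.
  by rewrite (T3Z _ _ _ 0 (fun _ _ _ => 0)) mul0r.
move=> P' X' R' pP' pX' pR' eP eX eR.
have uPR' : uniq (P' ++ R') by rewrite (perm_uniq (_ : perm_eq _ (P ++ R))) // perm_cat.
have gt : generic (P' ++ X' ++ R').
  rewrite -(generic_perm (_ : perm_eq s _)) // se perm_sym.
  apply/seq.permP => q; rewrite !count_cat.
  rewrite (seq.permP eP) (seq.permP eX) (seq.permP eR) count_cat -(seq.permP ePR) count_cat; lia.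
have szt : size (P' ++ X' ++ R') = size (wY a c p r).
  by rewrite size_w3 !size_cat pP'.1 pX'.1 pR'.1 addnA.
have : sem (Mo b (al : (c - p').-tuple 'I_(a - r').+1)) u (P' ++ X' ++ R') = 0.
  rewrite semD semN (Mo_sumNM (p := p') (r := r')) // -sem_comp.
  by rewrite (sem_sound (Mt_e3 _ _ _ _ _ _ _)) // subrr.
rewrite sem_Mt ?size_lsof //.
rewrite -/(cur u) -/G lsE mul0r => /eqP; rewrite mulf_eq0 signr_eq0 /= => /eqP; exact.
Qed.
End Completeness.

(** * Assembly in the Karoubi envelope *)

Lemma hcomp_single X Y Z (M : hom Y Z) (N : hom X Y) y0 : (forall y, y = y0) ->
  forall x z, hcomp M N x z =h (M y0 z \oc N x y0)%T.
Proof.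
move=> E x z; apply: sem_complete => h s _ _; rewrite sem_big.
rewrite (big_pred1 y0) // => y; by rewrite /= (E y) eqxx.
Qed.

Definition divpow3 i j x y z := ktens (ktens (divpow i x) (divpow j y)) (divpow i z).

Lemma divpow3_single i j x y z (q : idx (kobj (divpow3 i j x y z))) : q = (tt, tt, tt).
Proof. by case: q => [[[] []] []]. Qed.

Lemma kobj_ok_divpow3 i j x y z t : kobj_ok (kshift t (divpow3 i j x y z)).
Proof.
split=> [q q'|q q'].
  by rewrite [X in homog X]/= subrr; apply: (homog_e3 i j x y z).
apply: teq_trans (e3_idem i j x y z).
exact: (hcomp_single _ _ (@divpow3_single i j x y z)).
Qed.

Section Pieces.
Variables (a b c : nat).
Let A := divpow3 vx1 vx2 a b c.

Definition eps p r (al : (c - p).-tuple 'I_(a - r).+1) : hom (kobj A) (kobj A) :=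
  fun _ _ => (No b al \oc Mo b al)%T.

Lemma retract_eps p r (al : (c - p).-tuple 'I_(a - r).+1) : idx_ok b al ->
  retract (eps al) (kshift ((2 * psize al)%N%:Z - ((c - p) * (a - r))%N%:Z)
                       (divpow3 vx2 vx1 p (a + c) r)).
Proof.
move=> ok; have [bE pc ra val] := ok; split; first exact: kobj_ok_divpow3.
set B := kshift _ _.
pose M : hom (kobj A) (kobj B) := fun _ _ => Mo b al.
pose N : hom (kobj B) (kobj A) := fun _ _ => No b al.
have sA := @divpow3_single vx1 vx2 a b c.
have sB : forall q : idx (kobj B), q = (tt, tt, tt) by exact: divpow3_single.
exists M, N; split.
- split=> q q'.
  + have -> : sh q - sh q' = (- (tri a)%:Z - (tri b)%:Z - (tri c)%:Z) -
      (- (tri p)%:Z - (tri (a + c))%:Z - (tri r)%:Z +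
       ((2 * psize al)%N%:Z - ((c - p) * (a - r))%N%:Z)) by rewrite /= !add0r.
    rewrite -(degree_M bE pc ra al); apply: homog_Mt; rewrite ?size_lsof //.
  + apply: teq_trans (e3_Mt a b c p r (lsof al) (sgno b al)); exact: (hcomp_single _ _ sB).
  + apply: teq_trans (Mt_e3 a b c p r (lsof al) (sgno b al)); exact: (hcomp_single _ _ sA).
- split=> q q'.
  + have -> : sh q - sh q' = (- (tri p)%:Z - (tri (a + c))%:Z - (tri r)%:Z +
       ((2 * psize al)%N%:Z - ((c - p) * (a - r))%N%:Z)) -
       (- (tri a)%:Z - (tri b)%:Z - (tri c)%:Z) by rewrite /= !add0r.
    rewrite -(degree_N bE pc ra val); apply: homog_Nt; rewrite ?size_ksof //.
  + apply: teq_trans (e3_Nt a b c p r (ko al)); exact: (hcomp_single _ _ sA).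
  + apply: teq_trans (Nt_e3 a b c p r (ko al)); exact: (hcomp_single _ _ sB).
- by move=> q q'; exact: (hcomp_single N M sB).
- move=> q q'; apply: teq_trans (MN_same ok); exact: (hcomp_single M N sA).
Qed.

Lemma eps_orth p r p0 r0 (al : (c - p).-tuple 'I_(a - r).+1)
    (al0 : (c - p0).-tuple 'I_(a - r0).+1) :
  idx_ok b al -> idx_ok b al0 -> (lsof al != lsof al0) || (p != p0) ->
  heq (hcomp (eps al) (eps al0)) (@hzero _ _).
Proof.
move=> ok ok0 ne q q'.
apply: teq_trans (hcomp_single _ _ (@divpow3_single vx1 vx2 a b c) q q') _.
apply: sem_complete => h s sz gs.
change (sem (No b al) (sem (Mo b al \oc No b al0) (sem (Mo b al0) h)) s = 0).
rewrite -[RHS](sem0 (No b al) s); apply: sem_ext_gen => // t szt gt.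
exact: (sem_sound (MN_diff ok ok0 ne)).
Qed.
End Pieces.

Theorem theorem3 (a b c : nat) (hb : (b <= a + c)%N) :
  kiso (ktens (ktens (divpow vx1 a) (divpow vx2 b)) (divpow vx1 c))
       (\big[ksum/kzero]_(p < c.+1)
          \big[ksum/kzero]_(r < a.+1 | (p + r == b)%N)
            \big[ksum/kzero]_(al in parts (c - p) (a - r))
              kshift ((2 * psize al)%N%:Z - ((c - p) * (a - r))%N%:Z)
                (ktens (ktens (divpow vx2 p) (divpow vx1 (a + c)))
                       (divpow vx2 r))).
Proof.
pose A := divpow3 vx1 vx2 a b c.
(* One endomorphism of the left-hand side for each level of the iterated direct sum. *)
pose eR (p : 'I_c.+1) (r : 'I_a.+1) : hom (kobj A) (kobj A) :=
  hsumv (index_enum _) (fun al : (c - p).-tuple 'I_(a - r).+1 => al \in parts (c - p) (a - r))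
    (fun al => @eps a b c p r al).
pose eP (p : 'I_c.+1) : hom (kobj A) (kobj A) :=
  hsumv (index_enum _) (fun r : 'I_a.+1 => (p + r == b)%N) (eR p).
pose eA : hom (kobj A) (kobj A) := hsumv (index_enum _) xpredT eP.
have okA : kobj_ok A.
  have [h1 h2] := kobj_ok_divpow3 vx1 vx2 a b c 0; split=> // q q'.
  by rewrite subrr; exact: (homog_e3 vx1 vx2 a b c).
apply: retract_kiso okA _; apply: (@retract_eq A eA).
  move=> q q'; apply: sem_complete => h s sz gs.
  transitivity (sumNM a b c h s); last exact: sumNM_id.
  rewrite /eA /eP /eR /hsumv sem_big; apply: eq_bigr => p _.
  by rewrite sem_big; apply: eq_bigr => r _; rewrite sem_big.
apply: retract_big => [|p p0 nep _ _|p _]; first exact: index_enum_uniq.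
  apply: orth_suml => r _ pr; apply: orth_sumr => r0 _ pr0.
  apply: orth_suml => al _ val; apply: orth_sumr => al0 _ val0.
  apply: eps_orth; [exact: idx_okI|exact: idx_okI|].
  by apply/orP; right; exact: nep.
apply: retract_big => [|r r0 ner pr pr0|r pr]; first exact: index_enum_uniq.
  (* For a given [p] the equation [p + r = b] leaves only one [r], so there is nothing to be
     orthogonal to. *)
  by case/eqP: ner; apply: val_inj; apply/eqP; rewrite -(eqn_add2l p) (eqP pr) (eqP pr0).
apply: retract_big => [|al al0 nea val val0|al val]; first exact: index_enum_uniq.
  apply: eps_orth; [exact: idx_okI|exact: idx_okI|].
  by rewrite (inj_eq (@lsof_inj _ _)) nea.
by apply: retract_eps; exact: idx_okI.
Qed.
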